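(* As the integer dimension $d\to\infty$, \[ \mathcal L^*(d)^{1/d}\to\frac12 , \] where $\mathcal L^*(d)$ is the normalized $L^1$ Nikolskii constant.
   Context: For an integer $d\ge1$, $\mathit{PW}_1^1(\mathbb R^d)$ is the class of functions $f\in L^1(\mathbb R^d)$ that are restrictions to $\mathbb R^d$ of entire functions on $\mathbb C^d$ of spherical exponential type at most $1$ (for every $\varepsilon>0$ there is $C_\varepsilon$ with $|f(z)|\le C_\varepsilon e^{(1+\varepsilon)|z|}$ for all $z\in\mathbb C^d$). The Nikolskii constant $\mathcal C_d$ is defined by \[ \mathcal C_d^{-1}=\inf\{\|f\|_{L^1(\mathbb R^d)}\colon f\in \mathit{PW}_1^1(\mathbb R^d),\ f(0)=1\}. \] Let $v_d=\pi^{d/2}/\Gamma(d/2+1)$ be the volume of the unit ball of $\mathbb R^d$. The normalized Nikolskii constant is $\mathcal L^*(d)=\dfrac{(2\pi)^d}{v_d}\,\mathcal C_d$. *)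

(* Defs.v *)
From HB Require Import structures.
From mathcomp Require Import all_boot all_order all_algebra.
From mathcomp Require Import complex.
From mathcomp Require Import all_classical all_reals all_analysis.

Set Implicit Arguments.
Unset Strict Implicit.
Unset Printing Implicit Defensive.

Import Order.TTheory GRing.Theory Num.Theory.
Import numFieldNormedType.Exports.

Local Open Scope classical_set_scope.
Local Open Scope ring_scope.
Local Open Scope complex_scope.

(* R^d, with the product of the Borel sigma-algebras of R. *)
Notation Rtuple R d := (d.-tuple (measurableTypeR R)).

Section lebesgue_cons.
Variables (R : realType) (d : nat).

Definition tuple_cons (p : measurableTypeR R * Rtuple R d) : Rtuple R d.+1 :=
  [tuple of p.1 :: p.2].

Let measurable_tuple_cons : measurable_fun setT tuple_cons.
Proof. exact: measurable_cons. Qed.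

HB.instance Definition _ :=
  isMeasurableFun.Build _ _ _ _ tuple_cons measurable_tuple_cons.

Variable mu : {sigma_finite_measure set (Rtuple R d) -> \bar R}.

Definition lebesgue_cons : set (Rtuple R d.+1) -> \bar R :=
  pushforward (@lebesgue_measure R \x mu)%E tuple_cons.

Let lebesgue_cons0 : lebesgue_cons set0 = 0%E.
Proof. exact: measure0. Qed.

Let lebesgue_cons_ge0 A : (0 <= lebesgue_cons A)%E.
Proof. exact: measure_ge0. Qed.

Let lebesgue_cons_sigma_additive : semi_sigma_additive lebesgue_cons.
Proof. exact: measure_semi_sigma_additive. Qed.

HB.instance Definition _ := isMeasure.Build _ _ _ lebesgue_cons
  lebesgue_cons0 lebesgue_cons_ge0 lebesgue_cons_sigma_additive.

Let sigma_finite_lebesgue_cons : sigma_finite setT lebesgue_cons.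
Proof.
have /sigma_finiteP[F [FT ndF mF]] := sigma_finiteT (@lebesgue_measure R).
have /sigma_finiteP[G [GT ndG mG]] := sigma_finiteT mu.
pose uncons (t : Rtuple R d.+1) : measurableTypeR R * Rtuple R d :=
  (thead t, [tuple of behead t]).
have uncons_cons p : uncons (tuple_cons p) = p.
  case: p => x t; rewrite /uncons /tuple_cons /=; congr pair.
  exact/val_inj.
have muncons : measurable_fun setT uncons.
  apply/measurable_fun_pair; first exact: measurable_tnth.
  exact: measurable_behead.
exists (fun i => uncons @^-1` (F i `*` G i)).
  rewrite -preimage_bigcup (_ : \bigcup_i _ = setT) ?preimage_setT//.
  rewrite -setXTT FT GT predeqE => -[x y]; split.
    by move=> [n _ []/= ? ?]; split; exists n.
  move=> [/= [n _ Fnx] [k _ Gky]]; exists (maxn n k) => //; split.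
  - by move: x Fnx; exact/subsetPset/ndF/leq_maxl.
  - by move: y Gky; exact/subsetPset/ndG/leq_maxr.
move=> i; have [mFi Fi] := mF i; have [mGi Gi] := mG i; split.
  rewrite -[X in measurable X]setTI; apply: muncons => //.
  exact: measurableX.
rewrite /lebesgue_cons /pushforward -comp_preimage.
rewrite (_ : uncons \o tuple_cons = id) ?preimage_id; last exact/funext.
by rewrite product_measure1E// lte_mul_pinfty// ge0_fin_numE.
Qed.

HB.instance Definition _ :=
  Measure_isSigmaFinite.Build _ _ _ lebesgue_cons sigma_finite_lebesgue_cons.

End lebesgue_cons.

(* Lebesgue measure on R^d, as the d-fold product of [lebesgue_measure]; on
   the one-point space R^0 it is the unit mass. *)
Fixpoint lebesgueRn (R : realType) (d : nat) :
    {sigma_finite_measure set (Rtuple R d) -> \bar R} :=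
  match d with
  | 0 => \d_([tuple] : Rtuple R 0)
  | d'.+1 => lebesgue_cons (lebesgueRn R d')
  end.

Lemma lebesgueRn_box (R : realType) d (A : 'I_d -> set (measurableTypeR R)) :
  (forall i, measurable (A i)) ->
  lebesgueRn R d [set t | forall i, A i (tnth t i)] = (\prod_(i < d) lebesgue_measure (A i))%E.
Proof.
elim: d A => [|d IH] A mA.
  rewrite big_ord0 /= diracE mem_set//=; by case.
rewrite big_ord_recl -IH//= /lebesgue_cons /pushforward -product_measure1E//.
  congr (_ _); apply/seteqP; split=> -[x t] /=.
    move=> h; split; first exact: (h ord0).
    by move=> i; have := h (lift ord0 i); rewrite tnthS.
  move=> [hx ht] i; case: (unliftP ord0 i) => [j ->|->//].
    by rewrite tnthS.
have -> : [set t : d.-tuple (measurableTypeR R) | forall i : 'I_d, A (lift ord0 i) (tnth t i)] = \bigcap_(i in [set: 'I_d]) ((fun t : d.-tuple (measurableTypeR R) => tnth t i) @^-1` A (lift ord0 i)).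
  by apply/seteqP; split=> [t h i _|t h i]; [exact: h|exact: (h i Logic.I)].
apply: fin_bigcap_measurable => // i _.
by rewrite -[X in measurable X]setTI; apply: measurable_tnth.
Qed.

Section nikolskii.
Variable R : realType.

(* Not [`|z|], which on ['rV[R[i]]_d] is the sup norm. *)
Definition euclidean_norm (d : nat) (z : 'rV[R[i]]_d) : R :=
  Num.sqrt (\sum_(i < d) Normc.normc (z ord0 i) ^+ 2).

(* Complex (Frechet) differentiability everywhere: ['rV[R[i]]_d] and [R[i]^o]
   are normed spaces over the field [R[i]] here. *)
Definition entire (d : nat) (F : 'rV[R[i]]_d -> R[i]) : Prop :=
  forall z, differentiable (F : _ -> R[i]^o) z.

Definition spherical_exp_type_le1 (d : nat) (F : 'rV[R[i]]_d -> R[i]) : Prop :=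
  forall e : R, 0 < e -> exists C : R, forall z : 'rV[R[i]]_d,
    Normc.normc (F z) <= C * expR ((1 + e) * euclidean_norm z).

Definition real_to_complex_vec (d : nat) (x : Rtuple R d) : 'rV[R[i]]_d :=
  \row_(i < d) (tnth x i : R)%:C.

(* A complex function is in L^1 when its real and imaginary parts are. *)
Definition inL1 (d : nat) (f : Rtuple R d -> R[i]) : Prop :=
  (lebesgueRn R d).-integrable setT (fun x => (complex.Re (f x))%:E) /\
  (lebesgueRn R d).-integrable setT (fun x => (complex.Im (f x))%:E).

Definition L1norm (d : nat) (f : Rtuple R d -> R[i]) : R :=
  \int[lebesgueRn R d]_x Normc.normc (f x).

Definition PW11 (d : nat) (f : Rtuple R d -> R[i]) : Prop :=
  inL1 f /\
  exists F : 'rV[R[i]]_d -> R[i],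
    [/\ entire F, spherical_exp_type_le1 F &
        forall x, f x = F (real_to_complex_vec x)].

(* The set is bounded below by 0 and its elements are finite L^1 norms, so the
   infimum is taken in R. *)
Definition nikolskii (d : nat) : R :=
  (inf [set L1norm f | f in [set f : Rtuple R d -> R[i] |
          PW11 f /\ f [tuple of nseq d (0 : measurableTypeR R)] = 1]])^-1.

(* Euler's integral; used for s >= 1 only. *)
Definition Gamma (s : R) : R :=
  \int[@lebesgue_measure R]_(t in `]0, +oo[) (t `^ (s - 1) * expR (- t)).

Definition unit_ball_volume (d : nat) : R :=
  pi `^ (d%:R / 2) / Gamma (d%:R / 2 + 1).

Definition normalized_nikolskii (d : nat) : R :=
  (2 * pi) ^+ d / unit_ball_volume d * nikolskii d.

End nikolskii.

(* Main.v *)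
(* Upper bound on the Nikolskii constant.  Let F be entire of exponential type at
   most tau > 1 with integrable restriction f to R^d.  On the strip
   |Re zeta| <= pi/2 consider the average over x in a box of
     |F(x sin zeta)| exp(- tau |x| Re cos zeta) |1 + cos zeta|^d.
   It is log-subharmonic in zeta.  On the two edges sin zeta = +-cosh y,
   Re cos zeta = 0 and |1 + cos zeta| = cosh y, so after the change of variables
   x -> x / cosh y it is at most ||f||_1; Phragmen-Lindelof extends this bound to
   zeta = 0, giving 2^d |F(0)| int exp(- tau |x|) dx <= ||f||_1.  Comparing
   exp(- |x|) with a Gaussian bounds the integral below by (2 pi d / e)^(d/2).

   Lower bound.  The square of H(|x|^2 / 4), with H(t^2) a discrete version of
   n! (2/t)^n J_n(t) and n close to d/2, has type 1.  It is O((4n / (e |x|))^(2n))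
   up to polynomial factors, and the same strip argument in one variable shows
   that H(t^2) is at most e n for real t.  Hence its L^1 norm is at most
   e^n (4 sqrt(pi n) / e)^d up to polynomial factors.

   Stirling-type bounds on Gamma(d/2 + 1) turn both estimates into
   2^-d exp(-26 sqrt d) <= L*(d) <= 2^-d exp(26 sqrt d). *)
Require Import Defs.
From mathcomp Require Import all_boot all_order all_algebra.
From mathcomp Require Import ring lra zify complex.
From mathcomp Require Import all_classical all_reals all_analysis measurable_realfun.
Set Implicit Arguments.
Unset Strict Implicit.
Unset Printing Implicit Defensive.
Import Order.TTheory GRing.Theory Num.Theory.
Import numFieldNormedType.Exports.
Local Open Scope classical_set_scope.
Local Open Scope ring_scope.
Local Open Scope complex_scope.
Import Normc.

(** * Entire functions of one variable *)

(** Both estimates have the same exponential size. The integral of [exp (- |x|)] is [d! v_d], which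
    is [(2 pi d / e)^(d/2)] up to polynomial factors. With [2 n] just above [d], the weakest
    integrable decay, the function [min (1, (4 n / (e |x|))^(2 n))] has, up to such factors, the
    integral of the ball of radius [2 d / e], namely [2^d (2 pi d / e)^(d/2)].

    The obstacle lies in Phragmen-Lindelof. In a strip of width pi the growth [exp (c cosh y)] is
    exactly critical: [exp (cos zeta)] has modulus 1 on both edges and is unbounded between them.
    The extra information comes from the imaginary axis, where [|sin zeta| <= cos zeta]: there the
    exponential weight cancels the growth of F and only a power of [cosh y] remains. The axis cuts
    the strip into two halves of width pi / 2, in which the same growth is subcritical. *)

Section ComplexBasics.
Variable R : realType.
Implicit Types z w h : R[i].

Lemma normr_normc z : `|z| = (normc z)%:C.
Proof. by case: z. Qed.

Lemma normc_ge0 z : 0 <= normc z.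
Proof. by case: z => a b /=; exact: sqrtr_ge0. Qed.

Lemma normc_gt0 z : (0 < normc z) = (z != 0).
Proof.
by rewrite -(ltcR 0 (normc z)) -normr_normc normr_gt0.
Qed.

Lemma normcD z w : normc (z + w) <= normc z + normc w.
Proof. exact: le_normcD. Qed.

Lemma normc_real (x : R) : normc x%:C = `|x|.
Proof. by rewrite /= expr0n addr0 sqrtr_sqr. Qed.

Lemma normcX z n : normc (z ^+ n) = normc z ^+ n.
Proof. by elim: n => [|n IH]; rewrite ?expr0 ?normc1// !exprS normcM IH. Qed.

Lemma Re_le_normc z : `|complex.Re z| <= normc z.
Proof.
case: z => a b /=; rewrite -sqrtr_sqr ler_wsqrtr// lerDl; exact: sqr_ge0.
Qed.

Lemma Im_le_normc z : `|complex.Im z| <= normc z.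
Proof.
case: z => a b /=; rewrite -sqrtr_sqr ler_wsqrtr// lerDr; exact: sqr_ge0.
Qed.

Lemma normc_le_ReIm z : normc z <= `|complex.Re z| + `|complex.Im z|.
Proof.
rewrite {1}(complexE z); apply: (le_trans (normcD _ _)).
by rewrite normcM !normc_real /= expr0n expr1n add0r sqrtr1 mul1r.
Qed.

(** The norm of [R[i]] is itself complex-valued; real [e] and [dl] with [normc] let all later
    estimates take place in [R]. *)
Definition cdiff_at (f : R[i] -> R[i]) z (D : R[i]) := forall e : R, 0 < e ->
  exists2 dl : R, 0 < dl & forall h, normc h < dl ->
    normc (f (z + h) - f z - D * h) <= e * normc h.

Lemma cdiffP (f : R[i] -> R[i]) z :
  differentiable (f : R[i]^o -> R[i]^o) (z : R[i]^o) <-> exists D, cdiff_at f z D.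
Proof.
split.
  move=> /derivable1_diffP df; pose D : R[i] := 'D_1 (f : R[i]^o -> R[i]^o) z.
  exists D => e e0.
  have /cvgrPdist_le /(_ e%:C) := df; rewrite ltcR => /(_ e0).
  rewrite -[lim _]/D => /nbhs_ballP [dl /= dl0 Hd].
  have dlR : dl = (complex.Re dl)%:C.
    by apply/esym/RRe_real/gtr0_real.
  exists (complex.Re dl); first by rewrite -ltcR -dlR.
  move=> h hdl; have [->|h0] := eqVneq h 0.
    by rewrite addr0 subrr mulr0 subr0 normc0 mulr0.
  have := Hd h; rewrite -ball_normE /= sub0r normrN => /(_ _ h0).
  rewrite dlR normr_normc ltcR => /(_ hdl).
  rewrite normr_normc lecR /= => H.
  have -> : f (z + h) - f z - D * h =
            - ((D - h^-1 * (f (h * 1 + z) - f z)) * h).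
    rewrite mulrBl mulr1 (addrC h z) mulrAC mulVf// mul1r opprB //.
  by rewrite normcN normcM ler_wpM2r// normc_ge0.
move=> [D HD]; apply/derivable1_diffP/cvg_ex; exists D.
apply/cvgrPdist_le => e e0.
have eR : e = (complex.Re e)%:C by apply/esym/RRe_real/gtr0_real.
have [|dl dl0 Hd] := HD (complex.Re e); first by rewrite -ltcR -eR.
apply/nbhs_ballP; exists dl%:C => /=; first by rewrite ltcR.
move=> h; rewrite -ball_normE /= sub0r normrN normr_normc ltcR => hdl h0.
rewrite normr_normc eR lecR -(ler_pM2r (x := normc h)) ?normc_gt0//.
rewrite -normcM; apply: le_trans (Hd h hdl).
have -> : (D - h^-1 *: ((f : R[i]^o -> R[i]^o) (h *: 1 + z) - f z)) * h
   = - (f (z + h) - f z - D * h).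
  rewrite [h *: 1]mulr1 (addrC h z) mulrBl [h^-1 *: _ * h]mulrAC mulVf// mul1r.
  by rewrite !opprB.
by rewrite normcN.
Qed.

Definition entire1 (f : R[i] -> R[i]) := forall z : R[i]^o, differentiable (f : R[i]^o -> R[i]^o) z.

Lemma entire1_cst a : entire1 (fun=> a).
Proof. by move=> z; exact: differentiable_cst. Qed.

Lemma entire1_id : entire1 id.
Proof. by move=> z; have [] := @is_diff_id _ R[i]^o z. Qed.

Lemma entire1D f g : entire1 f -> entire1 g -> entire1 (fun z => f z + g z).
Proof. by move=> hf hg z; exact: (differentiableD (hf z) (hg z)). Qed.

Lemma entire1M f g : entire1 f -> entire1 g -> entire1 (fun z => f z * g z).
Proof. by move=> hf hg z; exact: (differentiableM (hf z) (hg z)). Qed.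

Lemma entire1X f n : entire1 f -> entire1 (fun z => f z ^+ n).
Proof.
move=> hf; elim: n => [|n IH]; first exact: entire1_cst.
by under eq_fun do rewrite exprS; exact: entire1M.
Qed.

Lemma entire1_comp f g : entire1 f -> entire1 g -> entire1 (fun z => f (g z)).
Proof. by move=> hf hg z; exact: (differentiable_comp (hg z) (hf (g z))). Qed.

End ComplexBasics.

(** * The complex exponential, cosine and sine *)

Section CExp.
Variable R : realType.
Implicit Types z w h : R[i].

Lemma is_derive_small (f : R -> R) (x d : R) : is_derive x 1 f d ->
  forall e, 0 < e -> exists2 dl : R, 0 < dl &
    forall s, `|s| < dl -> `|f (x + s) - f x - d * s| <= e * `|s|.
Proof.
move=> [df dfE] e e0; move: df => /cvgrPdist_le /(_ _ e0).
rewrite -[lim _]/('D_1 f x) dfE => /nbhs_ballP [dl /= dl0 Hd].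
exists dl => // s sdl; have [->|s0] := eqVneq s 0.
  by rewrite addr0 subrr mulr0 subr0 normr0 mulr0.
have := Hd s; rewrite -ball_normE /= sub0r normrN => /(_ sdl s0) H.
have -> : f (x + s) - f x - d * s =
            - ((d - s^-1 * (f (s * 1 + x) - f x)) * s).
  rewrite mulrBl mulr1 (addrC s x) mulrAC mulVf// mul1r opprB //.
by rewrite normrN normrM ler_wpM2r.
Qed.

Definition cexp z : R[i] :=
  (expR (complex.Re z))%:C * (cos (complex.Im z) +i* sin (complex.Im z)).

Lemma cexp0 : cexp 0 = 1.
Proof. by rewrite /cexp /= expR0 cos0 sin0 mul1r. Qed.

Lemma cexpD z w : cexp (z + w) = cexp z * cexp w.
Proof.
case: z => a b; case: w => c d; rewrite /cexp /= expRD cosD sinD.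
by apply/eqP; rewrite eq_complex /=; apply/andP; split; apply/eqP; ring.
Qed.

Lemma normc_cexp z : normc (cexp z) = expR (complex.Re z).
Proof.
by rewrite /cexp normcM normc_real /= cos2Dsin2 sqrtr1 mulr1 ger0_norm ?expR_ge0.
Qed.

Lemma cdiff_cexp0 : cdiff_at cexp 0 1.
Proof.
move=> e e0.
(* With [m] this minimum, the error terms below add up to at most [7 * m * N]. *)
have e8 : 0 < Num.min 1 (e / 8) by rewrite lt_min ltr01 divr_gt0.
have [d1 d10 H1] := is_derive_small (is_derive_expR 0) e8.
have [d2 d20 H2] := is_derive_small (is_derive_cos 0) e8.
have [d3 d30 H3] := is_derive_small (is_derive_sin 0) e8.
exists (Num.min (Num.min 1 (e / 8)) (Num.min d1 (Num.min d2 d3))).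
  by rewrite !lt_min ltr01 d10 d20 divr_gt0.
move=> h; rewrite lt_min => /andP[h1]; rewrite !lt_min => /and3P[hd1 hd2 hd3].
have hx := Re_le_normc h; have hy := Im_le_normc h.
rewrite add0r cexp0 mul1r.
move: h1 hd1 hd2 hd3 hx hy; case: h => x y; set N := normc _.
rewrite /cexp /= => N1 Nd1 Nd2 Nd3 hx hy.
have := H1 x (le_lt_trans hx Nd1); have := H2 y (le_lt_trans hy Nd2).
have := H3 y (le_lt_trans hy Nd3).
rewrite !add0r expR0 cos0 sin0 oppr0 mul0r !subr0 !mul1r => S C E.
have e88 : Num.min 1 (e/8) <= e / 8 by rewrite ge_min lexx orbT.
have e81 : Num.min 1 (e/8) <= 1 by rewrite ge_min lexx.
set m := Num.min _ _ in e8 N1 H1 H2 H3 S C E e88 e81.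
have N0 : 0 <= N by exact: normc_ge0.
have mul_le (a b A B : R) : `|a| <= A -> `|b| <= B -> `|a * b| <= A * B.
  by move=> ? ?; rewrite normrM ler_pM.
apply: (le_trans (normc_le_ReIm (_ +i* _))); rewrite /=.
have -> : expR x * cos y - 0 * sin y - 1 - x =
   (expR x - 1 - x) * cos y + (1 + x) * (cos y - 1) by ring.
rewrite addr0 in S.
have -> : expR x * sin y + 0 * cos y + 0 - y =
  (expR x - 1 - x) * sin y + x * sin y + (sin y - y) by ring.
have x1 : `|x| <= 1 by apply: le_trans hx _; apply: le_trans (ltW N1) _.
have ax : `|1 + x| <= 2 by rewrite (le_trans (ler_normD _ _))// normr1; lra.
have cb : `|cos y| <= 1 by rewrite ler_norml cos_geN1 cos_le1.
have sb : `|sin y| <= 1 by rewrite ler_norml sin_geN1 sin_le1.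
have mN : m * `|x| <= m * N by rewrite ler_wpM2l// ltW.
have mN' : m * `|y| <= m * N by rewrite ler_wpM2l// ltW.
have E' := le_trans E mN; have C' := le_trans C mN'; have S' := le_trans S mN'.
have T1 := mul_le _ _ _ _ E' cb; have T2 := mul_le _ _ _ _ ax C'.
have T3 := mul_le _ _ _ _ E' sb.
have Nm : N * m <= N * 1 by rewrite ler_wpM2l.
have T4 : `|x * sin y| <= N * (2 * m).
  apply: mul_le => //.
  have -> : sin y = (sin y - y) + y by ring.
  apply: le_trans (ler_normD _ _) _.
  have : m * N <= 1 * m by rewrite mulrC ler_wpM2r// ltW// (lt_le_trans N1).
  move: (ltW N1) hy S'; lra.
have P1 := ler_normD ((expR x - 1 - x) * cos y) ((1 + x) * (cos y - 1)).
have P2 := ler_normD ((expR x - 1 - x) * sin y + x * sin y) (sin y - y).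
have P3 := ler_normD ((expR x - 1 - x) * sin y) (x * sin y).
have Ne : N * m <= N * (e / 8) by rewrite ler_wpM2l.
have := mulr_ge0 N0 (ltW e0); lra.
Qed.

Lemma entire1_cexp : entire1 cexp.
Proof.
move=> z; apply/cdiffP; exists (cexp z) => e e0.
have z0 : 0 < normc (cexp z) by rewrite normc_cexp expR_gt0.
have [|dl dl0 H] := @cdiff_cexp0 (e / normc (cexp z)); first by rewrite divr_gt0.
exists dl => // h /H; rewrite add0r cexp0 mul1r => {}H.
have -> : cexp (z + h) - cexp z - cexp z * h = cexp z * (cexp h - 1 - h).
  by rewrite cexpD; ring.
rewrite normcM; apply: le_trans (ler_wpM2l (ltW z0) H) _.
by rewrite mulrA mulrCA divff ?mulr1// gt_eqF.
Qed.

Definition ccos z : R[i] := (2^-1)%:C * (cexp ('i * z) + cexp (- 'i * z)).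
Definition csin z : R[i] := (0 -i* 2^-1) * (cexp ('i * z) - cexp (- 'i * z)).

Lemma entire1_ccos : entire1 ccos.
Proof.
apply: entire1M; first exact: entire1_cst.
by apply: entire1D; apply: entire1_comp entire1_cexp _;
  apply: entire1M; [exact: entire1_cst|exact: entire1_id
    |exact: entire1_cst|exact: entire1_id].
Qed.

Lemma entire1_csin : entire1 csin.
Proof.
apply: entire1M; first exact: entire1_cst.
under eq_fun do rewrite -mulN1r.
by apply: entire1D; [|apply: entire1M; first exact: entire1_cst];
  apply: entire1_comp entire1_cexp _;
  apply: entire1M; [exact: entire1_cst|exact: entire1_id
    |exact: entire1_cst|exact: entire1_id].
Qed.

Lemma ccosE (x y : R) : ccos (x +i* y) =
  (cos x * ((expR y + expR (- y)) / 2)) +i*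
   - (sin x * ((expR y - expR (- y)) / 2)).
Proof.
rewrite /ccos /cexp /= !(mul0r, mul1r, mulN1r, add0r, addr0, sub0r, oppr0, opprK, mulr0, subr0, mulNr).
rewrite cosN sinN.
by apply/eqP; rewrite eq_complex /=; apply/andP; split; apply/eqP; ring.
Qed.

Lemma csinE (x y : R) : csin (x +i* y) =
  (sin x * ((expR y + expR (- y)) / 2)) +i*
   (cos x * ((expR y - expR (- y)) / 2)).
Proof.
rewrite /csin /cexp /= !(mul0r, mul1r, mulN1r, add0r, addr0, sub0r, oppr0, opprK, mulr0, subr0, mulNr).
rewrite cosN sinN.
by apply/eqP; rewrite eq_complex /=; apply/andP; split; apply/eqP; ring.
Qed.

End CExp.

(** * Integrals of continuous functions over segments *)

Section IntegralSegment.
Variable R : realType.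
Local Notation mu := (@lebesgue_measure R).
Implicit Types (f g : R -> R) (a b c M : R).

Lemma continuous_integrable_itv f a b : continuous f ->
  mu.-integrable `[a, b] (EFin \o f).
Proof.
move=> cf; apply: continuous_compact_integrable; first exact: segment_compact.
exact: continuous_subspaceT.
Qed.

Lemma Rintegral_itv_cst (c a b : R) : a <= b ->
  \int[mu]_(x in `[a, b]) c = c * (b - a).
Proof.
move=> ab; rewrite Rintegral_cst// -[fine _]/(fine (lebesgue_measure `[a, b])).
rewrite lebesgue_measure_itv/= lte_fin.
by case: ifPn => //; rewrite -leNgt => ba; rewrite (@le_anti _ _ a b) ?subrr ?ab.
Qed.

Lemma Rintegral_itv_split f a m b : continuous f -> a <= m -> m <= b ->
  \int[mu]_(x in `[a, b]) f x =
  \int[mu]_(x in `[a, m]) f x + \int[mu]_(x in `[m, b]) f x.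
Proof.
move=> cf am mb.
have := @Rintegral_itvB R f (BLeft a) (BRight b) m (continuous_integrable_itv _ _ cf).
rewrite !bnd_simp => /(_ am mb) /eqP; rewrite subr_eq => /eqP ->.
rewrite addrC Rintegral_itv_obnd_cbnd//.
apply: integrableS (continuous_integrable_itv m b cf) => //.
by apply: subset_itvr; rewrite bnd_simp.
Qed.

Lemma Rintegral_itv_close f a b c M : continuous f -> a <= b ->
  (forall x, a <= x <= b -> `|f x - c| <= M) ->
  `|\int[mu]_(x in `[a, b]) f x - c * (b - a)| <= M * (b - a).
Proof.
move=> cf ab H.
rewrite -Rintegral_itv_cst// -RintegralB//; last 2 first.
- exact: continuous_integrable_itv.
- by apply: continuous_integrable_itv => x; exact: cvg_cst.
have cc : continuous (fun x => f x - c) by move=> x; apply: cvgB; [exact: cf|exact: cvg_cst].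
apply: (le_trans (le_normr_Rintegral _ _)) => //; first exact: continuous_integrable_itv.
rewrite -Rintegral_itv_cst//; apply: le_Rintegral => //.
- by apply: continuous_integrable_itv => x; apply: cvg_norm; exact: cc.
- by apply: continuous_integrable_itv => x; exact: cvg_cst.
Qed.

Lemma continuousB_fun f g : continuous f -> continuous g -> continuous (fun x => f x - g x).
Proof. by move=> cf cg x; apply: cvgB; [exact: cf|exact: cg]. Qed.

End IntegralSegment.

(** * Goursat's theorem for divergence-free fields *)

Section Goursat.
Variable R : realType.
Local Notation mu := (@lebesgue_measure R).
Variables p q : R -> R -> R.

(* (q, p) is differentiable with zero divergence; only pointwise
   differentiability is assumed, as in Goursat's theorem. *)
Hypothesis div0 : forall x y, exists al be ga : R, forall e, 0 < e ->
  exists2 dl : R, 0 < dl & forall s t, `|s| < dl -> `|t| < dl ->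
    `|q (x + s) (y + t) - q x y - (al * s + be * t)| <= e * (`|s| + `|t|) /\
    `|p (x + s) (y + t) - p x y - (ga * s - al * t)| <= e * (`|s| + `|t|).

Hypothesis cont_q : forall x, continuous (q x).
Hypothesis cont_p : forall y, continuous (p ^~ y).

Let flux (a b c d : R) : R :=
  \int[mu]_(y in `[c, d]) (q b y - q a y) +
  \int[mu]_(x in `[a, b]) (p x d - p x c).

Let flux_splitx a m b c d : a <= m -> m <= b ->
  flux a b c d = flux a m c d + flux m b c d.
Proof.
move=> am mb; rewrite /flux (@Rintegral_itv_split _ _ a m b)//; last exact: continuousB_fun.
have Iq u v : mu.-integrable `[c, d] (EFin \o (fun y => q u y - q v y)).
  by apply: continuous_integrable_itv; exact: continuousB_fun.
rewrite addrACA -RintegralD//; congr (_ + _).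
by apply: eq_Rintegral => y _; rewrite /=; ring.
Qed.

Let flux_splity a b c m d : c <= m -> m <= d ->
  flux a b c d = flux a b c m + flux a b m d.
Proof.
move=> am mb; rewrite /flux (@Rintegral_itv_split _ _ c m d)//; last exact: continuousB_fun.
have Ip u v : mu.-integrable `[a, b] (EFin \o (fun x => p x u - p x v)).
  by apply: continuous_integrable_itv; exact: continuousB_fun.
rewrite addrACA -RintegralD//; congr (_ + _).
by apply: eq_Rintegral => y _; rewrite /=; ring.
Qed.

Let rect : Type := (R * R * (R * R))%type.
Let bad (e : R) (r : rect) : bool :=
  let: ((a, b), (c, d)) := r in
  [&& a <= b, c <= d & e * ((b - a) * (d - c)) < `|flux a b c d|].

Let halfx e (r : rect) : rect :=
  let: ((a, b), (c, d)) := r in let m := (a + b) / 2 in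
  if bad e ((a, m), (c, d)) then ((a, m), (c, d)) else ((m, b), (c, d)).
Let halfy e (r : rect) : rect :=
  let: ((a, b), (c, d)) := r in let m := (c + d) / 2 in
  if bad e ((a, b), (c, m)) then ((a, b), (c, m)) else ((a, b), (m, d)).

Let bad_halfx e r : bad e r -> bad e (halfx e r).
Proof.
case: r => -[a b] [c d] /= /and3P[ab cd].
case: ifPn => // nb; rewrite /bad.
have am : a <= (a + b) / 2 by lra.
have mb : (a + b) / 2 <= b by lra.
rewrite (flux_splitx _ _ am mb) => H; rewrite cd mb /=.
move: nb; rewrite /bad am cd /= -leNgt => nb.
have := lt_le_trans H (ler_normD _ _); nra.
Qed.

Let bad_halfy e r : bad e r -> bad e (halfy e r).
Proof.
case: r => -[a b] [c d] /= /and3P[ab cd].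
case: ifPn => // nb; rewrite /bad.
have am : c <= (c + d) / 2 by lra.
have mb : (c + d) / 2 <= d by lra.
rewrite (flux_splity _ _ am mb) => H; rewrite ab mb /=.
move: nb; rewrite /bad am ab /= -leNgt => nb.
have := lt_le_trans H (ler_normD _ _); nra.
Qed.

(** If the flux were non-zero, bisection in both directions would give nested rectangles whose flux
    always exceeds [e] times their area. Around the common point the affine part of the field has
    zero flux, as [al * u * v] and [- (al * v) * u] cancel, and the remainder is too small for
    that. *)
Lemma goursat a b c d : a < b -> c < d ->
  \int[mu]_(y in `[c, d]) (q b y - q a y) +
  \int[mu]_(x in `[a, b]) (p x d - p x c) = 0.
Proof.
move=> ab cd; rewrite -/(flux a b c d).
apply/eqP; apply/negPn/negP => fne0.
pose U := b - a; pose V := d - c.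
have U0 : 0 < U by rewrite subr_gt0.
have V0 : 0 < V by rewrite subr_gt0.
pose e := `|flux a b c d| / (U * V + 1).
have UV0 : 0 < U * V + 1 by rewrite ltr_wpDl// mulr_ge0// ltW.
have e0 : 0 < e by rewrite divr_gt0// normr_gt0.
have bad0 : bad e ((a, b), (c, d)).
  rewrite /bad !ltW//= -/U -/V /e mulrAC ltr_pdivrMr// ltr_pM2l ?normr_gt0//.
  by rewrite ltrDl.
pose rn n := iter n (fun r => halfy e (halfx e r)) ((a, b), (c, d)).
pose an n := (rn n).1.1; pose bn n := (rn n).1.2.
pose cn n := (rn n).2.1; pose dn n := (rn n).2.2.
have badn n : bad e (rn n).
  by elim: n => [//|n IH]; rewrite /rn iterS; apply: bad_halfy; exact: bad_halfx.
have step n : [/\ an n <= an n.+1, bn n.+1 <= bn n, cn n <= cn n.+1, dn n.+1 <= dn n &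
   bn n.+1 - an n.+1 = (bn n - an n) / 2 /\ dn n.+1 - cn n.+1 = (dn n - cn n) / 2].
  have := badn n; rewrite /an /bn /cn /dn /rn iterS -/(rn n).
  case: (rn n) => -[x1 x2] [y1 y2] /and3P[h1 h2 _].
  by rewrite /halfx; case: ifP => _; rewrite /halfy; case: ifP => _ /=; split; try split; lra.

have lenx n : bn n - an n = U / 2 ^+ n.
  elim: n => [|n IH]; first by rewrite expr0 divr1.
  by have [_ _ _ _ [-> _]] := step n; rewrite IH exprSr invfM mulrA.
have leny n : dn n - cn n = V / 2 ^+ n.
  elim: n => [|n IH]; first by rewrite expr0 divr1.
  by have [_ _ _ _ [_ ->]] := step n; rewrite IH exprSr invfM mulrA.
have pow0 n : 0 < (2 : R) ^+ n by rewrite exprn_gt0.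
have nested (u v : nat -> R) : (forall n, u n <= u n.+1) -> (forall n, v n.+1 <= v n) ->
    (forall n, u n <= v n) -> exists x, forall n, u n <= x <= v n.
  move=> hu hv huv.
  have mu_ n m : (n <= m)%N -> u n <= u m.
    by elim: m => [|m IH]; [rewrite leqn0 => /eqP ->|rewrite leq_eqVlt ltnS => /predU1P[->//|/IH]/le_trans->].
  have mv n m : (n <= m)%N -> v m <= v n.
    elim: m => [|m IH]; [by rewrite leqn0 => /eqP ->|rewrite leq_eqVlt ltnS => /predU1P[->//|/IH]].
    exact: le_trans.
  have uv n m : u n <= v m.
    apply: (le_trans (mu_ n (maxn n m) (leq_maxl _ _))).
    by apply: (le_trans (huv _)); exact: mv (leq_maxr _ _).
  have ub m : ubound (range u) (v m) by move=> _ [n _ <-].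
  exists (sup (range u)) => n; apply/andP; split.
    by apply: ub_le_sup; [exists (v 0%N); exact: ub|exists n].
  by apply: ge_sup; [exists (u 0%N), 0%N|exact: ub].
have [xs hxs] : exists x, forall n, an n <= x <= bn n.
  by apply: nested => n; have [] := step n => // _ _ _ _ _; rewrite -subr_ge0 lenx divr_ge0 ?ltW.
have [ys hys] : exists x, forall n, cn n <= x <= dn n.
  by apply: nested => n; have [] := step n => // _ _ _ _ _; rewrite -subr_ge0 leny divr_ge0 ?ltW.
have [al [be [ga Hd]]] := div0 xs ys.
(* Both sides are halved at each stage, so [u * v / (u + v)^2] keeps the value [U * V / (U + V)^2].
   The remainder on such a rectangle is at most [2 e' (u + v)^2], which is half of [e * (u * v)]. *)
pose e' := e * (U * V) / (4 * (U + V) ^+ 2).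
have UV : 0 < U + V by rewrite addr_gt0.
have e'0 : 0 < e' by apply: divr_gt0; apply: mulr_gt0 => //; [exact: mulr_gt0|exact: exprn_gt0].
have [dl dl0 {}Hd] := Hd _ e'0.
have [n Hn] : exists n, (U + V) / 2 ^+ n < dl.
  have [n Hn] : exists n, (U + V) / dl < n%:R.
    by exists (Num.bound ((U + V) / dl)); rewrite archi_boundP// divr_ge0 ?ltW.
  exists n; rewrite ltr_pdivrMr// mulrC -ltr_pdivrMr// (lt_trans Hn)//.
  by rewrite -natrX ltr_nat ltn_expl.
have := badn n; move: (lenx n) (leny n) (hxs n) (hys n).
rewrite /an /bn /cn /dn; case: (rn n) => -[x1 x2] [y1 y2] /= lx ly hx hy.
set u := U / 2 ^+ n in lx; set v := V / 2 ^+ n in ly.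
have u0 : 0 < u by rewrite divr_gt0. have v0 : 0 < v by rewrite divr_gt0.
have uvdl : u + v < dl by rewrite /u /v -mulrDl.
have e'E : 4 * e' * (u + v) ^+ 2 = e * (u * v).
  rewrite /e' /u /v -mulrDl; field.
  by rewrite !gt_eqF.
move=> /and3P[_ _]; rewrite lx ly; apply/negP; rewrite -leNgt.
have Hq x y : x1 <= x <= x2 -> y1 <= y <= y2 ->
    `|q x y - q xs ys - (al * (x - xs) + be * (y - ys))| <= e' * (u + v) /\
    `|p x y - p xs ys - (ga * (x - xs) - al * (y - ys))| <= e' * (u + v).
  move=> xx yy.
  have xu : `|x - xs| <= u by rewrite ler_norml; apply/andP; split; lra.
  have yv : `|y - ys| <= v by rewrite ler_norml; apply/andP; split; lra.
  have [] := Hd (x - xs) (y - ys); [lra|lra|].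
  rewrite !(addrC _ (_ - _)) !subrK => h1 h2.
  by split; [apply: (le_trans h1)|apply: (le_trans h2)]; rewrite ler_pM2l// lerD.
have x12 : x1 <= x2 by lra. have y12 : y1 <= y2 by lra.
have B1 : `|\int[mu]_(y in `[y1, y2]) (q x2 y - q x1 y) - al * u * (y2 - y1)| <= 2 * e' * (u + v) * (y2 - y1).
  apply: Rintegral_itv_close => //; first exact: continuousB_fun.
  move=> y yy; have [h1 _] := Hq x1 y (introT andP (conj (lexx _) x12)) yy.
  have [h2 _] := Hq x2 y (introT andP (conj x12 (lexx _))) yy.
  move: h1 h2; rewrite -lx !ler_norml => /andP[? ?] /andP[? ?]; apply/andP; split; lra.
have B2 : `|\int[mu]_(x in `[x1, x2]) (p x y2 - p x y1) - (- (al * v)) * (x2 - x1)| <= 2 * e' * (u + v) * (x2 - x1).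
  apply: Rintegral_itv_close => //; first exact: continuousB_fun.
  move=> x xx; have [_ h1] := Hq x y1 xx (introT andP (conj (lexx _) y12)).
  have [_ h2] := Hq x y2 xx (introT andP (conj y12 (lexx _))).
  move: h1 h2; rewrite -ly !ler_norml => /andP[? ?] /andP[? ?]; apply/andP; split; lra.
rewrite lx ly in B1 B2; rewrite -e'E /flux.
move: B1 B2; set I1 := Rintegral _ _ _; set I2 := Rintegral _ _ _ => B1 B2.
have -> : I1 + I2 = (I1 - al * u * v) + (I2 - - (al * v) * u) by ring.
apply: le_trans (ler_normD _ _) _; apply: le_trans (lerD B1 B2) _.
rewrite -subr_ge0 (_ : _ - _ = 2 * e' * (u + v) ^+ 2); last by ring.
by rewrite mulr_ge0 ?sqr_ge0// mulr_ge0// ltW.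
Qed.

End Goursat.

(** * The mean value property of entire functions *)

Section MeanValue.
Variable R : realType.
Local Notation mu := (@lebesgue_measure R).
Implicit Types (z w h : R[i]) (f g phi : R[i] -> R[i]).

Lemma entire1_continuous f z (e : R) : entire1 f -> 0 < e ->
  exists2 dl : R, 0 < dl & forall h, normc h < dl -> normc (f (z + h) - f z) < e.
Proof.
move=> hf e0; have /cdiffP[D HD] := hf z.
have [dl dl0 H] := HD _ ltr01.
have K0 : 0 < normc D + 1 by rewrite ltr_wpDl// normc_ge0.
exists (Num.min dl (e / (normc D + 1))); first by rewrite lt_min dl0 divr_gt0.
move=> h; rewrite lt_min => /andP[/H hd]; rewrite ltr_pdivlMr// => he.
rewrite -(subrK (D * h) (f (z + h) - f z)).
apply: le_lt_trans (normcD _ _) _; apply: le_lt_trans he.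
by rewrite mul1r in hd; rewrite mulrDr mulr1 addrC normcM (mulrC (normc D)) lerD2l.
Qed.

Lemma lipschitz_normc z w : `|normc z - normc w| <= normc (z - w).
Proof.
have h1 := normcD (z - w) w; have h2 := normcD (w - z) z.
rewrite !subrK -opprB normcN in h1 h2 *.
by rewrite ler_norml; apply/andP; split; lra.
Qed.

(** An arbitrary 1-Lipschitz [G] covers the real part, the opposite of the imaginary part and the
    modulus at once. *)
Lemma entire1_continuous_path (T : topologicalType) f (G : R[i] -> R) (al be : T -> R) :
  (forall z w, `|G z - G w| <= normc (z - w)) ->
  entire1 f -> continuous al -> continuous be ->
  continuous (fun t => G (f (al t +i* be t))).
Proof.
move=> hG hf ca cb t; apply/cvgrPdist_lt => e e0.
have [dl dl0 H] := entire1_continuous (al t +i* be t) hf e0.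
have dl2 : 0 < dl / 2 by rewrite divr_gt0.
near=> s; rewrite distrC; apply: le_lt_trans (hG _ _) _.
have -> : al s +i* be s = (al t +i* be t) + ((al s - al t) +i* (be s - be t)).
  by apply/eqP; rewrite eq_complex /= !(addrC _ (_ - _)) !subrK !eqxx.
apply: H; apply: (le_lt_trans (normc_le_ReIm (_ +i* _))); rewrite /=.
rewrite (splitr dl) ltrD//.
- by near: s; move/cvgrPdist_lt : (ca t) => /(_ _ dl2); under eq_near do rewrite distrC.
- by near: s; move/cvgrPdist_lt : (cb t) => /(_ _ dl2); under eq_near do rewrite distrC.
Unshelve. all: by end_near. Qed.

Lemma Re_sub z w : complex.Re (z - w) = complex.Re z - complex.Re w.
Proof. by case: z; case: w. Qed.
Lemma Im_sub z w : complex.Im (z - w) = complex.Im z - complex.Im w.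
Proof. by case: z; case: w. Qed.

Lemma lipschitz_Re z w : `|complex.Re z - complex.Re w| <= normc (z - w).
Proof. by rewrite -Re_sub Re_le_normc. Qed.

Lemma lipschitz_NIm z w : `|- complex.Im z - - complex.Im w| <= normc (z - w).
Proof. by rewrite -opprD normrN -Im_sub Im_le_normc. Qed.

Lemma entire1_div0 f : entire1 f -> forall x y, exists al be ga : R, forall e, 0 < e ->
  exists2 dl : R, 0 < dl & forall s t, `|s| < dl -> `|t| < dl ->
    `|complex.Re (f ((x + s) +i* (y + t))) - complex.Re (f (x +i* y)) - (al * s + be * t)|
       <= e * (`|s| + `|t|) /\
    `|- complex.Im (f ((x + s) +i* (y + t))) - - complex.Im (f (x +i* y)) - (ga * s - al * t)|
       <= e * (`|s| + `|t|).
Proof.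
move=> hf x y; have /cdiffP[D HD] := hf (x +i* y).
exists (complex.Re D), (- complex.Im D), (- complex.Im D) => e e0.
have [dl dl0 H] := HD _ e0; exists (dl / 2); first by rewrite divr_gt0.
move=> s t sd td.
have st := normc_le_ReIm (s +i* t); rewrite [X in _ <= X]/= in st.
have {}H := H (s +i* t) (le_lt_trans st _).
have sE : (x + s) +i* (y + t) = (x +i* y) + (s +i* t) by [].
rewrite sE.
have {}H : normc (f ((x +i* y) + (s +i* t)) - f (x +i* y) - D * (s +i* t)) <= e * (`|s| + `|t|).
  apply: le_trans (H _) _; first by rewrite (splitr dl) ltrD.
  by rewrite ler_pM2l.
move: H; set W := f (_ + _); set Z := f _ => H.
split; apply: le_trans H.
  apply: le_trans (Re_le_normc _); rewrite !Re_sub; case: (D) => a b /=.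
  by rewrite mulNr.
apply: le_trans (Im_le_normc _); rewrite !Im_sub -normrN; case: (D) => a b /=.
by rewrite le_eqVlt; apply/orP; left; apply/eqP; congr `|_|; ring.
Qed.

Lemma entire1_polar phi z0 : entire1 phi -> entire1 (fun u => phi (z0 + cexp u)).
Proof.
move=> h; apply: (entire1_comp h); apply: entire1D; first exact: entire1_cst.
exact: entire1_cexp.
Qed.

Lemma cexp_2pi (x : R) : cexp (x +i* (pi *+ 2)) = cexp (x +i* 0).
Proof. by rewrite /cexp /= cos2pi sin2pi cos0 sin0. Qed.

Lemma continuous_fun_cst (T : topologicalType) (c : R) : continuous (fun _ : T => c).
Proof. by move=> x; exact: cvg_cst. Qed.

Lemma continuous_fun_id : continuous (fun x : R => x).
Proof. by move=> x; exact: cvg_id. Qed.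

(* Goursat on [a, ln r] x [0, 2 pi] for u |-> phi (z0 + exp u): the horizontal
   sides cancel by periodicity, and a -> -oo gives the value at z0. *)
Lemma mean_value_Re phi z0 (r : R) : entire1 phi -> 0 < r ->
  \int[mu]_(t in `[0, pi *+ 2]) complex.Re (phi (z0 + r%:C * cexp (0 +i* t))) =
  complex.Re (phi z0) * (pi *+ 2).
Proof.
move=> hphi r0.
pose psi u := phi (z0 + cexp u).
have hpsi : entire1 psi by exact: entire1_polar.
pose q x y := complex.Re (psi (x +i* y)).
pose p x y := - complex.Im (psi (x +i* y)).
have cq x : continuous (q x).
  apply: (entire1_continuous_path lipschitz_Re hpsi); first exact: continuous_fun_cst.
  exact: continuous_fun_id.
have cp y : continuous (p ^~ y).
  apply: (entire1_continuous_path lipschitz_NIm hpsi); first exact: continuous_fun_id.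
  exact: continuous_fun_cst.
have pi2 : 0 < (pi : R) *+ 2 by rewrite mulrn_wgt0// pi_gt0.
pose M x := \int[mu]_(y in `[0, pi *+ 2]) q x y.
have Mab a b : a < b -> M a = M b.
  move=> ab.
  have G : \int[mu]_(y in `[0, pi *+ 2]) (q b y - q a y) +
      \int[mu]_(x in `[a, b]) (p x (pi *+ 2) - p x 0) = 0 :=
    goursat (entire1_div0 hpsi) cq cp ab pi2.
  have Ep : \int[mu]_(x in `[a, b]) (p x (pi *+ 2) - p x 0) = 0.
    transitivity (\int[mu]_(x in `[a, b]) (0 : R)).
      by apply: eq_Rintegral => x _; rewrite /p /psi cexp_2pi subrr.
    by rewrite Rintegral_itv_cst ?mul0r// ltW.
  have Eq : \int[mu]_(y in `[0, pi *+ 2]) (q b y - q a y) = M b - M a.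
    apply: RintegralB => //.
      exact: (continuous_integrable_itv _ _ (cq b)).
    exact: (continuous_integrable_itv _ _ (cq a)).
  by move: G; rewrite Ep Eq addr0 => /eqP; rewrite subr_eq0 => /eqP ->.
have ME : M (ln r) = complex.Re (phi z0) * (pi *+ 2).
  apply/eqP; rewrite -subr_eq0 -normr_le0; apply/ler_addgt0Pr => e e0; rewrite add0r.
  have e1 : 0 < e / (pi *+ 2) by rewrite divr_gt0.
  have [dl dl0 H] := entire1_continuous z0 hphi e1.
  pose a := Num.min (ln r - 1) (ln (dl / 2)).
  have aln : a < ln r by rewrite gt_min ltrBlDr ltrDl ltr01.
  rewrite -(Mab a (ln r) aln).
  have -> : e = e / (pi *+ 2) * (pi *+ 2 - 0) by rewrite subr0 divfK// gt_eqF.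
  rewrite -[X in _ - _ * X]subr0; apply: Rintegral_itv_close => //; first exact: ltW.
  move=> y _; apply: le_trans (lipschitz_Re _ _) _; apply/ltW/H.
  rewrite normc_cexp /=; apply: (@le_lt_trans _ _ (dl / 2)).
    rewrite -[leRHS]lnK ?posrE ?divr_gt0// ler_expR /a.
    by rewrite ge_min lexx orbT.
  by rewrite ltr_pdivrMr// ltr_pMr// ltr1n.
rewrite -ME; apply: eq_Rintegral => y _; rewrite /q /psi; congr (complex.Re (phi (_ + _))).
by rewrite /cexp /= expR0 lnK// mul1r.
Qed.

Lemma Re_conj_mul z : complex.Re (z^* * z) = normc z ^+ 2.
Proof.
case: z => a b /=; rewrite sqr_sqrtr ?addr_ge0 ?sqr_ge0//; ring.
Qed.

Lemma normc_conj z : normc z^* = normc z.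
Proof. by case: z => a b /=; rewrite sqrrN. Qed.

Lemma continuous_normc_circle phi z0 (r : R) : entire1 phi ->
  continuous (fun t : R => normc (phi (z0 + r%:C * cexp (0 +i* t)))).
Proof.
move=> h.
pose psi u := phi (z0 + r%:C * cexp u).
apply: (@entire1_continuous_path _ psi (@normc R) (fun=> 0) id).
- exact: lipschitz_normc.
- apply: (entire1_comp h); apply: entire1D; first exact: entire1_cst.
  apply: entire1M; first exact: entire1_cst.
  exact: entire1_cexp.
- exact: continuous_fun_cst.
- exact: continuous_fun_id.
Qed.

(** Multiplying [phi] by the conjugate of [phi z0] makes its value at the centre real and equal to
    [normc (phi z0) ^+ 2]; the mean value property of the real part then bounds it by the mean of
    the moduli. *)
Lemma mean_value_ineq phi z0 (r : R) : entire1 phi -> 0 < r ->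
  normc (phi z0) * (pi *+ 2) <=
  \int[mu]_(t in `[0, pi *+ 2]) normc (phi (z0 + r%:C * cexp (0 +i* t))).
Proof.
move=> h r0; set a := phi z0.
have [->|a0] := eqVneq a 0.
  by rewrite normc0 mul0r; apply: Rintegral_ge0 => x _; exact: normc_ge0.
have na : 0 < normc a by rewrite normc_gt0.
rewrite -(ler_pM2l na) mulrA -expr2 -Re_conj_mul.
pose phi' z := a^* * phi z.
have h' : entire1 phi' by apply: entire1M => //; exact: entire1_cst.
rewrite -/(phi' z0) -(mean_value_Re z0 h' r0).
have ci : mu.-integrable `[0, pi *+ 2] (EFin \o (fun t => normc (phi (z0 + r%:C * cexp (0 +i* t))))).
  by apply: continuous_integrable_itv; exact: continuous_normc_circle.
rewrite -RintegralZl//.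
apply: le_Rintegral => //.
- apply: continuous_integrable_itv.
  pose psi u := phi' (z0 + r%:C * cexp u).
  apply: (@entire1_continuous_path _ psi (@complex.Re R) (fun=> 0) id).
  + exact: lipschitz_Re.
  + apply: (entire1_comp h'); apply: entire1D; first exact: entire1_cst.
    apply: entire1M; first exact: entire1_cst.
    exact: entire1_cexp.
  + exact: continuous_fun_cst.
  + exact: continuous_fun_id.
- apply: continuous_integrable_itv => x.
  by apply: cvgM; [exact: cvg_cst|exact: continuous_normc_circle].
- move=> t _; rewrite -(normc_conj a) -normcM.
  by apply: le_trans (Re_le_normc _); exact: ler_norm.
Qed.

End MeanValue.

(** * Sub-mean value property and maximum principle on rectangles *)

Section MaximumPrinciple.
Variable R : realType.
Local Notation mu := (@lebesgue_measure R).
Implicit Types (z w h : R[i]) (B : R[i] -> R) (f g phi : R[i] -> R[i]).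

Definition circ z0 (r t : R) : R[i] := z0 + r%:C * cexp (0 +i* t).

Definition continuous2 B := continuous (fun u : R * R => B (u.1 +i* u.2)).

Definition submean B := continuous2 B /\
  forall z0 r, 0 < r ->
    B z0 * (pi *+ 2) <= \int[mu]_(t in `[0, pi *+ 2]) B (circ z0 r t).

Lemma circE (x y r t : R) : circ (x +i* y) r t = (x + r * cos t) +i* (y + r * sin t).
Proof.
rewrite /circ /cexp /= expR0 mul1r; apply/eqP; rewrite eq_complex /=.
by apply/andP; split; apply/eqP; ring.
Qed.

Lemma continuous_circ B z0 (r : R) : continuous2 B -> continuous (fun t : R => B (circ z0 r t)).
Proof.
case: z0 => x y cB.
rewrite (_ : (fun t => _) = (fun t => B ((x + r * cos t) +i* (y + r * sin t)))); last first.
  by apply/funext => t; rewrite circE.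
move=> t.
pose gam (t : R) : R * R := (x + r * cos t, y + r * sin t).
apply: (@continuous_comp _ _ _ gam (fun u => B (u.1 +i* u.2))); last exact: cB.
have c1 : (fun t => x + r * cos t) t @[t --> t] --> x + r * cos t.
  apply: cvgD; first exact: cvg_cst.
  by apply: cvgMr; exact: continuous_cos.
have c2 : (fun t => y + r * sin t) t @[t --> t] --> y + r * sin t.
  apply: cvgD; first exact: cvg_cst.
  by apply: cvgMr; exact: continuous_sin.
exact: (cvg_pair c1 c2).
Qed.

Lemma norm_le_ends (a b x : R) : a <= x <= b -> `|x| <= `|a| + `|b|.
Proof.
move=> /andP[ax xb]; have := ler_norm b; have := ler_norm (- a); rewrite normrN.
have := normr_ge0 a; have := normr_ge0 b.
by rewrite ler_norml => *; apply/andP; split; lra.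
Qed.

Lemma pi2_gt0 : 0 < (pi : R) *+ 2.
Proof. by rewrite mulrn_wgt0// pi_gt0. Qed.

(** Adding [e * |z|^2], with [e] too small to fill the gap above [M], keeps the maximum off the
    boundary. At an interior maximum the sub-mean value inequality fails, because the mean of
    [|z|^2] over a circle of radius [r] exceeds its central value by [r^2]. *)
Lemma max_principle_rect B (a b L M : R) : submean B ->
  (forall x y, a <= x <= b -> - L <= y <= L ->
     [|| x == a, x == b, y == - L | y == L] -> B (x +i* y) <= M) ->
  forall x y, a <= x <= b -> - L <= y <= L -> B (x +i* y) <= M.
Proof.
move=> [cB sB] bdy x1 y1 hx1 hy1; rewrite leNgt; apply/negP => gap.
pose D : R := (`|a| + `|b|) ^+ 2 + L ^+ 2.
have D0 : 0 <= D by rewrite addr_ge0// sqr_ge0.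
pose e := (B (x1 +i* y1) - M) / (D + 1).
have D1 : 0 < D + 1 by rewrite ltr_wpDl.
have e0 : 0 < e by rewrite divr_gt0// subr_gt0.
have eD : M + e * D < B (x1 +i* y1).
  rewrite -ltrBrDl /e mulrAC ltr_pdivrMr// ltr_pM2l ?subr_gt0//.
  by rewrite ltrDl.
pose Be (u : R * R) := B (u.1 +i* u.2) + e * (u.1 ^+ 2 + u.2 ^+ 2).
have cBe : continuous Be.
  move=> u; apply: cvgD; first exact: cB.
  apply: cvgMr; apply: cvgD.
    exact: (@cvgM R _ (nbhs u) _ (fun v => v.1) (fun v => v.1) u.1 u.1 cvg_fst cvg_fst).
  exact: (@cvgM R _ (nbhs u) _ (fun v => v.2) (fun v => v.2) u.2 u.2 cvg_snd cvg_snd).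
have [|||[x0 y0]] := @compact_EVT_max _ R Be (`[a, b] `*` `[- L, L]).
- by exists (x1, y1); split; rewrite /= in_itv/=.
- by apply: compact_setX; exact: segment_compact.
- exact: continuous_subspaceT.
rewrite inE => -[]; rewrite /= !in_itv /= => hx0 hy0 Hmax.
have K2 x y : a <= x <= b -> - L <= y <= L -> x ^+ 2 + y ^+ 2 <= D.
  move=> hx hy; rewrite lerD//.
    rewrite -(real_normK (num_real x)) lerXn2r ?nnegrE// ?addr_ge0//.
    exact: norm_le_ends.
  rewrite -ler_norml in hy.
  rewrite -(real_normK (num_real y)) -(real_normK (num_real L)) lerXn2r ?nnegrE//.
  by apply: (le_trans hy); exact: ler_norm.
have Be1 : B (x1 +i* y1) <= Be (x0, y0).
  apply: (@le_trans _ _ (Be (x1, y1))).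
    by rewrite /Be /= lerDl mulr_ge0 ?(ltW e0)// addr_ge0// sqr_ge0.
  by apply: Hmax; rewrite inE; split; rewrite /= in_itv/=.
have nb : ~~ [|| x0 == a, x0 == b, y0 == - L | y0 == L].
  apply/negP => /(bdy _ _ hx0 hy0) HB; move: Be1; apply/negP; rewrite -ltNge.
  by apply: le_lt_trans eD; rewrite /Be /= lerD// ler_pM2l// K2.
move: nb; rewrite !negb_or => /and4P[nxa nxb nyl nyr].
move: hx0 hy0 => /andP[]; rewrite le_eqVlt eq_sym (negbTE nxa)/= => ax0.
rewrite le_eqVlt (negbTE nxb)/= => x0b.
move=> /andP[]; rewrite le_eqVlt eq_sym (negbTE nyl)/= => ly0.
rewrite le_eqVlt (negbTE nyr)/= => y0l.
pose r := Num.min (Num.min (x0 - a) (b - x0)) (Num.min (y0 + L) (L - y0)).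
have r0 : 0 < r by rewrite !lt_min !subr_gt0 ax0 x0b y0l -ltrBlDr sub0r ly0.
have [r1 r2 r3 r4] : [/\ r <= x0 - a, r <= b - x0, r <= y0 + L & r <= L - y0].
  by split; rewrite !ge_min lexx ?orbT.
pose z0 := x0 +i* y0.
pose phi z := z0^* * z.
have ephi : entire1 phi by apply: entire1M; [exact: entire1_cst|exact: entire1_id].
have IRe := mean_value_Re z0 ephi r0.
rewrite -/(circ _ _ _) /phi Re_conj_mul in IRe.
pose N2 := x0 ^+ 2 + y0 ^+ 2.
have N2E : normc z0 ^+ 2 = N2 by rewrite /= sqr_sqrtr// addr_ge0// sqr_ge0.
pose K1 := Be (x0, y0) - e * (r ^+ 2 - N2).
pose hh (t : R) := K1 - (2 * e) * complex.Re (phi (circ z0 r t)).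
have cRe : continuous (fun t : R => complex.Re (phi (circ z0 r t))).
  apply: (@continuous_circ (fun z => complex.Re (phi z))).
  apply: (entire1_continuous_path (@lipschitz_Re R) ephi).
    by move=> u; exact: cvg_fst.
  by move=> u; exact: cvg_snd.
have chh : continuous hh.
  by move=> t; apply: cvgB; [exact: cvg_cst|apply: cvgMr; exact: cRe].
have Hle t : B (circ z0 r t) <= hh t.
  rewrite /hh /phi /z0 circE /=.
  set u := r * cos t; set v := r * sin t.
  have uv : u ^+ 2 + v ^+ 2 = r ^+ 2 by rewrite /u /v !exprMn -mulrDr cos2Dsin2 mulr1.
  have ub : `|u| <= r.
    by rewrite /u normrM gtr0_norm// ler_piMr ?(ltW r0)// ler_norml cos_geN1 cos_le1.
  have vb : `|v| <= r.
    by rewrite /v normrM gtr0_norm// ler_piMr ?(ltW r0)// ler_norml sin_geN1 sin_le1.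
  have : Be (x0 + u, y0 + v) <= Be (x0, y0).
    move: ub vb; rewrite !ler_norml => /andP[ub1 ub2] /andP[vb1 vb2].
    apply: Hmax; rewrite inE; split; rewrite /= in_itv /=.
      by clear - ub1 ub2 r1 r2; apply/andP; split; lra.
    by clear - vb1 vb2 r3 r4; apply/andP; split; lra.
  rewrite [Be (x0 + u, _)]/Be [(_, _).1]/= [(_, _).2]/= => h.
  rewrite -lerBrDr in h; apply: le_trans h _.
  rewrite /K1 -uv /N2 le_eqVlt; apply/orP; left; apply/eqP; ring.
have I1 : \int[mu]_(t in `[0, pi *+ 2]) B (circ z0 r t) <= \int[mu]_(t in `[0, pi *+ 2]) hh t.
  apply: le_Rintegral => //.
  - by apply: continuous_integrable_itv; exact: continuous_circ.
  - exact: continuous_integrable_itv.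
have I2 : \int[mu]_(t in `[0, pi *+ 2]) hh t = (K1 - 2 * e * N2) * (pi *+ 2).
  rewrite /hh RintegralB//; last 2 first.
  - by apply: continuous_integrable_itv => t; exact: cvg_cst.
  - by apply: continuous_integrable_itv => t; apply: cvgMr; exact: cRe.
  rewrite RintegralZl//; last exact: continuous_integrable_itv.
  rewrite Rintegral_itv_cst ?ltW ?pi2_gt0// subr0 [RHS]mulrBl; congr (_ - _).
  by rewrite -[RHS]mulrA; congr (_ * _); rewrite -N2E; exact: IRe.
have := le_trans (sB z0 r r0) I1; rewrite I2 ler_pM2r ?pi2_gt0//.
apply/negP; rewrite -ltNge /K1 /Be /= -/z0 -/N2 -subr_gt0.
rewrite (_ : _ - _ = e * r ^+ 2); last by ring.
by rewrite mulr_gt0// exprn_gt0.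
Qed.

End MaximumPrinciple.

(** * The Phragmen-Lindelof principle on a strip *)

Section PhragmenLindelof.
Variable R : realType.
Implicit Types (z w h : R[i]) (B : R[i] -> R) (E : R[i] -> R[i]).

(* The part of log-subharmonicity used by Phragmen-Lindelof: the sub-mean value
   property survives multiplication by the modulus of an entire function. *)
Definition logsub B := (forall z, 0 <= B z) /\
  forall E, entire1 E -> submean (fun z => B z * normc (E z)).

Lemma logsubM B E : logsub B -> entire1 E -> logsub (fun z => B z * normc (E z)).
Proof.
move=> [B0 hB] hE; split; first by move=> z; rewrite mulr_ge0// normc_ge0.
move=> E' hE'.
rewrite (_ : (fun z => _) = (fun z => B z * normc (E z * E' z))).
  by apply: hB; exact: entire1M.
by apply/funext => z; rewrite normcM mulrA.
Qed.

(** The multiplier may depend on the point and on [e]: one rectangle of half-height [L] is enough to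
    contradict a single value above [M]. *)
Lemma phragmen_lindelof_multiplier B (a b M x1 y1 : R) : logsub B -> a <= x1 <= b -> 0 <= M ->
  (forall x y, (x == a) || (x == b) -> B (x +i* y) <= M) ->
  (forall e, 0 < e -> e < 1 -> exists E, [/\ entire1 E,
     forall x y, a <= x <= b -> normc (E (x +i* y)) <= 1,
     1 - e <= normc (E (x1 +i* y1)) &
     exists L, `|y1| <= L /\ forall x y, a <= x <= b -> `|y| = L ->
        B (x +i* y) * normc (E (x +i* y)) <= e]) ->
  B (x1 +i* y1) <= M.
Proof.
move=> [B0 hB] hx1 M0 edge H; rewrite leNgt; apply/negP => gap.
set b1 := B _ in gap.
have b10 : 0 < b1 + 1 by rewrite ltr_wpDl// B0.
(* Then [e * (b1 + 1)] is half of [b1 - M], which contradicts [b1 * (1 - e) <= M + e]. *)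
pose e := (b1 - M) / (2 * (b1 + 1)).
have e0 : 0 < e by rewrite divr_gt0 ?subr_gt0// mulr_gt0.
have e1 : e < 1.
  rewrite ltr_pdivrMr ?mulr_gt0// mul1r.
  by have := M0; have := B0 (x1 +i* y1); rewrite -/b1; clear; lra.
have [E [hE E1 Ex [L [yL HL]]]] := H _ e0 e1.
have y1L : - L <= y1 <= L by rewrite -ler_norml.
have L0 : 0 <= L := le_trans (normr_ge0 _) yL.
have HH : b1 * normc (E (x1 +i* y1)) <= M + e.
  apply: (max_principle_rect (hB _ hE) _ hx1 y1L) => x y hx hy /or4P[xa|xb|yl|yl].
  - apply: (@le_trans _ _ M); last by rewrite lerDl ltW.
    by rewrite -[leRHS]mulr1 ler_pM ?B0 ?normc_ge0 ?edge ?xa ?E1.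
  - apply: (@le_trans _ _ M); last by rewrite lerDl ltW.
    by rewrite -[leRHS]mulr1 ler_pM ?B0 ?normc_ge0 ?edge ?xb ?orbT ?E1.
  - apply: (le_trans (HL _ _ hx _)); last by rewrite lerDr.
    by rewrite (eqP yl) normrN ger0_norm.
  - apply: (le_trans (HL _ _ hx _)); last by rewrite lerDr.
    by rewrite (eqP yl) ger0_norm.
have : b1 * (1 - e) <= M + e.
  by apply: le_trans HH; rewrite ler_wpM2l// B0.
apply/negP; rewrite -ltNge -subr_gt0.
have -> : b1 * (1 - e) - (M + e) = (b1 - M) - e * (b1 + 1) by ring.
rewrite /e invfM mulrA divfK ?gt_eqF// subr_gt0 ltr_pdivrMr// ltr_pMr ?subr_gt0//.
by rewrite ltr1n.
Qed.

Lemma two_cosh_ge2 (y : R) : 2 <= expR y + expR (- y).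
Proof.
have := expR_ge1Dx y; have := expR_ge1Dx (- y).
by move=> h1 h2; apply: le_trans (lerD h2 h1); lra.
Qed.

Lemma two_cosh_norm (y : R) : expR y + expR (- y) = expR `|y| + expR (- `|y|).
Proof. by case: (ger0P y) => // _; rewrite opprK addrC. Qed.

Lemma two_cosh_le (y : R) : expR y + expR (- y) <= 2 * expR `|y|.
Proof.
rewrite two_cosh_norm mulr_natl mulr2n lerD2l ler_expR.
by apply: (@le_trans _ _ 0); rewrite ?oppr_le0.
Qed.

Lemma expRN_le (v : R) : 0 < v -> expR (- v) <= v^-1.
Proof.
move=> v0; rewrite expRN lef_pV2 ?posrE ?expR_gt0//.
by apply: le_trans (expR_ge1Dx v); rewrite lerDr.
Qed.

Lemma sum4_ge (p q w : R) : 0 <= p -> 0 <= q -> 0 <= w ->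
  [/\ 1 <= 1 + p + q + w, p <= 1 + p + q + w, q <= 1 + p + q + w & w <= 1 + p + q + w].
Proof. by move=> *; split; lra. Qed.

(** In a strip of width [pi / 2] the critical growth is [exp (c e^(2 |y|))], so growth of order
    [e^|y|] leaves room for a multiplier of order [3 / 2], strictly between 1 and 2. *)
Lemma phragmen_lindelof_quarter B (a M C c : R) : logsub B -> 0 <= M -> 0 <= C -> 0 <= c ->
  (forall x y, (x == a) || (x == a + pi / 2) -> B (x +i* y) <= M) ->
  (forall x y, a <= x <= a + pi / 2 ->
     B (x +i* y) <= C * expR (c * (expR y + expR (- y)))) ->
  forall x y, a <= x <= a + pi / 2 -> B (x +i* y) <= M.
Proof.
move=> hB M0 C0 c0 edge growth x1 y1 hx1.
apply: (phragmen_lindelof_multiplier (M := M) _ _ _ edge) => // e e0 e1.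
pose m := a + pi / 4.
(* multiplier exp (- eta cos (3/2 (z - m))), decaying like exp (- c e^(3|y|/2)) *)
pose ang (x : R) := 3 / 2 * (x - m).
(* On the strip [|x - m| <= pi / 4], so the angle stays within [3 pi / 8 < pi / 2] and its cosine is
   bounded below. *)
pose kap : R := cos (3 / 8 * pi).
have pi0 : 0 < (pi : R) := pi_gt0 R.
have kap0 : 0 < kap.
  by apply: cos_gt0_pihalf; clear - pi0; apply/andP; split; lra.
have hang x : a <= x <= a + pi / 2 -> kap <= cos (ang x).
  move=> hx; rewrite /kap.
  have hn : `|ang x| <= 3 / 8 * pi.
    rewrite /ang /m; clear - hx pi0; rewrite ler_norml.
    by move: hx => /andP[? ?]; apply/andP; split; lra.
  have -> : cos (ang x) = cos `|ang x|.
    by case: (ger0P (ang x)) => // _; rewrite cosN.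
  rewrite leNgt; apply/negP => hlt.
  have A1 : `|ang x| \in `[0, pi].
    by rewrite in_itv/= normr_ge0; clear - hn pi0; move: hn; lra.
  have A2 : 3 / 8 * pi \in `[0, (pi : R)].
    by rewrite in_itv/=; clear - pi0; apply/andP; split; lra.
  by move: hlt; rewrite (ltr_cos A2 A1) ltNge hn.
pose ch (y : R) := (expR y + expR (- y)) / 2.
pose v := cos (ang x1) * ch (3 / 2 * y1).
have ch0 y : 0 < ch y by rewrite divr_gt0// addr_gt0// expR_gt0.
have v0 : 0 <= v by rewrite mulr_ge0 ?(ltW (ch0 _))// (le_trans (ltW kap0))// hang.
pose eta := e / (v + 1).
have eta0 : 0 < eta by rewrite divr_gt0// ltr_wpDl.
pose E z := cexp ((- eta)%:C * ccos ((3 / 2)%:C * (z + (- m)%:C))).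
have hE : entire1 E.
  apply: (entire1_comp (@entire1_cexp R)); apply: entire1M; first exact: entire1_cst.
  apply: (entire1_comp (@entire1_ccos R)); apply: entire1M; first exact: entire1_cst.
  by apply: entire1D; [exact: entire1_id|exact: entire1_cst].
have nE x y : normc (E (x +i* y)) = expR (- (eta * (cos (ang x) * ch (3 / 2 * y)))).
  rewrite /E normc_cexp.
  have -> : (3 / 2)%:C * ((x +i* y) + (- m)%:C) = (ang x) +i* (3 / 2 * y).
    by apply/eqP; rewrite eq_complex /=; apply/andP; split; apply/eqP; rewrite /ang; ring.
  by rewrite ccosE /= mul0r subr0 mulNr.
exists E; split => //.
- move=> x y hx; rewrite nE expR_le1 oppr_le0.
  apply: (mulr_ge0 (ltW eta0)); apply: mulr_ge0 (ltW (ch0 _)).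
  exact: le_trans (ltW kap0) (hang x hx).
- rewrite nE -/v; apply: le_trans (expR_ge1Dx _); rewrite lerD2l lerN2.
  rewrite /eta mulrAC ler_pdivrMr ?ltr_wpDl// ler_pM2l// lerDl ler01 //.
clearbody eta.
pose K := eta * kap / 2.
have K0 : 0 < K by rewrite divr_gt0// mulr_gt0.
(* At height [2 ln V] one has [e^|y| = V^2] and [e^(3 |y| / 2) = V^3], so the exponents are compared
   as polynomials in [V]. Each summand of [V] is one of the lower bounds required below. *)
pose V := 1 + (2 * c + 1) / K + C / e + expR `|y1|.
have P0 : 0 <= (2 * c + 1) / K by rewrite divr_ge0 ?(ltW K0)// addr_ge0// mulr_ge0.
have Q0 : 0 <= C / e by rewrite divr_ge0 ?(ltW e0).
have W0 := expR_ge0 `|y1|.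
have [V1 VP VC Vy] := sum4_ge P0 Q0 W0; rewrite -/V in V1 VP VC Vy.
have V0 : 0 < V := lt_le_trans ltr01 V1.
have VK : (2 * c + 1) <= K * V by rewrite (mulrC K) -ler_pdivrMr.
have lnV : `|y1| <= ln V by rewrite -(expRK `|y1|) ler_ln ?posrE ?expR_gt0.
have lnV0 : 0 <= ln V := le_trans (normr_ge0 _) lnV.
exists (2 * ln V); split.
  by apply: (le_trans lnV); rewrite ler_peMl// ler1n.
move=> x y hx hy; rewrite nE.
have eL : expR `|y| = V ^+ 2 by rewrite hy expRM_natl lnK.
have eL3 : expR `|3 / 2 * y| = V ^+ 3.
  have -> : `|3 / 2 * y| = 3%:R * ln V.
    by rewrite normrM hy ger0_norm ?divr_ge0//; field.
  by rewrite expRM_natl lnK.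
have h1 : B (x +i* y) <= C * expR (c * (2 * V ^+ 2)).
  apply: (le_trans (growth _ _ hx)); rewrite ler_wpM2l// ler_expR ler_wpM2l//.
  by rewrite -eL two_cosh_le.
have h2 : K * V ^+ 3 <= eta * (cos (ang x) * ch (3 / 2 * y)).
  have -> : K * V ^+ 3 = eta * (kap * (2^-1 * V ^+ 3)) by rewrite /K; ring.
  rewrite ler_pM2l//; apply: ler_pM.
  - exact: ltW.
  - by rewrite mulr_ge0 ?invr_ge0// exprn_ge0// ltW.
  - exact: hang.
  - by rewrite /ch [leLHS]mulrC ler_pM2r ?invr_gt0// two_cosh_norm eL3 lerDl expR_ge0.
apply: (@le_trans _ _ (C * expR (c * (2 * V ^+ 2)) * expR (- (K * V ^+ 3)))).
  by apply: ler_pM; rewrite ?expR_ge0 ?(proj1 hB)// ler_expR lerN2.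
rewrite -mulrA -expRD.
have h3 : c * (2 * V ^+ 2) + - (K * V ^+ 3) <= - V.
  have : V ^+ 2 * (2 * c + 1) <= V ^+ 2 * (K * V) by rewrite ler_wpM2l// sqr_ge0.
  have : V * 1 <= V * V by rewrite ler_pM2l.
  have -> : V ^+ 3 = V ^+ 2 * V by rewrite exprSr.
  rewrite -expr2 mulr1 mulrDr mulr1 => g1 g2.
  rewrite -subr_ge0; have -> : - V - (c * (2 * V ^+ 2) + - (K * (V ^+ 2 * V))) =
    (V ^+ 2 * (K * V) - (V ^+ 2 * (2 * c) + V ^+ 2)) + (V ^+ 2 - V) by ring.
  by rewrite addr_ge0// subr_ge0.
apply: (@le_trans _ _ (C * V^-1)).
  by rewrite ler_wpM2l//; apply: le_trans (expRN_le V0); rewrite ler_expR.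
by rewrite ler_pdivrMr// mulrC -ler_pdivrMr.
Qed.

Lemma phragmen_lindelof_strip B (M C c N : R) k : logsub B -> 0 <= M -> 0 <= C -> 0 <= c -> 0 <= N ->
  (forall x y, (x == - (pi / 2)) || (x == pi / 2) -> B (x +i* y) <= M) ->
  (forall y, B (0 +i* y) <= N * (expR y + expR (- y)) ^+ k) ->
  (forall x y, - (pi / 2) <= x <= pi / 2 ->
     B (x +i* y) <= C * expR (c * (expR y + expR (- y)))) ->
  forall x y, - (pi / 2) <= x <= pi / 2 -> B (x +i* y) <= M.
Proof.
move=> hB M0 C0 c0 N0 edge mid growth x1 y1 hx1.
have pi0 : 0 < (pi : R) := pi_gt0 R.
apply: (phragmen_lindelof_multiplier (M := M) _ _ _ edge) => // e e0 e1.
pose H : R := (pi / 2) ^+ 2.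
have H0 : 0 <= H by rewrite sqr_ge0.
pose dl := e / (2 * (H + y1 ^+ 2 + 1)).
have den0 : 0 < H + y1 ^+ 2 + 1 by rewrite ltr_wpDl// addr_ge0// sqr_ge0.
have dl0 : 0 < dl by rewrite divr_gt0// mulr_gt0.
have dlE : 2 * dl = e / (H + y1 ^+ 2 + 1) by rewrite /dl; field; rewrite ?gt_eqF.
clearbody dl.
have xH x : - (pi / 2) <= x <= pi / 2 -> x ^+ 2 <= H.
  rewrite -ler_norml => hx; rewrite /H -(real_normK (num_real x)) lerXn2r ?nnegrE//.
  by rewrite divr_ge0// ltW.
(* exp (dl z^2) first absorbs the polynomial growth on the imaginary axis, so
   that each half strip can be treated; a second factor recovers the bound M. *)
pose E1 z := cexp (dl%:C * z ^+ 2).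
have hE1 : entire1 E1.
  apply: (entire1_comp (@entire1_cexp R)); apply: entire1M; first exact: entire1_cst.
  by apply: entire1X; exact: entire1_id.
have nE1 x y : normc (E1 (x +i* y)) = expR (dl * (x ^+ 2 - y ^+ 2)).
  by rewrite /E1 normc_cexp /=; congr expR; ring.
(* The second summand bounds [N (2 e^Y)^k exp (- dl Y^2)] for all [Y]; the exact maximum of
   [k Y - dl Y^2] is [k^2 / (4 dl)]. *)
pose M1 := M * expR (dl * H) + N * 2 ^+ k * expR (k%:R ^+ 2 / dl).
have M10 : 0 <= M1 by rewrite addr_ge0// !mulr_ge0 ?expR_ge0 ?exprn_ge0.
have hB1 := logsubM hB hE1.
have edge1 x y : (x == - (pi / 2)) || (x == pi / 2) -> B (x +i* y) * normc (E1 (x +i* y)) <= M1.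
  move=> hx; apply: (@le_trans _ _ (M * expR (dl * H))); last first.
    by rewrite lerDl !mulr_ge0 ?expR_ge0 ?exprn_ge0.
  apply: (ler_pM (proj1 hB _) (normc_ge0 _) (edge _ _ hx)).
  rewrite nE1 ler_expR ler_pM2l// lerBlDr.
  have -> : x ^+ 2 = H by case/orP: hx => /eqP ->; rewrite ?sqrrN.
  by rewrite lerDl sqr_ge0.
have mid1 y : B (0 +i* y) * normc (E1 (0 +i* y)) <= M1.
  apply: (@le_trans _ _ (N * 2 ^+ k * expR (k%:R ^+ 2 / dl))); last first.
    by rewrite lerDr mulr_ge0 ?expR_ge0.
  rewrite nE1 expr0n sub0r.
  apply: (@le_trans _ _ (N * (2 * expR `|y|) ^+ k * expR (dl * - y ^+ 2))).
    rewrite ler_wpM2r ?expR_ge0//; apply: (le_trans (mid y)).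
    by rewrite ler_wpM2l// lerXn2r ?nnegrE ?two_cosh_le ?mulr_ge0 ?addr_ge0 ?expR_ge0.
  rewrite exprMn -expRM_natl -!mulrA ler_wpM2l// ler_wpM2l ?exprn_ge0//.
  rewrite -expRD ler_expR mulrN lerBlDr -(real_normK (num_real y)).
  set Y := `|y|; set kk : R := k%:R.
  rewrite -subr_ge0 -(pmulr_rge0 _ dl0).
  have -> : dl * (kk * (kk / dl) + dl * Y ^+ 2 - kk * Y) =
     (dl * Y - kk / 2) ^+ 2 + 3 / 4 * kk ^+ 2 by field; rewrite gt_eqF.
  by rewrite addr_ge0 ?sqr_ge0// mulr_ge0 ?sqr_ge0// divr_ge0.
have growth1 x y : - (pi / 2) <= x <= pi / 2 ->
    B (x +i* y) * normc (E1 (x +i* y)) <= (C * expR (dl * H)) * expR (c * (expR y + expR (- y))).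
  move=> hx; rewrite mulrAC; apply: (ler_pM (proj1 hB _) (normc_ge0 _) (growth _ _ hx)).
  rewrite nE1 ler_expR ler_pM2l// lerBlDr.
  by apply: (le_trans (xH _ hx)); rewrite lerDl sqr_ge0.
have bound1 x y : - (pi / 2) <= x <= pi / 2 -> B (x +i* y) * normc (E1 (x +i* y)) <= M1.
  move=> hx.
  have CH0 : 0 <= C * expR (dl * H) by rewrite mulr_ge0 ?expR_ge0.
  have [x0|x0] := leP 0 x.
    apply: (phragmen_lindelof_quarter (a := 0) hB1 M10 CH0 c0).
    - move=> x' y' /orP[/eqP ->|]; first exact: mid1.
      by rewrite add0r => hx'; apply: edge1; rewrite hx' orbT.
    - move=> x' y' hx'; apply: growth1; clear - hx' pi0.
      by move: hx' => /andP[? ?]; apply/andP; split; lra.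
    - by rewrite add0r x0; case/andP: hx.
  apply: (phragmen_lindelof_quarter (a := - (pi / 2)) hB1 M10 CH0 c0).
  - move=> x' y' /orP[hx'|]; first by apply: edge1; rewrite hx'.
    by rewrite addNr => /eqP ->; exact: mid1.
  - move=> x' y' hx'; apply: growth1; clear - hx' pi0.
    by move: hx' => /andP[? ?]; apply/andP; split; lra.
  - by rewrite addNr (ltW x0) andbT; case/andP: hx.
(* Up to a constant this is the square of [E1]: one factor is spent on the bound [M1], the other
   still decays. Subtracting [H] keeps the modulus below 1 on the strip, so that the edge bound
   stays [M]. *)
pose E z := cexp ((2 * dl)%:C * (z ^+ 2 + (- H)%:C)).
have hE : entire1 E.
  apply: (entire1_comp (@entire1_cexp R)); apply: entire1M; first exact: entire1_cst.
  by apply: entire1D; [apply: entire1X; exact: entire1_id|exact: entire1_cst].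
have nE x y : normc (E (x +i* y)) = expR (2 * dl * (x ^+ 2 - y ^+ 2 - H)).
  by rewrite /E normc_cexp /=; congr expR; ring.
exists E; split => //.
- move=> x y hx; rewrite nE expR_le1 pmulr_rle0 ?mulr_gt0//.
  by rewrite subr_le0 lerBlDr (le_trans (xH _ hx))// lerDl sqr_ge0.
- rewrite nE; apply: le_trans (expR_ge1Dx _); rewrite lerD2l lerNl -mulrN.
  rewrite dlE mulrAC ler_pdivrMr// ler_pM2l//.
  rewrite !opprB addrA lerBlDr; have := sqr_ge0 x1; clear; lra.
pose L := `|y1| + M1 / (e * dl) + 1.
have ed0 : 0 < e * dl by rewrite mulr_gt0.
have q0 : 0 <= M1 / (e * dl) by rewrite divr_ge0 ?(ltW ed0).
have L1 : 1 <= L by rewrite /L lerDr addr_ge0.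
have L0 : 0 < L := lt_le_trans ltr01 L1.
exists L; split; first by rewrite /L -addrA lerDl addr_ge0.
move=> x y hx hy.
have -> : normc (E (x +i* y)) = normc (E1 (x +i* y)) * expR (dl * (x ^+ 2 - y ^+ 2 - 2 * H)).
  by rewrite nE nE1 -expRD; congr expR; ring.
rewrite mulrA; apply: (@le_trans _ _ (M1 * expR (- (dl * L)))).
  apply: ler_pM (bound1 _ _ hx) _; rewrite ?expR_ge0//.
    by rewrite mulr_ge0 ?normc_ge0 ?(proj1 hB).
  rewrite ler_expR -[leRHS]mulrN ler_pM2l//.
  rewrite -(real_normK (num_real y)) hy.
  have : L * 1 <= L * L by rewrite ler_pM2l.
  have := xH _ hx; rewrite mulr1 -expr2; move: H0; clear; lra.
apply: (@le_trans _ _ (M1 * (dl * L)^-1)).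
  by rewrite ler_wpM2l// expRN_le// mulr_gt0.
rewrite ler_pdivrMr ?mulr_gt0// mulrA -ler_pdivrMl// mulrC.
by rewrite /L addrAC lerDr addr_ge0.
Qed.

End PhragmenLindelof.

(** * Joint measurability of Caratheodory functions *)

Section Caratheodory.
Variable R : realType.
Context (disp : measure_display) (T : measurableType disp).

(** Rounding [t] down to a multiple of [1 / (n + 1)] leaves countably many measurable slices, and
    continuity in [t] recovers [g] as the grid shrinks. *)
Lemma measurable_caratheodory (g : R -> T -> R) :
  (forall x, continuous (g ^~ x)) -> (forall t, measurable_fun setT (g t)) ->
  measurable_fun setT (fun p : measurableTypeR R * T => g p.1 p.2).
Proof.
move=> cg mg.
pose step n (t : R) : R := (Num.floor (t * n.+1%:R))%:~R / n.+1%:R.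
pose h n (p : measurableTypeR R * T) := g (step n p.1) p.2.
apply: (@measurable_realfun.measurable_fun_cvg _ _ _ _ h).
  move=> n _ Y mY; rewrite setTI.
  pose A (k : int) : set (measurableTypeR R * T) :=
    [set t : R | Num.floor (t * n.+1%:R) = k] `*` (g (k%:~R / n.+1%:R) @^-1` Y).
  rewrite (_ : h n @^-1` Y = \bigcup_k A k); last first.
    apply/seteqP; split=> -[t x] /=.
      by move=> hY; exists (Num.floor (t * n.+1%:R)).
    by move=> [k _ [/= tk]]; rewrite /h /step /= tk.
  apply: countable_bigcupT_measurable => // k; apply: measurableX.
    rewrite (_ : [set t : R | _] = `[k%:~R / n.+1%:R, (k + 1)%:~R / n.+1%:R[%classic)//.
    apply/seteqP; split=> t /=; rewrite in_itv/=.
      move=> /eqP; rewrite floor_eq => /andP[h1 h2].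
      by rewrite ler_pdivrMr// ltr_pdivlMr// h1.
    move=> /andP[h1 h2]; apply/eqP; rewrite floor_eq.
    by rewrite -ler_pdivrMr// -ltr_pdivlMr// h1.
  by rewrite -[X in measurable X]setTI; exact: mg.
move=> [t x] _; rewrite /h /=.
apply: (@cvg_comp _ _ _ (fun n => step n t) (g ^~ x)); last exact: cg.
apply/cvgrPdist_lt => e e0.
exists (Num.bound e^-1) => // n /= hn.
have n0 : (0 : R) < n.+1%:R by [].
have /andP[h1 h2] := floor_itv (t * n.+1%:R).
have s1 : step n t <= t by rewrite /step ler_pdivrMr.
have s2 : t < step n t + n.+1%:R^-1.
  by rewrite /step -[X in _ + X]mul1r -mulrDl ltr_pdivlMr//; move: h2; rewrite intrD.
rewrite ger0_norm ?subr_ge0// ltrBlDl; apply: lt_le_trans s2 _; rewrite lerD2l.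
rewrite invf_ple ?posrE//; apply: le_trans (ltW (archi_boundP _)) _; first by rewrite invr_ge0 ltW.
by rewrite ler_nat (leq_trans hn).
Qed.

End Caratheodory.

(** * Averages of moduli of entire functions *)

Section AverageLogsub.
Variable R : realType.
Local Notation mu := (@lebesgue_measure R).
Context (disp : measure_display) (T : measurableType disp).
Variable m : {sigma_finite_measure set T -> \bar R}.
Variable g : T -> R.
Hypothesis ig : m.-integrable setT (EFin \o g).

(** The dominating function is the same [g] near every point, only [C] varies; this makes the
    condition stable under multiplication by an entire function of [z]. *)
Definition locdom (Phi : T -> R[i] -> R[i]) := forall z, exists2 dl : R, 0 < dl &
  exists C : R, forall w x, normc w < dl -> normc (Phi x (z + w)) <= C * g x.

Definition avg (Phi : T -> R[i] -> R[i]) (z : R[i]) : R := \int[m]_x normc (Phi x z).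

Definition avg_family (Phi : T -> R[i] -> R[i]) :=
  [/\ forall x, entire1 (Phi x), forall z, measurable_fun setT (fun x => normc (Phi x z))
    & locdom Phi].

Lemma avg_familyM Phi E : avg_family Phi -> entire1 E -> avg_family (fun x z => Phi x z * E z).
Proof.
move=> [h1 h2 h3] hE; split.
- by move=> x; exact: entire1M.
- move=> z; under eq_fun do rewrite normcM.
  by apply: measurable_funM => //; exact: h2.
- move=> z; have [dl dl0 [C H]] := h3 z.
  have [dl' dl'0 H'] := entire1_continuous z hE ltr01.
  exists (Num.min dl dl'); first by rewrite lt_min dl0.
  exists (C * (normc (E z) + 1)) => w x; rewrite lt_min => /andP[/H{}H /H'{}H'].
  rewrite normcM mulrAC; apply: ler_pM; rewrite ?normc_ge0//.
  rewrite -(subrK (E z) (E (z + w))); apply: le_trans (normcD _ _) _.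
  by rewrite addrC lerD2l ltW.
Qed.

Lemma avg_integrable Phi z : avg_family Phi ->
  m.-integrable setT (EFin \o (fun x => normc (Phi x z))).
Proof.
move=> [h1 h2 h3]; have [dl dl0 [C H]] := h3 z.
apply: (@le_integrable _ _ _ m setT _ _ (fun x => (C * g x)%:E)) => //.
- by apply/measurable_EFinP; exact: h2.
- move=> x _ /=; rewrite lee_fin (ger0_norm (normc_ge0 _)).
  apply: le_trans (ler_norm _).
  by have := H 0 x; rewrite addr0 normc0; exact.
- by under eq_fun do rewrite EFinM; exact: integrableZl.
Qed.

(** Dominated convergence is sequential, so a failure of continuity at [z] is first turned into a
    sequence [w n] tending to 0 along which the averages stay [e] away. *)
Lemma avg_continuous Phi : avg_family Phi -> continuous2 (avg Phi).
Proof.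
move=> hPhi; have [h1 h2 h3] := hPhi; move=> [x0 y0] /=.
set z := x0 +i* y0.
have [dl dl0 [C H]] := h3 z.
suff hseq : forall w : nat -> R[i], (forall n, normc (w n) < dl) -> (forall n, normc (w n) < n.+1%:R^-1) ->
    avg Phi (z + w n) @[n --> \oo] --> avg Phi z.
  apply/cvgrPdist_lt => e e0.
  pose bad (eta : R) w := normc w < eta /\ e <= `|avg Phi z - avg Phi (z + w)|.
  have [eta [eta0 Heta]] : exists eta, 0 < eta /\ forall w, ~ bad eta w.
    apply: contrapT => /forallNP Hn.
    have ex n : exists w, bad (Num.min dl n.+1%:R^-1) w.
      have := Hn (Num.min dl n.+1%:R^-1) => /not_andP[|/existsNP[w /contrapT hw]]; last by exists w.
      by rewrite lt_min dl0 invr_gt0 ltr0n.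
    have [w hw] := choice ex.
    have w1 n : normc (w n) < dl by have [] := hw n; rewrite lt_min => /andP[].
    have w2 n : normc (w n) < n.+1%:R^-1 by have [] := hw n; rewrite lt_min => /andP[].
    have /cvgrPdist_lt /(_ _ e0) [N _ /(_ N (leqnn N))] := hseq w w1 w2.
    by apply/negP; rewrite -leNgt; have [] := hw N.
  have eta2 : 0 < eta / 2 by rewrite divr_gt0.
  have hnear : \forall u \near (x0, y0), `|u.1 - x0| < eta / 2 /\ `|u.2 - y0| < eta / 2.
    exists (ball x0 (eta / 2), ball y0 (eta / 2)) => /=.
      by split; exact: nbhsx_ballx.
    move=> [u v] /= []; rewrite -!ball_normE /= => hu hv.
    by rewrite distrC hu distrC hv.
  apply: filterS hnear => u [hu hv]; rewrite ltNge; apply/negP => hb.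
  apply: (Heta ((u.1 - x0) +i* (u.2 - y0))); split; last first.
    rewrite (_ : z + _ = u.1 +i* u.2)//.
    by apply/eqP; rewrite eq_complex /= !(addrC _ (_ - _)) !subrK !eqxx.
  apply: (le_lt_trans (normc_le_ReIm (_ +i* _))).
  by rewrite /= (splitr eta) ltrD.
move=> w w1 w2.
have [||||||_ _ D] := @dominated_convergence _ _ _ m setT _
  (fun n x => (normc (Phi x (z + w n)))%:E) (fun x => (normc (Phi x z))%:E) (fun x => (C * g x)%:E).
- by [].
- by move=> n; apply/measurable_EFinP; exact: h2.
- by apply/measurable_EFinP; exact: h2.
- apply: aeW => x _; apply: cvg_EFin; first exact: nearW.
  apply/cvgrPdist_lt => e e0; have [et et0 He] := entire1_continuous z (h1 x) e0.
  exists (Num.bound et^-1) => // n /= hn; rewrite distrC.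
  apply: le_lt_trans (lipschitz_normc _ _) _; apply: He; apply: lt_le_trans (w2 n) _.
  rewrite invf_ple ?posrE//; apply: le_trans (ltW (archi_boundP _)) _; first by rewrite invr_ge0 ltW.
  by rewrite ler_nat (leq_trans hn).
- by under eq_fun do rewrite EFinM; exact: integrableZl.
- apply: aeW => x n _ /=; rewrite lee_fin ger0_norm ?normc_ge0//; exact: H.
apply: fine_cvg; rewrite fineK; last first.
  by apply: integrable_fin_num => //; exact: (avg_integrable z hPhi).
by [].
Qed.

(** The inequality holds for each [x], and Tonelli exchanges the circle with the average. The
    indicator of [I] turns the integral over the segment into one over the line, as Tonelli is
    applied on a product of full spaces. *)
Lemma avg_submean Phi : avg_family Phi -> submean (avg Phi).
Proof.
move=> hPhi; split; first exact: avg_continuous.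
move=> z0 r r0; have [h1 h2 _] := hPhi.
have cA := continuous_circ (z0 := z0) (r := r) (avg_continuous hPhi).
have Aint := continuous_integrable_itv 0 (pi *+ 2) cA.
rewrite -lee_fin /Rintegral fineK; last exact: integrable_fin_num.
have step (t : R) : (avg Phi (circ z0 r t))%:E = (\int[m]_x (normc (Phi x (circ z0 r t)))%:E)%E.
  by rewrite fineK//; apply: integrable_fin_num => //; exact: (avg_integrable _ hPhi).
pose I := `[0, (pi : R) *+ 2]%classic.
pose F (p : measurableTypeR R * T) : \bar R := ((\1_I p.1) * normc (Phi p.2 (circ z0 r p.1)))%:E.
have mF : measurable_fun setT F.
  apply/measurable_EFinP; apply: measurable_funM.
    have mI : measurable_fun setT (\1_I : measurableTypeR R -> R).
      by apply: measurable_indic; exact: measurable_itv.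
    exact: (measurableT_comp mI measurable_fst).
  apply: (@measurable_caratheodory R _ T (fun t x => normc (Phi x (circ z0 r t)))).
    by move=> x; exact: continuous_normc_circle.
  by move=> t; exact: h2.
have F0 p : (0 <= F p)%E by rewrite lee_fin mulr_ge0// normc_ge0.
have E1 : (\int[mu]_(t in I) (avg Phi (circ z0 r t))%:E)%E = (\int[mu]_t \int[m]_x F (t, x))%E.
  rewrite integral_mkcond; apply: eq_integral => t _; rewrite patchE.
  case: ifPn => tI.
    by rewrite step; apply: eq_integral => x _; rewrite /F /= indicE tI mul1r.
  by rewrite integral0_eq// => x _; rewrite /F /= indicE (negbTE tI) mul0r.
rewrite -[leRHS]/(\int[mu]_(t in I) (avg Phi (circ z0 r t))%:E)%E E1 fubini_tonelli//.
have fA : (avg Phi z0)%:E = (\int[m]_x (normc (Phi x z0))%:E)%E.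
  by rewrite fineK//; apply: integrable_fin_num => //; exact: (avg_integrable _ hPhi).
rewrite EFinM fA muleC -ge0_integralZl//; last 3 first.
- by apply/measurable_EFinP; exact: h2.
- by move=> x _; rewrite lee_fin normc_ge0.
- by rewrite lee_fin ltW// pi2_gt0.
apply: ge0_le_integral => //.
- by move=> x _; rewrite mule_ge0// lee_fin ?normc_ge0// ltW// pi2_gt0.
- by apply: emeasurable_funM => //; apply/measurable_EFinP; exact: h2.
- exact: measurable_fun_fubini_tonelli_G.
move=> x _.
have cx := @continuous_normc_circle R (Phi x) z0 r (h1 x).
have ix : mu.-integrable I (EFin \o (fun t : R => normc (Phi x (circ z0 r t)))) := continuous_integrable_itv 0 (pi *+ 2) cx.
have -> : (\int[mu]_t F (t, x))%E = (\int[mu]_(t in I) normc (Phi x (circ z0 r t)))%:E.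
  rewrite /Rintegral fineK; last by apply: (integrable_fin_num _ ix); exact: measurable_itv.
  rewrite [RHS]integral_mkcond; apply: eq_integral => t _; rewrite patchE /F /= indicE.
  by case: ifP => _; rewrite ?mul1r ?mul0r.
by rewrite -EFinM lee_fin mulrC; exact: mean_value_ineq.
Qed.

(** The factor [normc (E z)] can be moved inside the average, which is again the average of an
    admissible family. *)
Lemma avg_logsub Phi : avg_family Phi -> logsub (avg Phi).
Proof.
move=> hPhi; split.
  by move=> z; apply: Rintegral_ge0 => x _; exact: normc_ge0.
move=> E hE.
rewrite (_ : (fun z => _) = avg (fun x z => Phi x z * E z)).
  by apply: avg_submean; exact: avg_familyM.
apply/funext => z; rewrite /avg -RintegralZr//; last exact: avg_integrable.
by apply: eq_Rintegral => x _; rewrite normcM.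
Qed.

End AverageLogsub.

(** * Integration on R^d *)

Section LebesgueRn.
Variable R : realType.
Local Notation mu := (@lebesgue_measure R).

Lemma measurable_tuple_cons_fun d : measurable_fun setT (@tuple_cons R d).
Proof. exact: measurable_cons. Qed.

Lemma integral_lebesgueRn_cons d (f : Rtuple R d.+1 -> \bar R) :
  measurable_fun setT f -> (forall x, (0 <= f x)%E) ->
  (\int[lebesgueRn R d.+1]_x f x =
   \int[mu]_t \int[lebesgueRn R d]_x f (tuple_cons (t, x)))%E.
Proof.
move=> mf f0.
transitivity (\int[mu \x lebesgueRn R d]_p (f \o @tuple_cons R d) p)%E.
  have := @ge0_integral_pushforward _ _ _ _ R (@tuple_cons R d) (measurable_tuple_cons_fun (d:=d))
    (mu \x lebesgueRn R d)%E setT f measurableT mf (fun x _ => f0 x).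
  by rewrite preimage_setT.
rewrite fubini_tonelli1//.
  exact: measurableT_comp mf (measurable_tuple_cons_fun (d:=d)).
by move=> x; exact: f0.
Qed.

Definition scl (c : R) (x : measurableTypeR R) : measurableTypeR R := c * x.

Lemma measurable_scl c : measurable_fun setT (scl c).
Proof. by apply: measurable_funM => //; exact: measurable_id. Qed.

Definition lebesgue_scl0 (c : R) : {measure set (measurableTypeR R) -> \bar R}.
Proof. refine (pushforward mu (scl c)); exact: measurable_scl. Defined.

Definition lebesgue_scl (c : R) := mscale (NngNum (normr_ge0 c)) (lebesgue_scl0 c).

(** By uniqueness of Lebesgue measure, half-open intervals suffice; a negative [c] reverses them, so
    the closed end changes side. *)
Lemma lebesgue_measure_scl (c : R) (A : set (measurableTypeR R)) : c != 0 -> measurable A ->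
  (`|c|%:E * mu (scl c @^-1` A))%E = mu A.
Proof.
move=> c0 mA.
rewrite -[LHS]/(lebesgue_scl c A); apply/esym; apply: (lebesgue_measure_unique (mu := lebesgue_scl c)) => // X.
move=> /ocitvP[->|[[a b] /= ab ->]]; first by rewrite !measure0.
rewrite /lebesgue_scl /mscale /= /pushforward.
rewrite lebesgue_measure_itv/= lte_fin ab.
have [cp|cn|/eqP] := ltrgt0P c; last by rewrite (negbTE c0).
  have -> : scl c @^-1` `]a, b] = `]a / c, b / c]%classic.
    by apply/seteqP; split=> x /=; rewrite /scl !in_itv/= ltr_pdivrMr// ler_pdivlMr// mulrC.
  rewrite lebesgue_measure_itv/= lte_fin ltr_pM2r ?invr_gt0// ab -!EFinD -EFinM.
  by congr EFin; field; rewrite gt_eqF.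
have -> : scl c @^-1` `]a, b] = `[b / c, a / c[%classic.
  apply/seteqP; split=> x /=; rewrite /scl !in_itv/= ler_ndivrMr// ltr_ndivlMr// mulrC andbC//.
rewrite lebesgue_measure_itv/= lte_fin ltr_nM2r ?invr_lt0// ab -!EFinD -EFinM.
by congr EFin; field; rewrite lt_eqF.
Qed.

Lemma ge0_integral_scl (c : R) (f : measurableTypeR R -> \bar R) : c != 0 ->
  measurable_fun setT f -> (forall x, (0 <= f x)%E) ->
  (\int[mu]_x f x = `|c|%:E * \int[mu]_x f (c * x)%R)%E.
Proof.
move=> c0 mf f0.
rewrite (eq_measure_integral (lebesgue_scl c)); last first.
  by move=> A mA _; first [exact: (lebesgue_measure_scl c0 mA)|exact: (esym (lebesgue_measure_scl c0 mA))].
rewrite ge0_integral_mscale//=; congr (_ * _)%E.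
have := @ge0_integral_pushforward _ _ _ _ R (scl c) (measurable_scl c) mu setT f
  measurableT mf (fun x _ => f0 x).
by rewrite preimage_setT.
Qed.

Definition tscale d (c : R) (x : Rtuple R d) : Rtuple R d := [tuple of map (scl c) x].

Lemma tnth_tscale d c (x : Rtuple R d) i : tnth (tscale c x) i = c * tnth x i.
Proof. by rewrite tnth_map. Qed.

Lemma measurable_tscale d c : measurable_fun setT (@tscale d c).
Proof.
apply/measurable_fun_tnthP => i.
rewrite (_ : _ \o _ = scl c \o (fun x : Rtuple R d => tnth x i)).
  exact: (measurableT_comp (measurable_scl c) (measurable_tnth i)).
by apply/funext => x /=; rewrite tnth_tscale.
Qed.

Lemma tscale_cons d c (p : measurableTypeR R * Rtuple R d) :
  tscale c (tuple_cons p) = tuple_cons (c * p.1, tscale c p.2).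
Proof. exact/val_inj. Qed.

Lemma measurable_tuple_cons2 d (t : R) :
  measurable_fun setT (fun x : Rtuple R d => tuple_cons (t, x)).
Proof. by apply: measurable_cons; [exact: measurable_cst|exact: measurable_id]. Qed.

Lemma ge0_integral_tscale d (c : R) (f : Rtuple R d -> \bar R) : c != 0 ->
  measurable_fun setT f -> (forall x, (0 <= f x)%E) ->
  (\int[lebesgueRn R d]_x f x = (`|c| ^+ d)%R%:E * \int[lebesgueRn R d]_x f (tscale c x))%E.
Proof.
move=> c0; elim: d f => [|d IH] f mf f0.
  rewrite expr0 mul1e; apply: eq_integral => x _; congr f.
  by apply: eq_from_tnth => -[].
have mfs : measurable_fun setT (fun x => f (tscale c x)).
  by apply: (measurableT_comp mf); exact: measurable_tscale.
rewrite !integral_lebesgueRn_cons//.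
have mF : measurable_fun setT (fun t : measurableTypeR R => \int[lebesgueRn R d]_x f (tuple_cons (t, x)))%E.
  apply: (@measurable_fun_fubini_tonelli_F _ _ _ _ _ (lebesgueRn R d) (f \o @tuple_cons R d)).
    exact: measurableT_comp mf (measurable_tuple_cons_fun (d:=d)).
  by move=> x; exact: f0.
rewrite (ge0_integral_scl c0 mF) => [|t]; last by apply: integral_ge0 => x _; exact: f0.
rewrite exprS EFinM -muleA; congr (_ * _)%E.
rewrite -ge0_integralZl//; last 2 first.
- apply: (@measurable_fun_fubini_tonelli_F _ _ _ _ _ (lebesgueRn R d)
    ((fun x => f (tscale c x)) \o @tuple_cons R d)).
    exact: measurableT_comp mfs (measurable_tuple_cons_fun (d:=d)).
  by move=> x; exact: f0.
- by move=> t _; apply: integral_ge0 => x _; exact: f0.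
apply: eq_integral => t _; rewrite (IH (fun x => f (tuple_cons (c * t, x)))) //; last first.
  by apply: (measurableT_comp mf); exact: measurable_tuple_cons2.
congr (_ * _)%E; apply: eq_integral => x _; by rewrite tscale_cons.
Qed.

Definition nsq d (x : Rtuple R d) : R := \sum_(i < d) (tnth x i : R) ^+ 2.

Lemma nsq_cons d t (x : Rtuple R d) : nsq (tuple_cons (t, x)) = t ^+ 2 + nsq x.
Proof.
rewrite /nsq big_ord_recl; congr (_ + _); apply: eq_bigr => i _.
by rewrite tnthS.
Qed.

Lemma measurable_nsq d : measurable_fun setT (@nsq d).
Proof.
apply: measurable_sum => i; apply: measurable_funX; exact: measurable_tnth.
Qed.

Lemma integral_gauss1 (lam : R) : 0 < lam ->
  (\int[mu]_x (expR (- (lam * x ^+ 2)))%R%:E = (Num.sqrt (pi / lam))%R%:E)%E.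
Proof.
move=> l0; have s0 : 0 < Num.sqrt lam by rewrite sqrtr_gt0.
have mg : measurable_fun setT (fun x : measurableTypeR R => (gauss_fun x)%:E).
  by apply/measurable_EFinP; exact: measurable_gauss_fun.
have g0 (x : R) : (0 <= (gauss_fun x)%:E)%E by rewrite lee_fin gauss_fun_ge0.
have := ge0_integral_scl (lt0r_neq0 s0) mg g0.
rewrite integralT_gauss (ger0_norm (ltW s0)).
have -> : (\int[mu]_x (gauss_fun (Num.sqrt lam * x)%R)%:E =
    \int[mu]_x (expR (- (lam * x ^+ 2)))%R%:E)%E.
  by apply: eq_integral => x _; rewrite /gauss_fun exprMn sqr_sqrtr// ltW.
move=> H.
transitivity ((Num.sqrt lam)^-1%:E * (Num.sqrt pi)%:E)%E; last first.
  by rewrite -EFinM mulrC sqrtrM ?pi_ge0// sqrtrV// ltW.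
rewrite [X in _ = (_ * X)%E]H muleA -EFinM mulVf ?mul1e//.
exact: lt0r_neq0.
Qed.

Lemma measurable_gauss d (lam : R) :
  measurable_fun setT (fun x : Rtuple R d => (expR (- (lam * nsq x)))%:E).
Proof.
apply/measurable_EFinP; apply: measurableT_comp => //.
apply: measurableT_comp => //; apply: measurable_funM => //.
exact: measurable_nsq.
Qed.

Lemma integral_gauss d (lam : R) : 0 < lam ->
  (\int[lebesgueRn R d]_x (expR (- (lam * nsq x)))%R%:E = (Num.sqrt (pi / lam) ^+ d)%R%:E)%E.
Proof.
move=> l0; elim: d => [|d IH].
  rewrite expr0 integral_dirac//.
  rewrite diracT mul1e /nsq big_ord0 mulr0 oppr0 expR0//.
  exact: measurable_gauss.
rewrite integral_lebesgueRn_cons//.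
- transitivity (\int[mu]_t ((expR (- (lam * t ^+ 2)))%R%:E * (Num.sqrt (pi / lam) ^+ d)%R%:E))%E.
    apply: eq_integral => t _.
    under eq_integral do rewrite nsq_cons mulrDr opprD expRD EFinM.
    rewrite ge0_integralZl//; first by rewrite IH.
    + exact: measurable_gauss.
  rewrite ge0_integralZr//.
  + by rewrite integral_gauss1// -EFinM exprS.
  + apply/measurable_EFinP; apply: measurableT_comp => //.
    apply: measurableT_comp => //; apply: measurable_funM => //.
- exact: measurable_gauss.
Qed.

End LebesgueRn.

(** * The map sin on the strip |Re z| <= pi / 2 *)

Section Strip.
Variable R : realType.
Implicit Types (x y : R) (z w : R[i]).

Definition coshR y : R := (expR y + expR (- y)) / 2.

Lemma coshR_gt0 y : 0 < coshR y.
Proof. by rewrite divr_gt0// addr_gt0// expR_gt0. Qed.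

Lemma coshR_ge1 y : 1 <= coshR y.
Proof. by rewrite ler_pdivlMr// mul1r two_cosh_ge2. Qed.

Lemma sinh_le_cosh y : `|(expR y - expR (- y)) / 2| <= coshR y.
Proof.
have := expR_gt0 y; have := expR_gt0 (- y); rewrite /coshR.
by move=> *; rewrite ler_norml; apply/andP; split; lra.
Qed.

Lemma normc_csin_le x y : normc (csin (x +i* y)) <= expR y + expR (- y).
Proof.
rewrite csinE; apply: (le_trans (normc_le_ReIm (_ +i* _))) => /=.
apply: (@le_trans _ _ (1 * coshR y + 1 * coshR y)); last first.
  by rewrite /coshR !mul1r -splitr.
apply: lerD; rewrite normrM; apply: ler_pM => //.
- by rewrite ler_norml sin_geN1 sin_le1.
- by rewrite (ger0_norm (ltW (coshR_gt0 y))).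
- by rewrite ler_norml cos_geN1 cos_le1.
- exact: sinh_le_cosh.
Qed.

Lemma normc_ccos_le x y : normc (ccos (x +i* y)) <= expR y + expR (- y).
Proof.
rewrite ccosE; apply: (le_trans (normc_le_ReIm (_ +i* _))) => /=.
apply: (@le_trans _ _ (1 * coshR y + 1 * coshR y)); last first.
  by rewrite /coshR !mul1r -splitr.
apply: lerD; rewrite ?normrN normrM; apply: ler_pM => //.
- by rewrite ler_norml cos_geN1 cos_le1.
- by rewrite (ger0_norm (ltW (coshR_gt0 y))).
- by rewrite ler_norml sin_geN1 sin_le1.
- exact: sinh_le_cosh.
Qed.

Lemma Re_ccos_ge0 x y : - (pi / 2) <= x <= pi / 2 -> 0 <= complex.Re (ccos (x +i* y)).
Proof.
move=> hx; rewrite ccosE /=.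
by apply: mulr_ge0; [exact: cos_ge0_pihalf|exact: (ltW (coshR_gt0 y))].
Qed.

Lemma strip_edge x y : (x == - (pi / 2)) || (x == pi / 2) ->
  [/\ exists2 s : R, csin (x +i* y) = s%:C & `|s| = coshR y,
      complex.Re (ccos (x +i* y)) = 0 &
      normc (1 + ccos (x +i* y)) = coshR y].
Proof.
move=> hx.
have [cx sx] : cos x = 0 /\ (sin x = 1 \/ sin x = - 1).
  by case/orP: hx => /eqP ->; rewrite ?cosN ?sinN cos_pihalf sin_pihalf; split; auto.
rewrite csinE ccosE cx !mul0r; split => //.
  exists (sin x * coshR y) => //; rewrite normrM (gtr0_norm (coshR_gt0 y)).
  by case: sx => ->; rewrite ?normrN normr1 mul1r.
rewrite /= addr0 add0r expr1n sqrrN exprMn.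
have -> : sin x ^+ 2 = 1 by case: sx => ->; rewrite ?sqrrN expr1n.
rewrite mul1r -[RHS](ger0_norm (ltW (coshR_gt0 y))) -sqrtr_sqr; congr Num.sqrt.
have e1 : expR y * expR (- y) = 1 by rewrite expRxMexpNx_1.
apply/eqP; rewrite -subr_eq0; apply/eqP.
transitivity (1 - expR y * expR (- y)); last by rewrite e1 subrr.
by rewrite /coshR; field.
Qed.

(** Here [|sin z| = |sinh y|] and [cos z = cosh y]. The first inequality makes [exp (- tau cos z)]
    absorb growth of type [tau] in [sin z]. *)
Lemma strip_mid y : normc (csin (0 +i* y)) <= complex.Re (ccos (0 +i* y)) /\
  normc (1 + ccos (0 +i* y)) <= expR y + expR (- y).
Proof.
rewrite csinE ccosE sin0 cos0 !mul0r !mul1r oppr0; split.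
  by rewrite /= expr0n add0r sqrtr_sqr; exact: sinh_le_cosh.
rewrite /= addr0 expr0n addr0 sqrtr_sqr -/(coshR y).
have := coshR_ge1 y; rewrite ger0_norm; last by rewrite addr_ge0// ltW// coshR_gt0.
by rewrite /coshR; move=> h; lra.
Qed.

Lemma csin0 : csin 0 = 0 :> R[i].
Proof. by have := csinE (0 : R) (0 : R); rewrite sin0 cos0 oppr0 subrr mul0r mul0r mulr0. Qed.

Lemma ccos0 : ccos 0 = 1 :> R[i].
Proof.
have := ccosE (0 : R) (0 : R); rewrite sin0 cos0 oppr0 mul0r mul1r oppr0 expR0 => ->.
by rewrite (_ : (1 + 1) / 2 = 1)//; field.
Qed.

Lemma expR_pow_le (u : R) n : 0 <= u -> (1 + u) ^+ n <= expR (n%:R * u).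
Proof.
move=> u0; rewrite expRM_natl lerXn2r ?nnegrE ?addr_ge0 ?expR_ge0//.
exact: expR_ge1Dx.
Qed.

Lemma logsub_normc f : entire1 f -> logsub (fun z : R[i] => normc (f z)).
Proof.
move=> hf; split; first by move=> z; exact: normc_ge0.
move=> E hE.
rewrite (_ : (fun z => _) = (fun z => normc (f z * E z))); last first.
  by apply/funext => z; rewrite normcM.
have h := entire1M hf hE; split; last by move=> z0 r r0; exact: (mean_value_ineq z0 h r0).
apply: (entire1_continuous_path (@lipschitz_normc R) h).
  by move=> u; exact: cvg_fst.
by move=> u; exact: cvg_snd.
Qed.

(** The sine maps the open strip onto the plane slit along the real rays [|w| >= 1]. In [w = sin z]
    this is [exp (- tau sqrt (1 - w^2)) (1 + sqrt (1 - w^2))^n], whose exponential factor has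
    modulus 1 on the slits. *)
Definition slit_mult (tau : R) (n : nat) z : R[i] :=
  cexp ((- tau)%:C * ccos z) * (1 + ccos z) ^+ n.

Lemma entire1_slit_mult tau n : entire1 (slit_mult tau n).
Proof.
apply: entire1M.
  apply: (entire1_comp (@entire1_cexp R)); apply: entire1M; first exact: entire1_cst.
  exact: entire1_ccos.
by apply: entire1X; apply: entire1D; [exact: entire1_cst|exact: entire1_ccos].
Qed.

Lemma normc_slit_mult tau n z : normc (slit_mult tau n z) =
  expR (- (tau * complex.Re (ccos z))) * normc (1 + ccos z) ^+ n.
Proof.
by rewrite /slit_mult normcM normc_cexp normcX; case: (ccos z) => a b /=; rewrite mul0r subr0 mulNr.
Qed.

Lemma slit_growth (tau : R) n x y : 0 <= tau -> - (pi / 2) <= x <= pi / 2 ->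
  normc (slit_mult tau n (x +i* y)) <= expR (n%:R * (expR y + expR (- y))).
Proof.
move=> t0 hx; rewrite normc_slit_mult -[leRHS]mul1r; apply: ler_pM.
- exact: expR_ge0.
- by rewrite exprn_ge0// normc_ge0.
- by rewrite expR_le1 oppr_le0 mulr_ge0// Re_ccos_ge0.
- apply: le_trans (expR_pow_le n (_ : 0 <= expR y + expR (- y))); last first.
    by rewrite addr_ge0// expR_ge0.
  rewrite lerXn2r ?nnegrE ?normc_ge0 ?addr_ge0 ?expR_ge0//.
  by apply: (le_trans (normcD _ _)); rewrite normc1 lerD2l normc_ccos_le.
Qed.

(** The strip argument in one variable: decay on the real rays is carried over to the segment
    between them, at the cost of the weight at [x]. *)
Lemma slit_bound (g : R[i] -> R[i]) (C tau M : R) n : entire1 g -> 0 <= tau ->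
  (forall z, normc (g z) <= C * expR (tau * normc z)) ->
  (forall t : R, 1 <= `|t| -> normc (g t%:C) * `|t| ^+ n <= M) ->
  forall x, - (pi / 2) <= x <= pi / 2 ->
  normc (g (sin x)%:C) * (expR (- (tau * cos x)) * (1 + cos x) ^+ n) <= M.
Proof.
move=> hg t0 hC hM x hx.
have C0 : 0 <= C.
  have := hC 0; rewrite normc0 mulr0 expR0 mulr1; apply: le_trans; exact: normc_ge0.
have M0 : 0 <= M.
  apply: le_trans (hM 1 _); last by rewrite normr1.
  by rewrite mulr_ge0 ?normc_ge0 ?exprn_ge0.
pose Phi z := g (csin z) * slit_mult tau n z.
have hPhi : entire1 Phi.
  apply: entire1M; last exact: entire1_slit_mult.
  exact: (entire1_comp hg (@entire1_csin R)).
have := @phragmen_lindelof_strip R (fun z => normc (Phi z)) M C (tau + n%:R) C n (logsub_normc hPhi) M0 C0.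
move=> /(_ _ C0 _ _ _ x 0 hx) H.
have xE : x +i* 0 = x%:C by [].
have := H; rewrite /Phi normcM normc_slit_mult csinE ccosE oppr0 expR0 subrr mul0r mulr0.
rewrite (_ : (1 + 1) / 2 = 1); last by field.
rewrite !mulr1 mulr0 oppr0 /= addr0 expr0n addr0 sqrtr_sqr ger0_norm; last first.
  by rewrite addr_ge0// cos_ge0_pihalf.
apply.
- by rewrite addr_ge0.
- move=> x' y hx'; have [[s sE sn] RE NE] := strip_edge y hx'.
  rewrite normcM normc_slit_mult RE mulr0 oppr0 expR0 mul1r NE sE -sn.
  by apply: hM; rewrite sn coshR_ge1.
- move=> y; have [h1 h2] := strip_mid y.
  rewrite normcM normc_slit_mult mulrA; apply: ler_pM.
  + by rewrite mulr_ge0 ?normc_ge0 ?expR_ge0.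
  + by rewrite exprn_ge0 ?normc_ge0.
  + apply: (@le_trans _ _ (C * expR (tau * normc (csin (0 +i* y))) *
      expR (- (tau * complex.Re (ccos (0 +i* y)))))).
      by rewrite ler_wpM2r ?expR_ge0.
    rewrite -mulrA -expRD ler_piMr// expR_le1 -mulrBr mulr_ge0_le0//.
    by rewrite subr_le0.
  + by rewrite lerXn2r ?nnegrE ?normc_ge0 ?addr_ge0 ?expR_ge0.
- move=> x' y hx'; rewrite normcM mulrDl expRD mulrA; apply: ler_pM.
  + exact: normc_ge0.
  + exact: normc_ge0.
  + apply: (le_trans (hC _)); rewrite ler_wpM2l// ler_expR ler_wpM2l//.
    exact: normc_csin_le.
  + exact: slit_growth.
Qed.

End Strip.

(** * Measurability from continuity along paths *)

Section SeparatelyContinuous.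
Variable R : realType.

(** Continuity along all paths with continuous coordinates survives the freezing of one coordinate,
    so the Caratheodory argument can be iterated over the dimension. *)
Lemma measurable_path_continuous d (g : Rtuple R d -> R) :
  (forall gam : 'I_d -> R -> R, (forall i, continuous (gam i)) ->
     continuous (fun t : R => g [tuple (gam i t : measurableTypeR R) | i < d])) ->
  measurable_fun setT g.
Proof.
elim: d g => [|d IH] g hg.
  rewrite (_ : g = cst (g [tuple])); first exact: measurable_cst.
  by apply/funext => x; congr g; apply: eq_from_tnth => -[].
pose h (t : R) (x : Rtuple R d) := g (tuple_cons (t, x)).
have mh : measurable_fun setT (fun p : measurableTypeR R * Rtuple R d => h p.1 p.2).
  apply: measurable_caratheodory.
    move=> x; pose gam (i : 'I_d.+1) : R -> R :=
      if unlift ord0 i is Some j then fun=> tnth x j else id.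
    have cg i : continuous (gam i).
      by rewrite /gam; case: unlift => [j|]; [exact: continuous_fun_cst|exact: continuous_fun_id].
    rewrite (_ : h ^~ x = fun t => g [tuple (gam i t : measurableTypeR R) | i < d.+1]).
      exact: hg.
    apply/funext => t; rewrite /h; congr g; apply: eq_from_tnth => i.
    rewrite tnth_mktuple /gam; case: unliftP => [j ->|->//].
    by rewrite tnthS.
  move=> t; apply: IH => gam cg.
  pose gam' (i : 'I_d.+1) : R -> R :=
    if unlift ord0 i is Some j then gam j else fun=> t.
  have cg' i : continuous (gam' i).
    by rewrite /gam'; case: unlift => [j|]; [exact: cg|exact: continuous_fun_cst].
  rewrite (_ : (fun s => _) = fun s => g [tuple (gam' i s : measurableTypeR R) | i < d.+1]).
    exact: hg.
  apply/funext => s; rewrite /h; congr g; apply: eq_from_tnth => i.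
  rewrite tnth_mktuple /gam'; case: unliftP => [j ->|->//].
  by rewrite tnthS tnth_mktuple.
pose unc (x : Rtuple R d.+1) : measurableTypeR R * Rtuple R d := (thead x, [tuple of behead x]).
have munc : measurable_fun setT unc.
  by apply: measurable_fun_pair; [exact: measurable_tnth|exact: measurable_behead].
rewrite (_ : g = (fun p => h p.1 p.2) \o unc); first exact: measurableT_comp mh munc.
apply/funext => x; rewrite /h /=; congr g; apply/val_inj => /=.
by case/tupleP: x.
Qed.

End SeparatelyContinuous.

(** * Entire functions of several variables on complex multiples of real vectors *)

Section EntireLines.
Variables (R : realType) (d : nat) (F : 'rV[R[i]]_d -> R[i]).
Hypothesis hF : entire F.
Implicit Types (z w : 'rV[R[i]]_d) (x : Rtuple R d).

Lemma entire_continuous z (e : R) : 0 < e -> exists2 dl : R, 0 < dl &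
  forall w, (forall i, normc (w ord0 i - z ord0 i) < dl) -> normc (F w - F z) < e.
Proof.
move=> e0; have /differentiable_continuous cF := hF z.
have /cvgrPdist_lt /(_ e%:C) := cF; rewrite ltcR => /(_ e0) /nbhs_ballP [dl /= dl0 H].
have dlR : dl = (complex.Re dl)%:C by apply/esym/RRe_real/gtr0_real.
exists (complex.Re dl); first by rewrite -ltcR -dlR.
move=> w hw; have {}H := H w; rewrite -ltcR -normr_normc distrC; apply: H.
split=> // i j; rewrite (ord1 i) -ball_normE /= distrC normr_normc dlR ltcR.
exact: hw.
Qed.

Lemma continuous_entire_path (c : R[i]) (gam : 'I_d -> R -> R) :
  (forall i, continuous (gam i)) ->
  continuous (fun t => normc (F (\row_i (c * (gam i t)%:C)))).
Proof.
move=> cg t; apply/cvgrPdist_lt => e e0.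
have [dl dl0 H] := entire_continuous (\row_i (c * (gam i t)%:C)) e0.
pose K := normc c + 1.
have K0 : 0 < K by rewrite ltr_wpDl// normc_ge0.
have dlK : 0 < dl / K by rewrite divr_gt0.
have near_i : \forall s \near t, forall i, `|gam i t - gam i s| < dl / K.
  apply: (@filter_forall _ _ (fun i s => `|gam i t - gam i s| < dl / K) (nbhs t)) => i.
  by move/cvgrPdist_lt : (cg i t) => /(_ _ dlK).
apply: filterS near_i => s hs; rewrite distrC.
apply: le_lt_trans (lipschitz_normc _ _) _; apply: H => i; rewrite !mxE -mulrBr.
rewrite normcM -rmorphB normc_real distrC.
apply: (@le_lt_trans _ _ (K * `|gam i t - gam i s|)).
  by rewrite ler_wpM2r// lerDl.
by rewrite mulrC -ltr_pdivlMr.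
Qed.

Definition rvec (c : R[i]) x : 'rV[R[i]]_d := c *: real_to_complex_vec x.

Lemma measurable_entire_rvec c : measurable_fun setT (fun x => normc (F (rvec c x))).
Proof.
apply: measurable_path_continuous => gam cg.
rewrite (_ : (fun t => _) = (fun t => normc (F (\row_i (c * (gam i t)%:C))))).
  exact: continuous_entire_path.
apply/funext => t; congr (normc (F _)); apply/rowP => i.
by rewrite !mxE tnth_mktuple.
Qed.

Lemma entire1_line x : entire1 (fun c => F (rvec c x)).
Proof.
move=> c.
have dl : differentiable (fun c : R[i]^o => c *: real_to_complex_vec x) c.
  by apply: differentiableZl; have [] := @is_diff_id _ R[i]^o c.
exact: (differentiable_comp dl (hF (rvec c x))).
Qed.

Lemma euclidean_norm_rvec c x : euclidean_norm (rvec c x) = normc c * Num.sqrt (nsq x).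
Proof.
rewrite /euclidean_norm (_ : \sum_i _ = normc c ^+ 2 * nsq x).
  by rewrite sqrtrM ?sqr_ge0// sqrtr_sqr ger0_norm ?normc_ge0.
rewrite /nsq mulr_sumr; apply: eq_bigr => i _.
by rewrite !mxE normcM exprMn normc_real real_normK ?num_real.
Qed.

Lemma rvec_scale (c : R) x : rvec c%:C x = real_to_complex_vec (tscale c x).
Proof.
apply/rowP => i; rewrite !mxE tnth_tscale -[RHS]/((c * tnth x i)%:C).
by rewrite rmorphM.
Qed.

Lemma nsq_ge0 x : 0 <= nsq x.
Proof. by apply: sumr_ge0 => i _; exact: sqr_ge0. Qed.

Definition box (r : R) : set (Rtuple R d) :=
  [set x | forall i, `[- r, r]%classic (tnth x i : R)].

Lemma measurable_box r : measurable (box r).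
Proof.
have -> : box r = \bigcap_(i in [set: 'I_d])
   ((fun t : Rtuple R d => tnth t i) @^-1` `[- r, r]%classic).
  by apply/seteqP; split=> [t h i _|t h i]; [exact: h|exact: (h i Logic.I)].
apply: fin_bigcap_measurable => // i _.
by rewrite -[X in measurable X]setTI; apply: measurable_tnth => //; exact: measurable_itv.
Qed.

Lemma lebesgue_box r : 0 <= r -> lebesgueRn R d (box r) = ((2 * r) ^+ d)%:E.
Proof.
move=> r0; rewrite (@lebesgueRn_box R d (fun=> `[- r, r]%classic)); last by move=> i; exact: measurable_itv.
rewrite (eq_bigr (fun=> (2 * r)%:E)); last first.
  move=> i _; rewrite lebesgue_measure_itv/= lte_fin.
  case: ifPn => [_|]; first by rewrite -EFinD opprK mulr_natl mulr2n.
  rewrite -leNgt => h; have -> : r = 0 by apply/eqP; rewrite eq_le r0 andbT; lra.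
  by rewrite mulr0.
by rewrite prodEFin prodr_const card_ord.
Qed.

Lemma nsq_box r x : 0 <= r -> box r x -> Num.sqrt (nsq x) <= r * Num.sqrt d%:R.
Proof.
move=> r0 hx; rewrite -{1}(ger0_norm r0) -sqrtr_sqr -sqrtrM ?sqr_ge0// ler_wsqrtr//.
rewrite mulr_natr /nsq -[X in _ *+ X]card_ord -sumr_const; apply: ler_sum => i _.
have := hx i; rewrite /= in_itv/= -ler_norml => h.
by rewrite -(real_normK (num_real (tnth x i : R))) lerXn2r ?nnegrE.
Qed.

End EntireLines.

(** * Lower bound on the L^1 norm *)

Section PointEvaluation.
Variables (R : realType) (d : nat) (F : 'rV[R[i]]_d -> R[i]).
Hypothesis hF : entire F.
Variables (tau C N r : R).
Hypothesis tau0 : 0 <= tau.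
Hypothesis hC : forall z, normc (F z) <= C * expR (tau * euclidean_norm z).
Hypothesis hN : (\int[lebesgueRn R d]_x (normc (F (real_to_complex_vec x)))%:E <= N%:E)%E.
Hypothesis r0 : 0 <= r.
Implicit Types (x : Rtuple R d).
Local Notation m := (lebesgueRn R d).
Local Notation g := (\1_(box (R := R) (d := d) r) : Rtuple R d -> R).

Let C0 : 0 <= C.
Proof.
have := hC 0; rewrite /euclidean_norm big1 => [|i _]; last by rewrite mxE normc0 expr0n.
rewrite sqrtr0 mulr0 expR0 mulr1; apply: le_trans; exact: normc_ge0.
Qed.

Let rho := r * Num.sqrt d%:R.
Let rho0 : 0 <= rho. Proof. by rewrite mulr_ge0// sqrtr_ge0. Qed.

Let g0 x : 0 <= g x. Proof. by rewrite indicE. Qed.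

Let ig : m.-integrable setT (EFin \o g).
Proof.
apply/integrableP; split.
  by apply/measurable_EFinP; apply: measurable_indic; exact: measurable_box.
under eq_integral do rewrite /= ger0_norm//.
rewrite integral_indic ?setIT//; last exact: measurable_box.
by rewrite [X in (X < _)%E](lebesgue_box d r0) ltry.
Qed.

(** Restricting [x] to a box bounds [|x|], hence gives the domination and the growth bounds. On the
    edges the indicator is simply bounded by 1, so the final estimate by [N] does not depend on
    [r]. *)
Let Phi x (z : R[i]) : R[i] :=
  (g x)%:C * F (rvec (csin z) x) * slit_mult (tau * Num.sqrt (nsq x)) d z.

Let normc_Phi x z : normc (Phi x z) =
  g x * normc (F (rvec (csin z) x)) *
  (expR (- (tau * Num.sqrt (nsq x) * complex.Re (ccos z))) * normc (1 + ccos z) ^+ d).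
Proof. by rewrite /Phi normcM normcM normc_real normc_slit_mult ger0_norm. Qed.

Let F_bound x z : box r x -> normc (F (rvec z x)) <= C * expR (tau * rho * normc z).
Proof.
move=> hx; apply: (le_trans (hC _)); rewrite ler_wpM2l// ler_expR.
rewrite -mulrA ler_wpM2l// euclidean_norm_rvec mulrC ler_wpM2r ?normc_ge0//.
exact: nsq_box.
Qed.

Let tau_bound x : box r x -> tau * Num.sqrt (nsq x) <= tau * rho.
Proof. by move=> hx; rewrite ler_wpM2l//; exact: nsq_box. Qed.

Let Phi_le x z (K : R) :
  (box r x -> normc (F (rvec (csin z) x)) *
     (expR (- (tau * Num.sqrt (nsq x) * complex.Re (ccos z))) * normc (1 + ccos z) ^+ d) <= K) ->
  normc (Phi x z) <= K * g x.
Proof.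
move=> H; rewrite normc_Phi indicE; case: (boolP (x \in box r)) => [/set_mem|_].
  by move=> hx; rewrite mul1r mulr1; exact: H.
by rewrite !mul0r mulr0.
Qed.

Let measurable_sqrt_nsq : measurable_fun setT (fun x : Rtuple R d => Num.sqrt (nsq x)).
Proof.
have ms : measurable_fun setT (@Num.sqrt R).
  by apply: continuous_measurable_fun; exact: sqrt_continuous.
exact: (measurableT_comp ms (@measurable_nsq R d)).
Qed.

Let hPhi : avg_family g Phi.
Proof.
split.
- move=> x; apply: entire1M; last exact: entire1_slit_mult.
  apply: entire1M; first exact: entire1_cst.
  exact: (entire1_comp (entire1_line hF x) (@entire1_csin R)).
- move=> z; under eq_fun do rewrite normc_Phi.
  apply: measurable_funM; first apply: measurable_funM.
  + by apply: measurable_indic; exact: measurable_box.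
  + exact: measurable_entire_rvec.
  + apply: measurable_funM => //; apply: measurableT_comp => //.
    apply: measurableT_comp => //; apply: measurable_funM => //.
    exact: measurable_funM.
- move=> z.
  have [d1 d10 H1] := entire1_continuous z (@entire1_csin R) ltr01.
  have [d2 d20 H2] := entire1_continuous z (@entire1_ccos R) ltr01.
  exists (Num.min d1 d2); first by rewrite lt_min d10.
  pose s := normc (csin z) + 1; pose c := normc (ccos z) + 1.
  exists (C * expR (tau * rho * s) * (expR (tau * rho * c) * (1 + c) ^+ d)) => w x.
  rewrite lt_min => /andP[/H1{}H1 /H2{}H2]; apply: Phi_le => hx.
  have hs : normc (csin (z + w)) <= s.
    rewrite -(subrK (csin z) (csin (z + w))) addrC.
    by apply: (le_trans (normcD _ _)); rewrite lerD2l ltW.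
  have hc : normc (ccos (z + w)) <= c.
    rewrite -(subrK (ccos z) (ccos (z + w))) addrC.
    by apply: (le_trans (normcD _ _)); rewrite lerD2l ltW.
  have c0 : 0 <= c := le_trans (normc_ge0 _) hc.
  have tr0 : 0 <= tau * rho by rewrite mulr_ge0.
  apply: ler_pM; rewrite ?mulr_ge0 ?normc_ge0 ?expR_ge0 ?exprn_ge0 ?normc_ge0//.
    apply: (le_trans (F_bound _ hx)); rewrite ler_wpM2l// ler_expR.
    by rewrite ler_wpM2l.
  apply: ler_pM; rewrite ?expR_ge0 ?exprn_ge0 ?normc_ge0//.
    have hR : - complex.Re (ccos (z + w)) <= c.
      by apply: le_trans hc; apply: le_trans (Re_le_normc _); rewrite -normrN ler_norm.
    rewrite ler_expR -mulrN; apply: (le_trans (ler_wpM2l _ hR)).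
      by rewrite mulr_ge0// sqrtr_ge0.
    by rewrite ler_wpM2r// tau_bound.
  rewrite lerXn2r ?nnegrE ?normc_ge0 ?(addr_ge0 ler01 c0)//.
  by apply: (le_trans (normcD _ _)); rewrite normc1 lerD2l.
Qed.

Let Int_g : \int[m]_x g x = (2 * r) ^+ d.
Proof.
rewrite /Rintegral integral_indic ?setIT//; last exact: measurable_box.
by rewrite [X in fine X](lebesgue_box d r0).
Qed.

Let avg_le z K : (forall x, normc (Phi x z) <= K * g x) -> avg m Phi z <= K * (2 * r) ^+ d.
Proof.
move=> H; rewrite -Int_g -RintegralZl//.
have i1 := avg_integrable ig z hPhi.
have i2 : m.-integrable setT (EFin \o (fun x => K * g x)).
  by under [X in _.-integrable _ X]eq_fun do rewrite /= EFinM; exact: integrableZl.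
exact: (le_Rintegral measurableT i1 i2 (fun x _ => H x)).
Qed.

Lemma integrable_box_expR :
  m.-integrable setT (EFin \o (fun x => g x * expR (- (tau * Num.sqrt (nsq x))))).
Proof.
apply: (@le_integrable _ _ _ m setT measurableT _ (EFin \o g)) => //.
  apply/measurable_EFinP; apply: measurable_funM; first by apply: measurable_indic; exact: measurable_box.
  apply: measurableT_comp => //; apply: measurableT_comp => //; exact: measurable_funM.
move=> x _; rewrite /= lee_fin normrM (ger0_norm (expR_ge0 _)) ler_piMr//.
by rewrite expR_le1 oppr_le0 mulr_ge0// sqrtr_ge0.
Qed.

Lemma point_evaluation_box :
  2 ^+ d * normc (F 0) * \int[m]_x (g x * expR (- (tau * Num.sqrt (nsq x)))) <= N.
Proof.
have N0 : 0 <= N.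
  by rewrite -lee_fin; apply: le_trans hN; apply: integral_ge0 => x _; rewrite lee_fin normc_ge0.
have vol0 : 0 <= (2 * r) ^+ d by rewrite exprn_ge0// mulr_ge0.
have tr0 : 0 <= tau * rho by rewrite mulr_ge0.
have CV0 : 0 <= C * (2 * r) ^+ d by rewrite mulr_ge0.
have trd0 : 0 <= tau * rho + d%:R by rewrite addr_ge0.
have key := @phragmen_lindelof_strip R (avg m Phi) N (C * (2 * r) ^+ d) (tau * rho + d%:R) (C * (2 * r) ^+ d) d
  (avg_logsub ig hPhi) N0 CV0 trd0 CV0.
have : avg m Phi 0 <= N.
  have pi0 : 0 <= (pi : R) / 2 by rewrite divr_ge0// pi_ge0.
  apply: (key _ _ _ 0 0) => [x y hx|y|x y hx|]; last by rewrite oppr_le0 pi0.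
  - have [[s sE sn] RE NE] := strip_edge y hx.
    have s0 : s != 0 by rewrite -normr_gt0 sn coshR_gt0.
    rewrite -lee_fin /avg /Rintegral fineK; last first.
      by apply: integrable_fin_num => //; exact: (avg_integrable ig _ hPhi).
    apply: le_trans hN.
    have mF : measurable_fun setT (fun x : Rtuple R d => (normc (F (real_to_complex_vec x)))%:E).
      apply/measurable_EFinP.
      rewrite (_ : (fun x => _) = (fun x => normc (F (rvec 1 x)))); first exact: measurable_entire_rvec.
      by apply/funext => x'; rewrite /rvec scale1r.
    have mFs : measurable_fun setT (fun x : Rtuple R d => (normc (F (real_to_complex_vec (tscale s x))))%:E).
      exact: (measurableT_comp mF (@measurable_tscale R d s)).
    have F0 (x' : Rtuple R d) : (0 <= (normc (F (real_to_complex_vec x')))%:E)%E.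
      by rewrite lee_fin normc_ge0.
    rewrite (ge0_integral_tscale s0 mF F0).
    rewrite -(ge0_integralZl m measurableT mFs (fun x' _ => F0 _)); last by rewrite lee_fin exprn_ge0.
    apply: ge0_le_integral => //.
    + by move=> x' _; rewrite lee_fin normc_ge0.
    + by apply/measurable_EFinP; case: hPhi => _ h _; exact: h.
    + by apply: emeasurable_funM => //; exact: mFs.
    move=> x' _; rewrite lee_fin normc_Phi sE RE NE mulr0 oppr0 expR0 mul1r rvec_scale sn mulrC.
    rewrite ler_wpM2l ?exprn_ge0 ?(ltW (coshR_gt0 y))// ler_piMl ?normc_ge0//.
  - have [h1 h2] := strip_mid y; rewrite -mulrA (mulrC (_ ^+ d)) mulrA.
    apply: avg_le => x'; apply: Phi_le => hx; rewrite mulrA; apply: ler_pM.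
    + by rewrite mulr_ge0 ?normc_ge0 ?expR_ge0.
    + by rewrite exprn_ge0 ?normc_ge0.
    + apply: (@le_trans _ _ (C * expR (tau * Num.sqrt (nsq x') * normc (csin (0 +i* y))) *
        expR (- (tau * Num.sqrt (nsq x') * complex.Re (ccos (0 +i* y)))))).
        rewrite ler_wpM2r ?expR_ge0//; apply: (le_trans (hC _)).
        by rewrite euclidean_norm_rvec (mulrC (normc _)) mulrA.
      rewrite -mulrA -expRD ler_piMr// expR_le1 -mulrBr mulr_ge0_le0//.
        by rewrite mulr_ge0// sqrtr_ge0.
      by rewrite subr_le0.
    + by rewrite lerXn2r ?nnegrE ?normc_ge0 ?addr_ge0 ?expR_ge0.
  - rewrite -mulrA (mulrC (_ ^+ d)) mulrA.
    apply: avg_le => x'; apply: Phi_le => hx'.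
    rewrite mulrDl expRD mulrA; apply: ler_pM.
    + exact: normc_ge0.
    + by rewrite -normc_slit_mult normc_ge0.
    + apply: (le_trans (F_bound _ hx')); rewrite ler_wpM2l// ler_expR ler_wpM2l//.
      exact: normc_csin_le.
    + rewrite -normc_slit_mult; apply: slit_growth => //.
      by rewrite mulr_ge0// sqrtr_ge0.
congr (_ <= _); rewrite /avg -RintegralZl//.
  apply: eq_Rintegral => x _; rewrite normc_Phi csin0 ccos0 mulr1 /rvec scale0r.
  have -> : (1 + 1 : R[i]) = (2 : R)%:C by rewrite rmorph_nat.
  rewrite normc_real ger0_norm// /=.
  ring.
exact: integrable_box_expR.
Qed.

End PointEvaluation.

Section L1LowerBound.
Variables (R : realType) (d : nat).
Implicit Types (f : Rtuple R d -> R[i]).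
Local Notation m := (lebesgueRn R d).

Lemma inL1_normc f : inL1 f -> measurable_fun setT (fun x => normc (f x)) ->
  m.-integrable setT (EFin \o (fun x => normc (f x))).
Proof.
move=> [h1 h2] mf.
have i1 := integrable_abse h1; have i2 := integrable_abse h2.
have i12 := integrableD measurableT i1 i2.
apply: (le_integrable measurableT _ _ i12).
  exact/measurable_EFinP.
move=> x _ /=; rewrite lee_fin (ger0_norm (normc_ge0 _)).
apply: le_trans (ler_norm _); exact: normc_le_ReIm.
Qed.

Lemma PW11_measurable f : PW11 f -> measurable_fun setT (fun x => normc (f x)).
Proof.
move=> [_ [F [hF _ fF]]].
rewrite (_ : (fun x => _) = (fun x => normc (F (rvec 1 x)))).
  exact: measurable_entire_rvec.
by apply/funext => x; rewrite /rvec scale1r -fF.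
Qed.

Lemma box_cover : \bigcup_n @box R d n%:R = setT.
Proof.
apply/seteqP; split=> // x _.
exists (Num.bound (Num.sqrt (nsq x))) => // i.
rewrite /= in_itv /= -ler_norml; apply/ltW/(le_lt_trans _ (archi_boundP (sqrtr_ge0 _))).
rewrite -sqrtr_sqr ler_wsqrtr// /nsq (bigD1 i)//= lerDl.
by apply: sumr_ge0 => j _; exact: sqr_ge0.
Qed.

Lemma box_homo : {homo (fun n : nat => @box R d n%:R) : n k / (n <= k)%N >-> (n <= k)%O}.
Proof.
move=> n k nk; apply/subsetPset => x hx i; have := hx i.
rewrite /= !in_itv /= -!ler_norml => /le_trans; apply.
by rewrite ler_nat.
Qed.

Lemma L1norm_ge_tau f (e : R) : PW11 f -> f [tuple of nseq d (0 : measurableTypeR R)] = 1 ->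
  (0 < d)%N -> 0 < e ->
  (2 * expR (- ((1 + e) / 2)) * Num.sqrt (2 * pi * d%:R / (1 + e))) ^+ d <= L1norm f.
Proof.
move=> pf f0 d0 e0; have [il1 [F [hF tF fF]]] := pf.
have [C hC] := tF e e0.
have inf := inL1_normc il1 (PW11_measurable pf).
have dR : 0 < d%:R :> R by rewrite ltr0n.
pose tau := 1 + e; have tau0 : 0 < tau by rewrite addr_gt0.
have hN : (\int[m]_x (normc (F (real_to_complex_vec x)))%:E <= (L1norm f)%:E)%E.
  rewrite /L1norm /Rintegral fineK; last exact: integrable_fin_num.
  by rewrite le_eqVlt; apply/orP; left; apply/eqP; apply: eq_integral => x _; rewrite fF.
have F0 : F 0 = 1.
  rewrite -f0 fF; congr F; apply/rowP => i.
  by rewrite !mxE tnth_nseq.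
(* From [(s - d)^2 >= 0] one gets [tau * s <= lam * s^2 + tau * d / 2]. Equality holds at [s = d],
   close to where [s^(d-1) exp (- tau s)] peaks when [tau] is near 1, so little is lost. *)
pose lam := tau / (2 * d%:R).
have lam0 : 0 < lam by rewrite divr_gt0// mulr_gt0.
pose q := expR (- (tau * d%:R / 2)).
have q0 : 0 < q := expR_gt0 _.
pose K := L1norm f / (2 ^+ d * q).
have p20 : 0 < (2 : R) ^+ d by rewrite exprn_gt0.
have pq0 : 0 < 2 ^+ d * q by rewrite mulr_gt0.
have mg := @measurable_gauss R d lam.
have boxle (n : nat) : (\int[m]_(x in box n%:R) (expR (- (lam * nsq x)))%:E <= K%:E)%E.
  have n0 : 0 <= n%:R :> R by [].
  have := point_evaluation_box hF (ltW tau0) hC hN n0; rewrite F0 normc1 mulr1 => H.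
  have iI := @integrable_box_expR R d tau n%:R (ltW tau0) n0.
  set h := (fun x : Rtuple R d => _) in H iI.
  have iq : m.-integrable setT (EFin \o (fun x => q^-1 * h x)).
    by under [X in _.-integrable _ X]eq_fun do rewrite /= EFinM; exact: integrableZl.
  apply: (@le_trans _ _ (\int[m]_x (q^-1 * h x)%:E)%E); last first.
    have := RintegralZl q^-1 measurableT iI; rewrite /Rintegral => hq.
    rewrite -[leLHS]fineK; last exact: integrable_fin_num.
    rewrite hq lee_fin /K invfM mulrA (mulrC q^-1) ler_pM2r ?invr_gt0//.
    by rewrite ler_pdivlMr// mulrC.
  rewrite integral_mkcond; apply: ge0_le_integral => //.
  - by move=> x _; rewrite patchE; case: ifP => // _; rewrite lee_fin expR_ge0.
  - apply/(measurable_restrictT _ _).1; first exact: measurable_box.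
    exact: measurable_funTS.
  - exact: (measurable_int _ iq).
  move=> x _; rewrite patchE /h indicE; case: (x \in _); last first.
    by rewrite mul0r mulr0.
  rewrite mul1r lee_fin -expRN -expRD ler_expR opprK.
  set s := Num.sqrt _.
  have sE : nsq x = s ^+ 2 by rewrite sqr_sqrtr// nsq_ge0.
  rewrite sE -subr_ge0 (_ : _ - _ = tau / (2 * d%:R) * (s - d%:R) ^+ 2).
    by rewrite mulr_ge0 ?sqr_ge0// ltW.
  by rewrite /lam; field; rewrite gt_eqF.
have : (\int[m]_x (expR (- (lam * nsq x)))%:E <= K%:E)%E.
  rewrite -box_cover.
  have cv := @ge0_nondecreasing_set_cvg_integral _ _ R (fun n : nat => @box R d n%:R)
    (fun x => (expR (- (lam * nsq x)))%:E) m box_homo (fun n => @measurable_box R d n%:R)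
    (fun n => measurable_funTS mg) (fun n x _ => expR_ge0 _).
  rewrite -(cvg_lim _ cv)//; apply: lime_le; last exact: nearW.
  by apply/cvg_ex; eexists; exact: cv.
rewrite integral_gauss// lee_fin /K ler_pdivlMr// mulrCA => H.
apply: le_trans H; rewrite !exprMn mulrCA -mulrA mulrCA.
have -> : q = expR (- ((1 + e) / 2)) ^+ d.
  by rewrite /q -expRM_natl; congr expR; rewrite /tau; field.
rewrite (_ : pi / lam = 2 * pi * d%:R / (1 + e)).
  by rewrite le_eqVlt; apply/orP; left; apply/eqP; ring.
by rewrite /lam -/tau; field; rewrite !gt_eqF.
Qed.

(** The type condition only gives types [1 + e], so [e] must tend to 0. Per dimension [e] costs a
    factor at least [exp (- e)], half of it from the exponential and half from [sqrt (1 + e)], hence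
    [1 - e d] in all. *)
Lemma L1norm_ge f : PW11 f -> f [tuple of nseq d (0 : measurableTypeR R)] = 1 ->
  (0 < d)%N -> (2 * expR (- (1 / 2)) * Num.sqrt (2 * pi * d%:R)) ^+ d <= L1norm f.
Proof.
move=> pf f0 d0; set a := 2 * _ * _.
have dR : 0 < d%:R :> R by rewrite ltr0n.
have a0 : 0 <= a by rewrite !mulr_ge0 ?expR_ge0 ?sqrtr_ge0.
have ad0 : 0 <= a ^+ d by rewrite exprn_ge0.
have step e : 0 < e -> a ^+ d * (1 - e * d%:R) <= L1norm f.
  move=> e0; apply: le_trans (L1norm_ge_tau pf f0 d0 e0).
  have e1 : 0 < 1 + e by rewrite addr_gt0.
  apply: (@le_trans _ _ ((a * expR (- e)) ^+ d)).
    rewrite [leRHS]exprMn ler_wpM2l// -expRM_natl; apply: le_trans (expR_ge1Dx _).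
    by rewrite mulrN mulrC.
  rewrite lerXn2r ?nnegrE ?mulr_ge0 ?expR_ge0 ?sqrtr_ge0// /a.
  have -> : - ((1 + e) / 2) = - (1 / 2) + - (e / 2) :> R by field.
  have -> : Num.sqrt (2 * pi * d%:R / (1 + e)) = Num.sqrt (2 * pi * d%:R) / Num.sqrt (1 + e) :> R.
    rewrite sqrtrM; first by rewrite sqrtrV// ltW.
    by rewrite !mulr_ge0// pi_ge0.
  rewrite expRD.
  have -> : expR (- e) = expR (- (e / 2)) * expR (- (e / 2)) :> R.
    by rewrite -expRD; congr expR; field.
  set s := Num.sqrt (2 * pi * d%:R); set u := expR (- (e / 2)); set v := expR _.
  have -> : 2 * (v * u) * (s / Num.sqrt (1 + e)) = 2 * v * s * (u * (Num.sqrt (1 + e))^-1) by ring.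
  rewrite ler_wpM2l ?ler_wpM2l ?mulr_ge0 ?expR_ge0 ?sqrtr_ge0//.
  rewrite /u expRN lef_pV2 ?posrE ?sqrtr_gt0 ?expR_gt0//.
  rewrite -(ger0_norm (expR_ge0 (e / 2))) -sqrtr_sqr ler_wsqrtr//.
  by rewrite -expRM_natl mulrCA divff// mulr1; exact: expR_ge1Dx.
apply/ler_addgt0Pr => e e0.
pose e' := e / (a ^+ d * d%:R + 1).
have den : 0 < a ^+ d * d%:R + 1 by rewrite ltr_wpDl// mulr_ge0// ltW.
have e'0 : 0 < e' by rewrite divr_gt0.
have := step e' e'0; rewrite mulrBr mulr1 lerBlDr => /le_trans; apply.
rewrite lerD2l (_ : a ^+ d * (e' * d%:R) = e * (a ^+ d * d%:R) / (a ^+ d * d%:R + 1)).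
  by rewrite ler_pdivrMr// ler_pM2l// lerDl.
by rewrite /e'; ring.
Qed.

End L1LowerBound.

(** * The test function *)

Section ComplexPowerSeries.
Variable R : realType.
Implicit Types (a : nat -> R) (w h : R[i]) (u : nat -> R[i]).

Definition cseq u (l : R[i]) := forall e : R, 0 < e ->
  exists N, forall n, (N <= n)%N -> normc (u n - l) < e.

Lemma cseq_normc_le u l (X : R) : cseq u l -> (forall n, normc (u n) <= X) -> normc l <= X.
Proof.
move=> ul uX; apply/ler_addgt0Pr => e e0; have [N HN] := ul e e0.
rewrite -(subrK (u N) l); apply: (le_trans (normcD _ _)).
rewrite addrC lerD// -normcN opprB; exact: (ltW (HN N (leqnn N))).
Qed.

Lemma cseq_unique u l l' : cseq u l -> cseq u l' -> l = l'.
Proof.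
move=> ul ul'; apply/eqP; rewrite -subr_eq0; apply/eqP/eq0_normc/eqP.
rewrite eq_le normc_ge0 andbT; apply/ler_addgt0Pr => e e0; rewrite add0r.
have e2 : 0 < e / 2 by rewrite divr_gt0.
have [N HN] := ul _ e2; have [N' HN'] := ul' _ e2.
have := HN (maxn N N') (leq_maxl _ _); have := HN' (maxn N N') (leq_maxr _ _).
set v := u _ => h1 h2; have -> : l - l' = (v - l') - (v - l) by ring.
by rewrite (splitr e) (le_trans (normcD _ _))// normcN lerD// ltW.
Qed.

Lemma cseqD u v l l' : cseq u l -> cseq v l' -> cseq (fun n => u n + v n) (l + l').
Proof.
move=> ul vl e e0; have e2 : 0 < e / 2 by rewrite divr_gt0.
have [N HN] := ul _ e2; have [N' HN'] := vl _ e2.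
exists (maxn N N') => n; rewrite geq_max => /andP[/HN h1 /HN' h2].
rewrite opprD addrACA (splitr e).
by apply: (le_lt_trans (normcD _ _)); rewrite ltrD.
Qed.

Lemma cseqZ u l c : cseq u l -> cseq (fun n => c * u n) (c * l).
Proof.
move=> ul e e0; have c0 : 0 < normc c + 1 by rewrite ltr_wpDl// normc_ge0.
have [N HN] := ul (e / (normc c + 1)) (divr_gt0 e0 c0).
exists N => n /HN; rewrite ltr_pdivlMr// => hn.
rewrite -mulrBr normcM; apply: le_lt_trans hn.
by rewrite mulrC ler_wpM2l ?normc_ge0// lerDl.
Qed.

Definition cpoly a w n : R[i] := \sum_(k < n) (a k)%:C * w ^+ k.

(** Infinite radius of convergence, in the form of bounded absolute partial sums. *)
Definition absbnd a := forall r : R, 0 <= r -> exists X, forall n,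
  \sum_(k < n) `|a k| * r ^+ k <= X.

(** Limits are taken in [R], part by part, so that absolute convergence of real series applies. *)
Definition cpseries a w : R[i] :=
  limn (fun n => complex.Re (cpoly a w n)) +i* limn (fun n => complex.Im (cpoly a w n)).

Lemma absbnd_cvg (c b : nat -> R) X : (forall n, \sum_(k < n) b k <= X) ->
  (forall k, `|c k| <= b k) -> cvgn (series c).
Proof.
move=> hX hcb; apply: normed_cvg; apply: nondecreasing_is_cvgn.
  by apply: nondecreasing_series => n _ _; exact: normr_ge0.
exists X => _ [n _ <-]; rewrite /= /series /= big_mkord.
by apply: le_trans (hX n); apply: ler_sum => k _; exact: hcb.
Qed.

Lemma ReD : {morph (@complex.Re R) : z w / z + w}.
Proof. by move=> [? ?] [? ?]. Qed.
Lemma ImD : {morph (@complex.Im R) : z w / z + w}.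
Proof. by move=> [? ?] [? ?]. Qed.

Lemma cseq_cpseries a w : absbnd a -> cseq (cpoly a w) (cpseries a w).
Proof.
move=> ha e e0; have [X hX] := ha (normc w) (normc_ge0 w).
have cl k : normc ((a k)%:C * w ^+ k) = `|a k| * normc w ^+ k.
  by rewrite normcM normc_real normcX.
pose cr k := complex.Re ((a k)%:C * w ^+ k).
pose ci k := complex.Im ((a k)%:C * w ^+ k).
have crE : (fun n => complex.Re (cpoly a w n)) = series cr.
  by apply/funext => n; rewrite /cpoly (big_morph _ ReD (erefl _)) /series /= big_mkord.
have ciE : (fun n => complex.Im (cpoly a w n)) = series ci.
  by apply/funext => n; rewrite /cpoly (big_morph _ ImD (erefl _)) /series /= big_mkord.
have cvr : cvgn (series cr).
  by apply: (absbnd_cvg (b := fun k => `|a k| * normc w ^+ k) hX) => k; rewrite -cl; exact: Re_le_normc.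
have cvi : cvgn (series ci).
  by apply: (absbnd_cvg (b := fun k => `|a k| * normc w ^+ k) hX) => k; rewrite -cl; exact: Im_le_normc.
have e2 : 0 < e / 2 by rewrite divr_gt0.
have /cvgrPdist_lt /(_ _ e2) [N _ HN] := cvr.
have /cvgrPdist_lt /(_ _ e2) [N' _ HN'] := cvi.
exists (maxn N N') => n; rewrite geq_max => /andP[/HN h1 /HN' h2].
apply: (le_lt_trans (normc_le_ReIm _)).
rewrite Re_sub Im_sub /cpseries crE ciE.
rewrite -[complex.Re (cpoly a w n)]/((fun n => complex.Re (cpoly a w n)) n) crE.
rewrite -[complex.Im (cpoly a w n)]/((fun n => complex.Im (cpoly a w n)) n) ciE.
by rewrite (splitr e) ltrD// distrC.
Qed.

Lemma normc_cpseries_le a w X : absbnd a ->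
  (forall n, \sum_(k < n) `|a k| * normc w ^+ k <= X) -> normc (cpseries a w) <= X.
Proof.
move=> ha hX; apply: (cseq_normc_le (cseq_cpseries w ha)) => n.
apply: le_trans (hX n); elim: n => [|n IH]; first by rewrite /cpoly !big_ord0 normc0.
rewrite /cpoly !big_ord_recr /=; apply: (le_trans (normcD _ _)); rewrite lerD//.
by rewrite normcM normc_real normcX.
Qed.

Lemma cpseries_real a (x l : R) : absbnd a ->
  (fun n => \sum_(k < n) a k * x ^+ k) @ \oo --> l -> cpseries a x%:C = l%:C.
Proof.
move=> ha hl; apply: (cseq_unique (cseq_cpseries _ ha)) => e e0.
have /cvgrPdist_lt /(_ _ e0) [N _ HN] := hl; exists N => n /HN.
rewrite distrC /cpoly (eq_bigr (fun k : 'I_n => (a k * x ^+ k)%:C)) => [|k _].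
  by rewrite -rmorph_sum -rmorphB normc_real.
by rewrite rmorphM rmorphXn.
Qed.

Definition dcoef a k := k.+1%:R * a k.+1.

Lemma natr_le_pow2 k : k%:R <= (2 : R) ^+ k.
Proof. by rewrite -natrX ler_nat ltnW// ltn_expl. Qed.

(** Doubling the radius absorbs the factor, since [k + 1 <= 2^(k+1)]; passing from [r] to [r + 1]
    makes up for the extra power. *)
Lemma absbnd_dcoef a : absbnd a -> absbnd (dcoef a).
Proof.
move=> ha r r0; have [|X hX] := ha (2 * (r + 1)); first by rewrite mulr_ge0// addr_ge0.
exists X => n; apply: le_trans (hX n.+1); rewrite big_ord_recl.
apply: ler_wpDl; first by rewrite mulr_ge0 ?exprn_ge0// mulr_ge0// addr_ge0.
apply: ler_sum => k _; rewrite /dcoef lift0 normrM ger0_norm//.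
rewrite mulrAC mulrC; apply: ler_wpM2l => //.
rewrite exprMn; apply: ler_pM; rewrite ?exprn_ge0//; first exact: natr_le_pow2.
rewrite exprS -[leLHS]mul1r; apply: ler_pM; rewrite ?exprn_ge0//.
  by rewrite lerDr.
by rewrite lerXn2r ?nnegrE ?addr_ge0// lerDl.
Qed.

Lemma cpow_taylor (w h : R[i]) k : normc h <= 1 ->
  normc ((w + h) ^+ k - w ^+ k - k%:R * w ^+ k.-1 * h) <=
  normc h ^+ 2 * (k%:R ^+ 2 * (normc w + 1) ^+ k).
Proof.
move=> h1; set rho := normc w + 1.
have rho1 : 1 <= rho by rewrite lerDr normc_ge0.
have rho0 : 0 <= rho := le_trans ler01 rho1.
have n0 := normc_ge0 h.
elim: k => [|k IH].
  by rewrite !expr0 !mul0r subrr subr0 normc0 expr0n mul0r mulr0.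
have -> : (w + h) ^+ k.+1 - w ^+ k.+1 - k.+1%:R * w ^+ k.+1.-1 * h =
  (w + h) * ((w + h) ^+ k - w ^+ k - k%:R * w ^+ k.-1 * h) + k%:R * w ^+ k.-1 * h ^+ 2.
  rewrite /= !exprS -natr1; case: k {IH} => [|k] /=; first by rewrite !expr0; ring.
  by rewrite !exprS; ring.
apply: (le_trans (normcD _ _)).
apply: (@le_trans _ _ (rho * (normc h ^+ 2 * (k%:R ^+ 2 * rho ^+ k)) +
   k%:R * rho ^+ k * normc h ^+ 2)).
  apply: lerD.
    rewrite normcM; apply: ler_pM; rewrite ?normc_ge0//.
    by apply: (le_trans (normcD _ _)); rewrite lerD2l.
  rewrite normcM normcX normcM normcX -(rmorph_nat (real_complex R)) normc_real ger0_norm//.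
  rewrite ler_wpM2r ?exprn_ge0// ler_wpM2l//.
  case: k {IH} => [|k] //=; apply: (@le_trans _ _ (rho ^+ k)).
    by rewrite lerXn2r ?nnegrE ?normc_ge0// lerDl.
  by rewrite exprS ler_peMl// exprn_ge0.
rewrite -subr_ge0.
have -> : normc h ^+ 2 * (k.+1%:R ^+ 2 * rho ^+ k.+1) -
   (rho * (normc h ^+ 2 * (k%:R ^+ 2 * rho ^+ k)) + k%:R * rho ^+ k * normc h ^+ 2) =
   normc h ^+ 2 * rho ^+ k * ((rho - 1) * k%:R + rho * (k%:R + 1)).
  by rewrite -natr1 (exprS rho); ring.
apply: mulr_ge0; first by rewrite mulr_ge0 ?exprn_ge0.
by apply: addr_ge0; apply: mulr_ge0 => //; rewrite ?subr_ge0 ?addr_ge0.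
Qed.

Lemma entire1_cpseries a : absbnd a -> entire1 (cpseries a).
Proof.
move=> ha w; apply/cdiffP; exists (cpseries (dcoef a) w) => e e0.
have hd := absbnd_dcoef ha; pose rho := normc w + 1.
have rho0 : 0 <= rho by rewrite addr_ge0 ?normc_ge0.
(* The Taylor remainder carries [k^2 rho^k], and [k^2 <= 4^k]. *)
have [|X hX] := ha (4 * rho); first by rewrite mulr_ge0.
have X0 : 0 <= X by have := hX 0%N; rewrite big_ord0.
have X1 : 0 < X + 1 by rewrite ltr_wpDl.
exists (Num.min 1 (e / (X + 1))); first by rewrite lt_min ltr01 divr_gt0.
move=> h; rewrite lt_min => /andP[h1]; rewrite ltr_pdivlMr// => he.
apply: (@le_trans _ _ (normc h ^+ 2 * X)); last first.
  rewrite expr2 -mulrA mulrC ler_wpM2r ?normc_ge0//; apply: le_trans (ltW he).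
  by rewrite ler_wpM2l ?normc_ge0// lerDl.
(* The derivative of [n + 1] terms has [n] terms; with these matching truncations the difference is
   a sum of remainders of single powers. *)
pose u n := cpoly a (w + h) n.+1 - cpoly a w n.+1 - cpoly (dcoef a) w n * h.
have shift v l : cseq v l -> cseq (fun n => v n.+1) l.
  by move=> hv d d0; have [N HN] := hv d d0; exists N => n Nn; apply: HN; rewrite leqW.
apply: (@cseq_normc_le u).
  have c1 := shift _ _ (cseq_cpseries (w + h) ha).
  have c2 := cseqZ (- 1) (shift _ _ (cseq_cpseries w ha)).
  have c3 := cseqZ (- h) (cseq_cpseries w hd).
  have := cseqD (cseqD c1 c2) c3; rewrite !mulN1r mulNr mulrC.
  congr cseq; apply/funext => n; rewrite /u; ring.
move=> n; rewrite /u.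
have -> : cpoly a (w + h) n.+1 - cpoly a w n.+1 - cpoly (dcoef a) w n * h =
  \sum_(k < n.+1) (a k)%:C * ((w + h) ^+ k - w ^+ k - k%:R * w ^+ k.-1 * h).
  rewrite /cpoly -sumrB.
  have -> : (\sum_(k < n) (dcoef a k)%:C * w ^+ k) * h =
     \sum_(k < n.+1) (a k)%:C * (k%:R * w ^+ k.-1 * h).
    rewrite big_ord_recl !mul0r mulr0 add0r mulr_suml; apply: eq_bigr => k _.
    by rewrite lift0 /dcoef rmorphM rmorph_nat /=; ring.
  by rewrite -sumrB; apply: eq_bigr => k _; ring.
apply: (@le_trans _ _ (\sum_(k < n.+1) normc h ^+ 2 * (`|a k| * (4 * rho) ^+ k))); last first.
  by rewrite -mulr_sumr ler_wpM2l ?exprn_ge0 ?normc_ge0.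
elim: n.+1 => [|k IH]; first by rewrite !big_ord0 normc0.
rewrite !big_ord_recr /=; apply: (le_trans (normcD _ _)); rewrite lerD//.
rewrite normcM normc_real mulrCA ler_wpM2l//.
apply: (le_trans (cpow_taylor w k (ltW h1))); rewrite ler_wpM2l ?exprn_ge0 ?normc_ge0//.
rewrite exprMn ler_wpM2r ?exprn_ge0//.
rewrite (_ : 4 = 2 * 2 :> R); last by ring.
by rewrite exprMn expr2; apply: ler_pM => //; exact: natr_le_pow2.
Qed.

End ComplexPowerSeries.

(** * Cosine sums over equispaced nodes *)

Section TrigMoments.
Variables (R : realType) (N : nat).
Hypothesis N0 : (0 < N)%N.

Definition node (j : nat) : R := j%:R * (2 * pi / N%:R).

Definition trig_moment (m q : nat) : R :=
  \sum_(j < N) cos (q%:R * node j) * cos (node j) ^+ m.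

Lemma sin_2pin (x : R) k : sin (x + 2 * pi * k%:R) = sin x.
Proof.
have -> : x + 2 * pi * k%:R = x + (pi *+ 2) *+ k by rewrite mulr_natr mulr_natl.
exact: (periodicn (@sinD2pi R)).
Qed.

(** After multiplication by [2 sin (al / 2)] the sum telescopes, as for the Dirichlet kernel, and
    the two ends agree by periodicity. *)
Lemma trig_moment0 q : (0 < q < N)%N -> trig_moment 0 q = 0.
Proof.
move=> /andP[q0 qN]; pose al : R := q%:R * (2 * pi / N%:R).
have NR : (N%:R : R) != 0 by rewrite pnatr_eq0 -lt0n.
have pi0 := pi_gt0 R.
have s0 : sin (al / 2) != 0.
  rewrite gt_eqF// sin_gt0_pi//.
  have -> : al / 2 = q%:R / N%:R * pi by rewrite /al; field.
  rewrite mulr_gt0 ?divr_gt0 ?ltr0n//= gtr_pMl// ltr_pdivrMr ?ltr0n//.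
  by rewrite mul1r ltr_nat.
apply: (mulfI s0); rewrite mulr0; apply: (mulfI (x := 2)); first by rewrite pnatr_eq0.
pose f (j : nat) : R := sin (j%:R * al - al / 2).
transitivity (\sum_(0 <= j < N) (f j.+1 - f j)).
  rewrite mulrA /trig_moment mulr_sumr big_mkord; apply: eq_bigr => j _.
  rewrite expr0 mulr1 /f -(@natr1 _ j).
  have -> : (j%:R + 1) * al - al / 2 = j%:R * al + al / 2 by field.
  have -> : q%:R * node j = j%:R * al by rewrite /node /al; ring.
  by rewrite sinD sinB; ring.
rewrite telescope_sumr// mulr0 /f mul0r sub0r.
have -> : N%:R * al - al / 2 = - (al / 2) + 2 * pi * q%:R by rewrite /al; field.
by rewrite sin_2pin subrr.
Qed.

Lemma trig_momentS m q : trig_moment m.+1 q.+1 =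
  (trig_moment m q.+2 + trig_moment m q) / 2.
Proof.
rewrite /trig_moment -big_split /= mulr_suml; apply: eq_bigr => j _.
set t := node j.
have -> : q.+2%:R * t = q.+1%:R * t + t by rewrite -(@natr1 _ q.+1); ring.
have -> : q%:R * t = q.+1%:R * t - t by rewrite -(@natr1 _ q); ring.
by rewrite cosD cosB exprS; field.
Qed.

(** The frequencies of [cos^m] are at most [m], hence orthogonal to frequency [q]; the condition
    [q + m < N] excludes aliasing on the grid. *)
Lemma trig_moment_eq0 m q : (m < q)%N -> (q + m < N)%N -> trig_moment m q = 0.
Proof.
elim: m q => [|m IH] [|q] // mq qmN.
  by apply: trig_moment0; rewrite /= -(addn0 q.+1).
by rewrite trig_momentS !IH ?addr0 ?mul0r//; lia.
Qed.

Lemma trig_moment_diag m : (m.*2 < N)%N -> trig_moment m m = N%:R / 2 ^+ m.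
Proof.
elim: m => [_|m IH hm].
  rewrite /trig_moment (eq_bigr (fun=> 1)).
    by rewrite sumr_const card_ord expr0 divr1.
  by move=> j _; rewrite mul0r cos0 expr0 mulr1.
rewrite trig_momentS IH; last by lia.
rewrite trig_moment_eq0 ?add0r; try lia.
by rewrite exprSr invfM mulrA.
Qed.

Lemma norm_cos_le1 (x : R) : `|cos x| <= 1.
Proof. by rewrite ler_norml cos_geN1 cos_le1. Qed.

Lemma norm_sum_le (c : 'I_N -> R) : (forall j, `|c j| <= 1) -> `|\sum_j c j| <= N%:R.
Proof.
move=> hc; apply: (le_trans (ler_norm_sum _ _ _)).
apply: (@le_trans _ _ (\sum_(j < N) 1)); first exact: ler_sum.
by rewrite sumr_const card_ord.
Qed.

Lemma norm_trig_moment m q : `|trig_moment m q| <= N%:R.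
Proof.
apply: norm_sum_le => j; rewrite normrM normrX -[leRHS]mulr1.
by apply: ler_pM; rewrite ?exprn_ge0 ?exprn_ile1 ?norm_cos_le1.
Qed.

End TrigMoments.

(** * A discrete Bessel function *)

Section BesselLike.
Variables (R : realType) (p : nat).
Hypothesis p0 : (0 < p)%N.
Let n := p.*2.
(** Frequency [n] is tested against powers up to [n], so any [N] above [2 n] avoids aliasing. *)
Let N := (4 * n)%N.
Let n0 : (0 < n)%N. Proof. by rewrite /n double_gt0. Qed.
Let N0 : (0 < N)%N. Proof. by rewrite muln_gt0. Qed.
Let NR : (0 : R) < N%:R. Proof. by rewrite ltr0n. Qed.

Let B m : R := trig_moment R N m n / N%:R.

Let B_eq0 m : (m < n)%N -> B m = 0.
Proof.
move=> mn; have h : (n + m < N)%N by have := n0; rewrite /N; lia.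
by rewrite /B (trig_moment_eq0 R N0 mn h) mul0r.
Qed.

Let B_diag : B n = (2 ^+ n)^-1.
Proof.
have h : (n.*2 < N)%N by have := n0; rewrite /N; lia.
rewrite /B (trig_moment_diag R N0 h); field.
by rewrite gt_eqF ?exprn_gt0//= gt_eqF.
Qed.

Let B_le1 m : `|B m| <= 1.
Proof.
rewrite /B normrM normfV (ger0_norm (ltW NR)) ler_pdivrMr// mul1r.
exact: norm_trig_moment.
Qed.

(** Makes the value at 0 equal to 1: the first surviving moment is [2^-n], and it is divided by
    [n!]. *)
Definition bessel_cst : R := n`!%:R * 2 ^+ n.

Lemma bessel_cst_gt0 : 0 < bessel_cst.
Proof. by rewrite mulr_gt0 ?exprn_gt0 ?ltr0n ?fact_gt0. Qed.

(* Coefficients in w = t^2 of the discrete Bessel function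
   n! 2^n t^-n (-1)^p avg_j cos (n th_j) cos (t cos th_j), with n = 2 p and the
   4 n equispaced nodes th_j; the average of cos (n th_j) cos^m th_j vanishes
   for m < n, so this is entire in w. *)
Definition bessel_coef k : R :=
  bessel_cst * ((-1) ^+ k * (trig_moment R (4 * p.*2) (k.*2 + p.*2) p.*2 / (4 * p.*2)%:R)
    / (k.*2 + p.*2)`!%:R).

Lemma bessel_coef0 : bessel_coef 0 = 1.
Proof.
rewrite /bessel_coef double0 add0n -/n -/N -/(B n) B_diag /bessel_cst expr0 mul1r.
by field; rewrite ?expf_neq0 ?pnatr_eq0 -?lt0n ?fact_gt0.
Qed.

Lemma norm_bessel_coef k : `|bessel_coef k| <= bessel_cst / k.*2`!%:R.
Proof.
rewrite /bessel_coef -/n -/N -/(B _) normrM (ger0_norm (ltW bessel_cst_gt0)).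
rewrite ler_pM2l ?bessel_cst_gt0// normrM [X in X * _ <= _]normrM normrX normrN1 expr1n mul1r normfV.
rewrite (ger0_norm (ler0n _ _)) -[leRHS]mul1r; apply: ler_pM; rewrite ?invr_ge0//.
rewrite lef_pV2 ?posrE ?ltr0n ?fact_gt0// ler_nat.
by apply: leq_fact; rewrite leq_addr.
Qed.

Lemma exp_even_partial (s : R) k : 0 <= s ->
  \sum_(j < k) s ^+ j.*2 / j.*2`!%:R <= expR s.
Proof.
move=> s0; apply: (@le_trans _ _ (series (exp_coeff s) k.*2)).
  elim: k => [|k IH]; first by rewrite big_ord0 /series /= big_nil.
  rewrite big_ord_recr doubleS /= 2!seriesSr /= -addrA lerD//.
  by rewrite lerDl divr_ge0// exprn_ge0.
apply: nondecreasing_cvgn_le; last exact: is_cvg_series_exp_coeff.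
by apply: nondecreasing_series => j _ _; rewrite divr_ge0// exprn_ge0.
Qed.

Lemma bessel_partial (r : R) k : 0 <= r ->
  \sum_(j < k) `|bessel_coef j| * r ^+ j <= bessel_cst * expR (Num.sqrt r).
Proof.
move=> r0; apply: le_trans (ler_wpM2l (ltW bessel_cst_gt0) (exp_even_partial k (sqrtr_ge0 r))).
rewrite mulr_sumr; apply: ler_sum => j _.
rewrite -mul2n exprM sqr_sqrtr// mul2n [s in _ <= _ * s]mulrC mulrA ler_wpM2r ?exprn_ge0//.
exact: norm_bessel_coef.
Qed.

Lemma absbnd_bessel : absbnd bessel_coef.
Proof. by move=> r r0; eexists => k; exact: bessel_partial. Qed.

Definition bessel_fun : R[i] -> R[i] := cpseries bessel_coef.

Lemma entire1_bessel : entire1 bessel_fun.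
Proof. exact: entire1_cpseries absbnd_bessel. Qed.

(** In the variable [t] with [w = t^2] this is exponential type 1. *)
Lemma normc_bessel w : normc (bessel_fun w) <= bessel_cst * expR (Num.sqrt (normc w)).
Proof.
apply: normc_cpseries_le; first exact: absbnd_bessel.
by move=> k; apply: bessel_partial; exact: normc_ge0.
Qed.

Lemma bessel_fun0 : bessel_fun 0 = 1.
Proof.
apply: (@cpseries_real _ _ 0 1 absbnd_bessel).
apply: (@cvg_near_cst _ _ _ _ _ _ ) => //.
exists 1%N => // k /= k1; rewrite (bigD1 (Ordinal k1)) //= bessel_coef0 expr0 mulr1.
by rewrite big1 ?addr0// => j j0; rewrite expr0n (negbTE (_ : nat_of_ord j != 0%N)) ?mulr0.
Qed.

Let S (t : R) : R := (\sum_(j < N) cos (n%:R * node R N j) * cos (t * cos (node R N j))) / N%:R.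

Let S_le1 t : `|S t| <= 1.
Proof.
rewrite /S normrM normfV (ger0_norm (ltW NR)) ler_pdivrMr// mul1r.
apply: norm_sum_le => j; rewrite normrM -[leRHS]mulr1.
by apply: ler_pM; rewrite ?norm_cos_le1.
Qed.

Let cvg_sum_seq (u : nat -> nat -> R) (l : nat -> R) K :
  (forall j, u j @ \oo --> l j) ->
  (fun k => \sum_(j < K) u j k) @ \oo --> \sum_(j < K) l j.
Proof.
move=> hu; elim: K => [|K IH].
  by rewrite big_ord0; under eq_fun do rewrite big_ord0; exact: cvg_cst.
rewrite big_ord_recr; under eq_fun do rewrite big_ord_recr; exact: cvgD.
Qed.

Let S_series t : (fun k => \sum_(j < k) (-1) ^+ j * B j.*2 * t ^+ j.*2 / j.*2`!%:R) @ \oo --> S t.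
Proof.
have -> : (fun k => \sum_(j < k) (-1) ^+ j * B j.*2 * t ^+ j.*2 / j.*2`!%:R) =
  (fun k => (\sum_(i < N) cos (n%:R * node R N i) *
     series (cos_coeff' (t * cos (node R N i))) k) / N%:R).
  apply/funext => k.
  under [X in _ = X / _]eq_bigr do rewrite /series /= big_mkord mulr_sumr.
  rewrite exchange_big /= mulr_suml; apply: eq_bigr => j _.
  rewrite /B /trig_moment !mulr_suml mulr_sumr !mulr_suml; apply: eq_bigr => i _.
  by rewrite /cos_coeff' exprMn -exprnP; ring.
apply: (@cvgM _ _ _ _ _ (cst N%:R^-1)); last exact: cvg_cst.
apply: (@cvg_sum_seq (fun i k => cos (n%:R * node R N i) * series (cos_coeff' (t * cos (node R N i))) k)
  (fun i => cos (n%:R * node R N i) * cos (t * cos (node R N i)))) => i.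
apply: (@cvgM _ _ _ _ (cst (cos (n%:R * node R N i)))); first exact: cvg_cst.
exact: cvg_cos_coeff'.
Qed.

(** For [t != 0] the value is [bessel_cst * (-1)^p * S t / t^n], and the decay is just [|S| <= 1],
    an average of products of cosines. The first [p] terms of the series of [S] vanish, which gives
    the shift of the index by [p] and the sign. *)
Lemma bessel_real (t : R) : exists2 g : R, bessel_fun (t ^+ 2)%:C = g%:C &
  `|g| * `|t| ^+ n <= bessel_cst.
Proof.
have [->|t0] := eqVneq t 0.
  exists 1; first by rewrite expr0n /= bessel_fun0.
  by rewrite normr0 expr0n (negbTE (_ : n != 0%N)) -?lt0n// mulr0 ltW ?bessel_cst_gt0.
pose g := bessel_cst * (-1) ^+ p / t ^+ n * S t.
exists g; last first.
  rewrite -normrX -normrM.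
  have -> : g * t ^+ n = bessel_cst * ((-1) ^+ p * S t).
    by rewrite /g; field; rewrite expf_neq0.
  rewrite normrM (ger0_norm (ltW bessel_cst_gt0)) [X in _ * X]normrM normrX normrN1.
  by rewrite expr1n mul1r ler_piMr// ltW ?bessel_cst_gt0.
apply: cpseries_real; first exact: absbnd_bessel.
have h1 := @S_series t; rewrite -(cvg_shiftn p) in h1.
have h2 := @cvgM _ _ _ _ (cst (bessel_cst * (-1) ^+ p / t ^+ n)) _ _ _ (cvg_cst _) h1.
rewrite -/g in h2.
rewrite (_ : (fun k => \sum_(j < k) bessel_coef j * (t ^+ 2) ^+ j) =
  (cst (bessel_cst * (-1) ^+ p / t ^+ n) \* (fun k => \sum_(j < k + p) (-1) ^+ j * B j.*2 * t ^+ j.*2 / j.*2`!%:R))); first exact: h2.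
apply/funext => k /=.
rewrite -(big_mkord xpredT (fun j => (-1) ^+ j * B j.*2 * t ^+ j.*2 / j.*2`!%:R)).
rewrite (@big_cat_nat _ _ _ p)//= ?leq_addl//.
have -> : \sum_(0 <= j < p) (-1) ^+ j * B j.*2 * t ^+ j.*2 / j.*2`!%:R = 0.
  rewrite big_mkord big1// => j _.
  by rewrite B_eq0 ?mulr0 ?mul0r// /n ltn_double.
rewrite add0r -[p in \sum_(p <= _ < _) _]add0n big_addn addnK big_mkord mulr_sumr.
apply: eq_bigr => j _; rewrite /bessel_coef -/n -/N -/(B _) doubleD -/n.
rewrite exprD -exprM mul2n exprD.
have e1 : ((-1) ^+ p * (-1) ^+ p : R) = 1 by rewrite -exprMn mulrNN mulr1 expr1n.
have tn : t ^+ n != 0 by rewrite expf_neq0.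
transitivity (bessel_cst * ((-1) ^+ p * (-1) ^+ p) * (-1) ^+ j * B (j.*2 + n) * t ^+ j.*2 / (j.*2 + n)`!%:R).
  by rewrite e1; ring.
by field; rewrite tn pnatr_eq0 -lt0n fact_gt0.
Qed.

End BesselLike.

(** * The uniform bound on the real line *)

Section BesselSup.
Variable R : realType.

(** Stirling up to a polynomial factor; the induction step is [1 - 1 / y <= exp (- 1 / y)] raised to
    the power [y]. *)
Lemma fact_le (n : nat) : (0 < n)%N ->
  n`!%:R <= expR 1 * n%:R * (n%:R * expR (- 1)) ^+ n :> R.
Proof.
elim: n => // -[_ _|n IH _].
  by rewrite mulr1 expr1 mul1r expRxMexpNx_1.
have {}IH := IH isT; set x : R := n.+1%:R in IH *.
have x0 : 0 < x by rewrite ltr0n.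
set y : R := n.+2%:R; have y0 : 0 < y by rewrite ltr0n.
have yx : y = x + 1 by rewrite /y -natr1.
rewrite factS natrM -/y.
apply: (@le_trans _ _ (y * (expR 1 * x * (x * expR (- 1)) ^+ n.+1))).
  by rewrite ler_wpM2l// ltW.
have -> : y * (expR 1 * x * (x * expR (- 1)) ^+ n.+1) =
  expR 1 * y * (x ^+ n.+2 * expR (- 1) ^+ n.+1) by rewrite exprMn (exprS x n.+1); ring.
rewrite ler_wpM2l ?mulr_ge0 ?expR_ge0 ?(ltW y0)//.
have -> : (y * expR (- 1)) ^+ n.+2 = y ^+ n.+2 * expR (- 1) * expR (- 1) ^+ n.+1.
  by rewrite exprMn (exprSr (expR (- 1)) n.+1); ring.
rewrite ler_wpM2r ?exprn_ge0 ?expR_ge0//.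
rewrite [X in _ * X](_ : expR (- 1) = expR (- y^-1) ^+ n.+2); last first.
  by rewrite -expRM_natl mulrN mulfV// gt_eqF.
rewrite -exprMn lerXn2r ?nnegrE ?mulr_ge0 ?expR_ge0 ?(ltW x0) ?(ltW y0)//.
rewrite [leRHS]mulrC -ler_pdivrMr//; apply: le_trans (expR_ge1Dx _).
have -> : x / y = 1 + - y^-1; last by [].
apply: (mulIf (lt0r_neq0 y0)); rewrite divfK ?lt0r_neq0// mulrDl mulNr mulVf ?lt0r_neq0//.
by rewrite mul1r yx addrK.
Qed.

(** The right side decreases from 1 to its value [2 / e] at [c = 1]. Through [exp (1 - c) >= 2 - c]
    the claim becomes [(1 + c) (2 - c) >= 2]. *)
Lemma half_e_bound (c : R) : 0 <= c -> c <= 1 -> 2 * expR (- 1) <= expR (- c) * (1 + c).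
Proof.
move=> c0 c1.
have -> : expR (- 1) = expR (- c) * expR (- (1 - c)) :> R by rewrite -expRD; congr expR; ring.
rewrite mulrCA ler_wpM2l ?expR_ge0//.
have h : expR (- (1 - c)) <= (1 + (1 - c))^-1.
  rewrite expRN lef_pV2 ?posrE ?expR_gt0 ?expR_ge1Dx//; lra.
apply: (@le_trans _ _ (2 * (1 + (1 - c))^-1)); first by rewrite ler_wpM2l.
by rewrite ler_pdivrMr; [nra|lra].
Qed.

(** For [|t| > n] the decay suffices. Otherwise [t = n sin x] and [slit_bound] applies with type
    [n]: the scale [n] is the one minimising [exp (a) / a^n]. The weight is at least [(2 / e)^n],
    which leaves [n! (e / n)^n]. *)
Lemma bessel_sup (p : nat) (t : R) : (0 < p)%N ->
  normc (bessel_fun p (t ^+ 2)%:C) <= expR 1 * p.*2%:R.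
Proof.
move=> p0; set n := p.*2; have n0 : (0 < n)%N by rewrite double_gt0.
have nR : 0 < n%:R :> R by rewrite ltr0n.
have c0 := bessel_cst_gt0 R p.
have hK : bessel_cst R p / n%:R ^+ n * (2^-1 * expR 1) ^+ n <= expR 1 * n%:R.
  have -> : bessel_cst R p / n%:R ^+ n * (2^-1 * expR 1) ^+ n = n`!%:R * (expR 1 / n%:R) ^+ n.
    by rewrite /bessel_cst -/n !exprMn !exprVn; field; rewrite !expf_neq0 ?gt_eqF.
  apply: (le_trans (ler_wpM2r _ (fact_le n0))); first by rewrite exprn_ge0// divr_ge0 ?expR_ge0.
  rewrite -[leLHS]mulrA -exprMn (_ : n%:R * expR (- 1) * (expR 1 / n%:R) = 1) ?expr1n ?mulr1//.
  rewrite expRN; field; by rewrite !gt_eqF// expR_gt0.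
have [tn|nt] := leP `|t| n%:R; last first.
  have [g -> hg] := bessel_real p0 t.
  rewrite normc_real; apply: le_trans hK; apply: (@le_trans _ _ (bessel_cst R p / n%:R ^+ n)).
    rewrite ler_pdivlMr ?exprn_gt0//; apply: le_trans hg; rewrite ler_wpM2l//.
    by rewrite lerXn2r ?nnegrE// ltW.
  rewrite ler_peMr ?divr_ge0 ?exprn_ge0 ?(ltW c0)// exprn_ege1//.
  by have := expR_ge1Dx (1 : R); lra.
pose s := t / n%:R.
have s1 : -1 <= s <= 1.
  by rewrite -ler_norml /s normrM normfV (ger0_norm (ltW nR)) ler_pdivrMr ?mul1r.
pose g (z : R[i]) := bessel_fun p (((n%:R : R)%:C * z) ^+ 2).
have hg : entire1 g.
  apply: (entire1_comp (entire1_bessel (R := R) p0)); apply: entire1X; apply: entire1M.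
    exact: entire1_cst.
  exact: entire1_id.
have gC z : normc (g z) <= bessel_cst R p * expR (n%:R * normc z).
  apply: (le_trans (normc_bessel p0 _)).
  by rewrite normcX normcM sqrtr_sqr normc_real !ger0_norm ?mulr_ge0 ?normc_ge0.
have gM (u : R) : 1 <= `|u| -> normc (g u%:C) * `|u| ^+ n <= bessel_cst R p / n%:R ^+ n.
  move=> _; have [v vE hv] := bessel_real p0 (n%:R * u).
  rewrite /g -rmorphM -rmorphXn vE normc_real ler_pdivlMr ?exprn_gt0// -mulrA -exprMn.
  by move: hv; rewrite normrM (ger0_norm (ltW nR)) mulrC (mulrC n%:R) mulrC.
have hx : - (pi / 2) <= asin s <= pi / 2 by rewrite asin_geNpi2// asin_lepi2.
have := slit_bound hg (ltW nR) gC gM hx.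
rewrite asinK; last by rewrite in_itv.
rewrite cos_asin; last exact: s1.
have -> : g s%:C = bessel_fun p (t ^+ 2)%:C.
  rewrite /g -rmorphM -rmorphXn; congr (bessel_fun p (_ ^+ 2)%:C).
  by rewrite /s mulrCA mulfV ?mulr1// gt_eqF.
set c := Num.sqrt _; set G := normc _ => H.
have c00 : 0 <= c by exact: sqrtr_ge0.
have c11 : c <= 1 by rewrite /c -[leRHS]sqrtr1 ler_wsqrtr// gerBl sqr_ge0.
have low : (2 * expR (- 1)) ^+ n <= expR (- (n%:R * c)) * (1 + c) ^+ n.
  rewrite -mulrN expRM_natl -exprMn lerXn2r ?nnegrE ?mulr_ge0 ?expR_ge0 ?addr_ge0//.
  exact: half_e_bound.
have e20 : 0 < (2 * expR (- 1) : R) ^+ n by rewrite exprn_gt0// mulr_gt0 ?expR_gt0.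
apply: le_trans hK.
have -> : (2^-1 * expR 1) ^+ n = ((2 * expR (- 1)) ^+ n)^-1 :> R.
  by rewrite -exprVn invfM expRN invrK.
rewrite ler_pdivlMr//; apply: le_trans H; rewrite ler_wpM2l ?normc_ge0//.
Qed.

End BesselSup.

(** * The radial test function on R^d *)

Section TestFunction.
Variables (R : realType) (d p : nat).
Hypothesis p0 : (0 < p)%N.
Let n := p.*2.
Let K : R := expR 1 * n%:R.
(** The radius at which the decay bound [K (4 n / (e |x|))^n] meets the uniform bound [K]. *)
Let r : R := 4 * n%:R * expR (- 1).

Let n0 : (0 < n)%N. Proof. by rewrite double_gt0. Qed.
Let nR : 0 < n%:R :> R. Proof. by rewrite ltr0n. Qed.
Let K0 : 0 < K. Proof. by rewrite mulr_gt0 ?expR_gt0. Qed.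
Let r0 : 0 < r. Proof. by rewrite !mulr_gt0 ?expR_gt0. Qed.

Definition cquad (z : 'rV[R[i]]_d) : R[i] := (4^-1)%:C * \sum_i z ord0 i ^+ 2.

(** With [t = |x| / 2] each factor has type [1 / 2] in [x]. Squaring restores type 1, doubles the
    decay exponent and makes the function non-negative on R^d. *)
Definition test_ext (z : 'rV[R[i]]_d) : R[i] := bessel_fun p (cquad z) ^+ 2.

Definition test_fun (x : Rtuple R d) : R[i] := test_ext (real_to_complex_vec x).

Lemma entire_test_ext : entire test_ext.
Proof.
have hc : entire1 (fun w : R[i] => bessel_fun p w ^+ 2) by apply: entire1X; exact: (entire1_bessel p0).
move=> z.
have hq : differentiable (cquad : _ -> R[i]^o) z.
  apply: differentiableM; first exact: differentiable_cst.
  rewrite (_ : (fun z : 'rV[R[i]]_d => _) = \sum_(i < d) (fun z : 'rV[R[i]]_d => (z ord0 i ^+ 2 : R[i]^o))).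
    apply: differentiable_sum => i.
    have hi : differentiable (fun z : 'rV[R[i]]_d => z ord0 i : R[i]^o) z by exact: differentiable_coord.
    exact: (differentiableM hi hi).
  by apply/funext => w; rewrite fct_sumE.
exact: (differentiable_comp hq (hc (cquad z))).
Qed.

Lemma normc_cquad z : normc (cquad z) <= (euclidean_norm z / 2) ^+ 2.
Proof.
rewrite /cquad normcM normc_real ger0_norm// expr_div_n mulrC [4^-1](_ : _ = (2 ^+ 2)^-1); last first.
  by congr (_^-1); ring.
rewrite ler_wpM2r// /euclidean_norm sqr_sqrtr ?sumr_ge0// => [|i _]; last exact: sqr_ge0.
elim/big_ind2 : _ => //; first by rewrite normc0.
  by move=> a b c e h1 h2; apply: (le_trans (normcD _ _)); rewrite lerD.
by move=> i _; rewrite normcX.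
Qed.

Lemma test_ext_type : spherical_exp_type_le1 test_ext.
Proof.
move=> e e0; exists (bessel_cst R p ^+ 2) => z.
have s0 : 0 <= euclidean_norm z by exact: sqrtr_ge0.
have c0 := ltW (bessel_cst_gt0 R p).
apply: (@le_trans _ _ ((bessel_cst R p * expR (euclidean_norm z / 2)) ^+ 2)).
  rewrite normcX lerXn2r ?nnegrE ?normc_ge0 ?mulr_ge0 ?expR_ge0//.
  apply: (le_trans (normc_bessel p0 _)); rewrite ler_wpM2l// ler_expR.
  rewrite -(ger0_norm (_ : 0 <= euclidean_norm z / 2)) ?divr_ge0// -sqrtr_sqr ler_wsqrtr//.
  exact: normc_cquad.
rewrite exprMn ler_wpM2l ?exprn_ge0// -expRM_natl ler_expR.
by rewrite mulrCA divff// mulr1 ler_peMl// lerDl ltW.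
Qed.

Lemma test_fun_real x : exists g : R, [/\ test_fun x = (g ^+ 2)%:C, `|g| <= K &
   g ^+ 2 * nsq x ^+ n <= K ^+ 2 * (r ^+ 2) ^+ n].
Proof.
pose t := Num.sqrt (nsq x) / 2.
have tE : t ^+ 2 = nsq x / 4.
  by rewrite /t expr_div_n sqr_sqrtr ?nsq_ge0//; congr (_ / _); ring.
have qE : cquad (real_to_complex_vec x) = (t ^+ 2)%:C.
  rewrite tE /cquad mulrC rmorphM /nsq rmorph_sum; congr (_ * _).
  by apply: eq_bigr => i _; rewrite !mxE rmorphXn.
have [g gE hg] := bessel_real p0 t.
exists g; split.
- by rewrite /test_fun /test_ext qE gE rmorphXn.
- by rewrite -normc_real -gE; exact: bessel_sup.
have c0 := bessel_cst_gt0 R p.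
have h1 : g ^+ 2 * (nsq x / 4) ^+ n <= bessel_cst R p ^+ 2.
  rewrite -tE -exprM mulnC exprM -exprMn -(real_normK (num_real (g * t ^+ n))).
  by rewrite lerXn2r ?nnegrE ?(ltW c0)// normrM normrX.
have h2 : bessel_cst R p <= K * (2 * (n%:R * expR (- 1))) ^+ n.
  rewrite /bessel_cst exprMn mulrCA mulrC ler_wpM2l ?exprn_ge0//; exact: fact_le.
have h3 : bessel_cst R p ^+ 2 <= (K * (2 * (n%:R * expR (- 1))) ^+ n) ^+ 2.
  by rewrite lerXn2r ?nnegrE ?(ltW c0)// ?mulr_ge0 ?(ltW K0) ?exprn_ge0 ?mulr_ge0 ?expR_ge0.
have H := le_trans h1 h3.
have e1 : g ^+ 2 * nsq x ^+ n = 4 ^+ n * (g ^+ 2 * (nsq x / 4) ^+ n).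
  by rewrite expr_div_n; field; rewrite expf_neq0.
have e2 : K ^+ 2 * (r ^+ 2) ^+ n = 4 ^+ n * (K * (2 * (n%:R * expR (- 1))) ^+ n) ^+ 2.
  rewrite (_ : r ^+ 2 = 4 * (2 * (n%:R * expR (- 1))) ^+ 2); last by rewrite /r; ring.
  move: K => k; rewrite [(4 * _) ^+ n]exprMn [(k * _) ^+ 2]exprMn -!exprM [(n * 2)%N]mulnC; ring.
by rewrite e1 e2 ler_wpM2l// exprn_ge0.
Qed.

Lemma test_fun0 : test_fun [tuple of nseq d (0 : measurableTypeR R)] = 1.
Proof.
rewrite /test_fun /test_ext /cquad big1 ?mulr0 ?(bessel_fun0 R p0) ?expr1n//.
by move=> i _; rewrite mxE tnth_nseq expr0n.
Qed.

End TestFunction.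

(** * Integrals of functions with power decay *)

Section Decay.
Variable R : realType.

(* min(1, u^-n) is dominated by a sum of Gaussian profiles, one for each level
   e^((k-1)/n) < u <= e^(k/n). *)
Lemma exp_sandwich (n : nat) (u : R) : (0 < n)%N ->
  exists2 k : nat, u <= expR (k%:R / n%:R) & (0 < k)%N -> expR (k.-1%:R / n%:R) < u.
Proof.
move=> n0; have nR : 0 < n%:R :> R by rewrite ltr0n.
have ex : exists k : nat, u <= expR (k%:R / n%:R).
  exists (Num.trunc (u * n%:R)).+1; apply: le_trans (expR_ge1Dx _).
  apply: (@le_trans _ _ ((Num.trunc (u * n%:R)).+1%:R / n%:R)); last by rewrite lerDr.
  by rewrite ler_pdivlMr// ltW// truncnS_gt.
case: (ex_minnP ex) => k hk kmin; exists k => // k0.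
by rewrite ltNge; apply/negP => /kmin; rewrite leqNgt prednK ?leqnn.
Qed.

(** On level [k] the power bound gives [v <= M exp (1 - k)], where the 1 accounts for the lower end
    [(k - 1) / n] of the level. The last factor is at least 1 there, and it turns into a Gaussian
    when [u] is a multiple of [|x|^2]. *)
Lemma decay_le_gauss (n : nat) (u v M : R) : (0 < n)%N -> 0 <= u -> 0 <= M -> v <= M ->
  v * u ^+ n <= M ->
  exists k : nat, v <= M * expR (1 - k%:R) * expR (n%:R * (1 - u * expR (- (k%:R / n%:R)))).
Proof.
move=> n0 u0 M0 vM vu; have nR : 0 < n%:R :> R by rewrite ltr0n.
have [k uk ku] := exp_sandwich u n0; exists k.
apply: (@le_trans _ _ (M * expR (1 - k%:R))); last first.
  rewrite ler_peMr ?mulr_ge0 ?expR_ge0// -[leLHS]expR0 ler_expR mulr_ge0 ?(ltW nR)//.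
  by rewrite subr_ge0 expRN ler_pdivrMr ?expR_gt0// mul1r.
case: k {uk} ku => [_|k /(_ isT) /= ku].
  apply: (le_trans vM); rewrite subr0 ler_peMr//.
  by apply: le_trans (expR_ge1Dx _); rewrite lerDl.
have -> : 1 - k.+1%:R = - k%:R :> R by rewrite -natr1; ring.
rewrite expRN ler_pdivlMr ?expR_gt0//.
have [v0|v0] := leP v 0; first by apply: le_trans M0; rewrite mulr_le0_ge0// expR_ge0.
apply: le_trans vu; rewrite ler_wpM2l ?(ltW v0)//.
rewrite (_ : k%:R = n%:R * (k%:R / n%:R)); last by rewrite mulrCA divff ?mulr1// gt_eqF.
by rewrite expRM_natl lerXn2r ?nnegrE ?expR_ge0 ?(ltW ku)//.
Qed.

(** The hypothesis gives [1 - q >= 1 / (n + 1)], so the bound is that of the full geometric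
    series. *)
Lemma geometric_sum_le (n N : nat) (q : R) : (0 < n)%N -> 0 <= q -> q <= expR (- n%:R^-1) ->
  \sum_(k < N) q ^+ k <= n%:R + 1.
Proof.
move=> n0 q0 qn; have nR : 0 < n%:R :> R by rewrite ltr0n.
have q1 : (n%:R + 1)^-1 <= 1 - q.
  have : expR (- n%:R^-1) <= (1 + n%:R^-1)^-1 :> R.
    rewrite expRN lef_pV2 ?posrE ?expR_gt0 ?expR_ge1Dx// addr_gt0// invr_gt0//.
  have -> : (1 + n%:R^-1)^-1 = 1 - (n%:R + 1)^-1 :> R.
    by field; rewrite !gt_eqF// addr_gt0.
  move/(le_trans qn); lra.
have p1 : 0 < 1 - q by apply: lt_le_trans q1; rewrite invr_gt0 addr_gt0.
apply: (@le_trans _ _ (1 - q)^-1); last first.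
  by rewrite -[leRHS]invrK lef_pV2 ?posrE// invr_gt0 addr_gt0.
rewrite -[(1 - q)^-1]mul1r ler_pdivlMr//.
have := subrX1 q N; have := exprn_ge0 N q0; set s := \sum_(_ < _) _; set w := q ^+ N.
by move: s w => s w; clear -R; nra.
Qed.

(** Level [k] contributes a Gaussian whose integral grows like [exp (k d / (2 n))] against the
    weight [exp (- k)]; the series converges because [d < 2 n]. As [d + 1 <= 2 n], its ratio is at
    most [exp (- 1 / (2 n))], whence the factor [2 n + 1]. *)
Lemma integral_decay (d n : nat) (M r : R) (f : Rtuple R d -> R) :
  measurable_fun setT f -> (forall x, 0 <= f x) -> (0 < n)%N -> (d < n.*2)%N -> 0 <= M -> 0 < r ->
  (forall x, f x <= M) -> (forall x, f x * nsq x ^+ n <= M * (r ^+ 2) ^+ n) ->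
  (\int[lebesgueRn R d]_x (f x)%:E <=
   (M * expR (n%:R + 1) * Num.sqrt (pi * r ^+ 2 / n%:R) ^+ d * (n.*2%:R + 1))%R%:E)%E.
Proof.
move=> mf f0 n0 dn M0 r0 fM fr; set m := lebesgueRn R d.
have nR : 0 < n%:R :> R by rewrite ltr0n.
have r20 : 0 < r ^+ 2 by rewrite exprn_gt0.
pose lam (k : nat) := n%:R * expR (- (k%:R / n%:R)) / r ^+ 2 : R.
have lam0 k : 0 < lam k by rewrite divr_gt0// mulr_gt0 ?expR_gt0.
pose c (k : nat) := M * expR (1 - k%:R) * expR n%:R.
have c0 k : 0 <= c k by rewrite !mulr_ge0 ?expR_ge0.
pose h (k : nat) (x : Rtuple R d) := ((c k)%:E * (expR (- (lam k * nsq x)))%:E)%E.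
have h0 k (x : Rtuple R d) : (0 <= h k x)%E by rewrite /h -EFinM lee_fin mulr_ge0 ?expR_ge0.
have mh k : measurable_fun setT (h k : Rtuple R d -> _).
  by apply: emeasurable_funM => //; exact: measurable_gauss.
have fh x : ((f x)%:E <= \big[+%E/0%E]_(0 <= k <oo) h k x)%E.
  have vr : f x * (nsq x / r ^+ 2) ^+ n <= M.
    by rewrite expr_div_n mulrA ler_pdivrMr ?exprn_gt0.
  have u0 : 0 <= nsq x / r ^+ 2 by rewrite divr_ge0 ?nsq_ge0 ?(ltW r20).
  have [k hk] := decay_le_gauss n0 u0 M0 (fM x) vr.
  apply: le_trans (nneseries_lim_ge k.+1 (fun i _ _ => h0 i x)).
  rewrite big_nat_recr//=; apply: (@le_trans _ _ (h k x)).
    rewrite /h -EFinM lee_fin; apply: (le_trans hk).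
    rewrite /c -[leRHS]mulrA -expRD le_eqVlt; apply/orP; left; apply/eqP.
    by congr (_ * expR _); rewrite /lam; ring.
  by rewrite leeDr// sume_ge0.
pose s := Num.sqrt (pi * r ^+ 2 / n%:R).
pose q := expR (- (1 - d%:R / n.*2%:R)) : R.
have n2R : 0 < n.*2%:R :> R by rewrite ltr0n double_gt0.
have hint k : (\int[m]_x h k x = (M * expR (n%:R + 1) * s ^+ d * q ^+ k)%R%:E)%E.
  rewrite ge0_integralZl//; [|exact: measurable_gauss|by rewrite lee_fin].
  rewrite integral_gauss// -EFinM; congr EFin.
  have -> : pi / lam k = pi * r ^+ 2 / n%:R * expR (k%:R / n%:R).
    by rewrite /lam expRN; field; rewrite !gt_eqF// expR_gt0.
  rewrite sqrtrM; last by apply: divr_ge0; rewrite ?(ltW nR)//; apply: mulr_ge0; rewrite ?pi_ge0 ?(ltW r20).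
  have -> : Num.sqrt (expR (k%:R / n%:R)) = expR (k%:R / n.*2%:R) :> R.
    rewrite -[X in Num.sqrt X](_ : expR (k%:R / n.*2%:R) ^+ 2 = _) ?sqrtr_sqr ?ger0_norm ?expR_ge0//.
    by rewrite -expRM_natl; congr expR; rewrite -muln2 natrM; field; rewrite gt_eqF.
  rewrite -/s /q exprMn -!expRM_natl /c.
  have -> : M * expR (1 - k%:R) * expR n%:R * (s ^+ d * expR (d%:R * (k%:R / n.*2%:R))) =
    M * s ^+ d * (expR (1 - k%:R) * expR n%:R * expR (d%:R * (k%:R / n.*2%:R))) by ring.
  have -> : forall a b, M * a * s ^+ d * b = M * s ^+ d * (a * b) by move=> a b; ring.
  by rewrite -!expRD; congr (_ * expR _); ring.
apply: (@le_trans _ _ (\int[m]_x (\big[+%E/0%E]_(0 <= k <oo) h k x))%E).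
  apply: ge0_le_integral => //.
  - by move=> x _; rewrite lee_fin.
  - exact/measurable_EFinP.
  - by apply: ge0_emeasurable_sum => // k x _ _; exact: h0.
rewrite integral_nneseries//.
apply: lime_le; first by apply: is_cvg_nneseries => k _ _; apply: integral_ge0 => x _; exact: h0.
apply: nearW => N; rewrite big_mkord.
under eq_bigr do rewrite hint.
rewrite sumEFin lee_fin -mulr_sumr ler_wpM2l ?mulr_ge0 ?expR_ge0 ?exprn_ge0 ?sqrtr_ge0//.
apply: geometric_sum_le; rewrite ?double_gt0 ?expR_ge0// ler_expR lerN2.
rewrite -(ler_pM2r n2R) mulVf ?gt_eqF// mulrBl mul1r divfK ?gt_eqF//.
have : (d%:R + 1 : R) <= n.*2%:R by rewrite natr1 ler_nat.
by clear; lra.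
Qed.

End Decay.

(** * The norm of the test function *)

Section TestNorm.
Variables (R : realType) (d p : nat).
Hypothesis p0 : (0 < p)%N.
Hypothesis dp : (d < 4 * p)%N.

Local Notation tf := (@test_fun R d p).

Definition test_norm_bound : R := (expR 1 * p.*2%:R) ^+ 2 * expR (p.*2%:R + 1) *
  Num.sqrt (pi * (4 * p.*2%:R * expR (- 1)) ^+ 2 / p.*2%:R) ^+ d * (p.*2.*2%:R + 1).

Let mtf : measurable_fun setT (fun x => normc (tf x)).
Proof.
rewrite (_ : (fun x => _) = (fun x => normc (test_ext p (rvec 1 x)))).
  by apply: measurable_entire_rvec; exact: entire_test_ext.
by apply/funext => x; rewrite /rvec scale1r.
Qed.

Let int_tf : (\int[lebesgueRn R d]_x (normc (tf x))%:E <= test_norm_bound%:E)%E.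
Proof.
apply: integral_decay => //.
- by move=> x; exact: normc_ge0.
- by rewrite double_gt0.
- lia.
- by rewrite !mulr_gt0 ?expR_gt0// ltr0n double_gt0.
- move=> x; have [g [-> gK _]] := test_fun_real p0 x.
  by rewrite normc_real (ger0_norm (sqr_ge0 _)) -real_normK ?num_real// lerXn2r ?nnegrE// mulr_ge0 ?expR_ge0.
- move=> x; have [g [-> _ gr]] := test_fun_real p0 x.
  by rewrite normc_real (ger0_norm (sqr_ge0 _)).
Qed.

Let integrable_tf : (lebesgueRn R d).-integrable setT (EFin \o (fun x => normc (tf x))).
Proof.
apply/integrableP; split; first exact/measurable_EFinP.
apply: le_lt_trans (ltry test_norm_bound); apply: le_trans int_tf.
rewrite le_eqVlt; apply/orP; left; apply/eqP; apply: eq_integral => x _ /=.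
by rewrite ger0_norm// normc_ge0.
Qed.

Lemma PW11_test_fun : PW11 tf.
Proof.
split; last by exists (test_ext p); split; [exact: entire_test_ext|exact: test_ext_type|].
split.
  rewrite (_ : (fun x => _) = EFin \o (fun x => normc (tf x))); first exact: integrable_tf.
  apply/funext => x; rewrite /comp; have [g [gE _ _]] := test_fun_real p0 x.
  by rewrite gE normc_real (ger0_norm (sqr_ge0 _)).
rewrite (_ : (fun x => _) = cst 0%E); first exact: integrable0.
apply/funext => x; have [g [gE _ _]] := test_fun_real p0 x.
by rewrite gE.
Qed.

Lemma L1norm_test_fun : L1norm tf <= test_norm_bound.
Proof.
by rewrite -lee_fin /L1norm /Rintegral fineK//; exact: integrable_fin_num.
Qed.

End TestNorm.

(** * Asymptotics *)

Section GammaBounds.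
Variable R : realType.
Local Notation mu := (@lebesgue_measure R).

Lemma powR_half (x : R) (d : nat) : 0 <= x -> x `^ (d%:R / 2) = Num.sqrt x ^+ d.
Proof. by move=> x0; rewrite mulrC powRrM powR12_sqrt// powR_mulrn// sqrtr_ge0. Qed.

(** With [y = t / (s + 1)], the bound [y <= exp (y - 1)] turns the integrand into a multiple of the
    exponential density of mean [s + 1]. *)
Lemma gamma_integrand_le (s t : R) : 0 < s -> 0 < t ->
  t `^ s * expR (- t) <= ((s + 1) `^ s * expR (- s) * (s + 1)) * exponential_pdf (s + 1)^-1 t.
Proof.
move=> s0 t0; have s1 : 0 < s + 1 by rewrite addr_gt0.
rewrite exponential_pdfE ?(ltW t0)// mulrA mulfK ?gt_eqF//.
pose y := t / (s + 1); have y0 : 0 < y by rewrite divr_gt0.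
have tE : t = (s + 1) * y by rewrite /y mulrCA divff ?mulr1// gt_eqF.
rewrite [- _ * t](_ : _ = - y); last by rewrite /y mulrC mulrN.
rewrite tE; clearbody y; clear tE t t0.
rewrite powRM ?(ltW s1) ?(ltW y0)// -!mulrA ler_wpM2l ?powR_ge0//.
have h : y `^ s <= expR ((y - 1) * s).
  rewrite expRM; apply: ge0_ler_powR; rewrite ?nnegrE ?(ltW s0) ?(ltW y0) ?expR_ge0//.
  by have := expR_ge1Dx (y - 1); rewrite addrC subrK.
apply: (le_trans (ler_wpM2r (expR_ge0 _) h)); rewrite -!expRD ler_expR.
by rewrite le_eqVlt; apply/orP; left; apply/eqP; ring.
Qed.

Lemma measurable_gamma_integrand (s : R) (D : set (measurableTypeR R)) :
  measurable_fun D (fun t : measurableTypeR R => (t `^ s * expR (- t))%R%:E).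
Proof.
apply: measurable_funTS; apply/measurable_EFinP; apply: measurable_funM.
  exact: measurable_powR.
by apply: measurableT_comp.
Qed.

Lemma gamma_integral_le (s : R) : 0 < s ->
  (\int[mu]_(t in `]0%R, +oo[) (t `^ s * expR (- t))%R%:E <=
   ((s + 1) `^ s * expR (- s) * (s + 1))%R%:E)%E.
Proof.
move=> s0; have s1 : 0 < s + 1 by rewrite addr_gt0.
have a0 : 0 < (s + 1)^-1 by rewrite invr_gt0.
set C := (s + 1) `^ s * _ * _.
have C0 : 0 <= C by rewrite !mulr_ge0 ?powR_ge0 ?expR_ge0 ?(ltW s1).
have mp := measurable_exponential_pdf (s + 1)^-1.
have pos (t : R) : (0 <= (exponential_pdf (s + 1)^-1 t)%:E)%E.
  by rewrite lee_fin exponential_pdf_ge0// ltW.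
apply: (@le_trans _ _ (\int[mu]_(t in `]0%R, +oo[) (C%:E * (exponential_pdf (s + 1)^-1 t)%:E))%E).
  apply: ge0_le_integral => //.
  - by move=> t _; rewrite lee_fin mulr_ge0 ?powR_ge0 ?expR_ge0.
  - exact: measurable_gamma_integrand.
  - apply: measurable_funTS; apply: emeasurable_funM => //; exact/measurable_EFinP.
  - by move=> t /=; rewrite in_itv/= andbT => t0; rewrite -EFinM lee_fin; exact: gamma_integrand_le.
rewrite ge0_integralZl//; last by apply: measurable_funTS; exact/measurable_EFinP.
rewrite -[leRHS]mule1 lee_wpmul2l// -(integral_exponential_pdf a0).
by apply: ge0_subset_integral => //; exact/measurable_EFinP.
Qed.

(** [Gamma] is a real-valued integral, so finiteness has to be known before it can be compared with
    the extended one. *)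
Lemma Gamma_fine (s : R) : 0 < s ->
  ((Gamma (s + 1))%R%:E = \int[mu]_(t in `]0%R, +oo[) (t `^ s * expR (- t))%R%:E)%E.
Proof.
move=> s0; rewrite /Gamma /Rintegral addrK fineK// ge0_fin_numE.
  by apply: le_lt_trans (gamma_integral_le s0) (ltry _).
by apply: integral_ge0 => t _; rewrite lee_fin mulr_ge0 ?powR_ge0 ?expR_ge0.
Qed.

Lemma Gamma_le (s : R) : 0 < s -> Gamma (s + 1) <= (s + 1) `^ s * expR (- s) * (s + 1).
Proof. by move=> s0; rewrite -lee_fin Gamma_fine//; exact: gamma_integral_le. Qed.

(** Only the unit interval to the right of [s], the maximum of the integrand, is kept. *)
Lemma Gamma_ge (s : R) : 0 < s -> s `^ s * expR (- (s + 1)) <= Gamma (s + 1).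
Proof.
move=> s0; rewrite -lee_fin Gamma_fine//.
apply: (@le_trans _ _ (\int[mu]_(t in `[s, (s + 1)%R]) (t `^ s * expR (- t))%R%:E)%E); last first.
  apply: ge0_subset_integral => //.
  - exact: measurable_gamma_integrand.
  - by move=> t _; rewrite lee_fin mulr_ge0 ?powR_ge0 ?expR_ge0.
  - by move=> t /=; rewrite !in_itv/= andbT => /andP[/(lt_le_trans s0)].
apply: (@le_trans _ _ (\int[mu]_(t in `[s, (s + 1)%R]) (s `^ s * expR (- (s + 1)))%R%:E)%E).
  rewrite integral_cst//= lebesgue_measure_itv/= lte_fin ltrDl ltr01 -EFinB -EFinM.
  by rewrite lee_fin addrAC subrr add0r mulr1.
apply: ge0_le_integral => //.
- by move=> t _; rewrite lee_fin mulr_ge0 ?powR_ge0 ?expR_ge0.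
- exact: measurable_gamma_integrand.
- move=> t /=; rewrite in_itv/= => /andP[st ts]; rewrite lee_fin ler_pM ?powR_ge0 ?expR_ge0//.
    by apply: ge0_ler_powR; rewrite ?nnegrE ?(ltW s0)// (le_trans (ltW s0)).
  by rewrite ler_expR lerN2.
Qed.

End GammaBounds.

(** * Comparison of the two estimates and the limit *)

Section Final.
Variable R : realType.

Lemma nikolskii_le d : (0 < d)%N ->
  nikolskii R d <= ((2 * expR (- (1 / 2)) * Num.sqrt (2 * pi * d%:R)) ^+ d)^-1.
Proof.
move=> d0; have dR : 0 < d%:R :> R by rewrite ltr0n.
have b0 : 0 < (2 * expR (- (1 / 2)) * Num.sqrt (2 * pi * d%:R) : R) ^+ d.
  by rewrite exprn_gt0// !mulr_gt0 ?expR_gt0 ?sqrtr_gt0 ?mulr_gt0 ?pi_gt0.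
rewrite /nikolskii; set S := (X in inf X).
suff H : (2 * expR (- (1 / 2)) * Num.sqrt (2 * pi * d%:R)) ^+ d <= inf S.
  by rewrite lef_pV2 ?posrE// (lt_le_trans b0).
apply: lb_le_inf.
  (* The infimum needs a member of the set; any [p] with [d < 4 * p] would do. *)
  exists (L1norm (@test_fun R d d)); exists (@test_fun R d d) => //; split; last exact: test_fun0.
  by apply: PW11_test_fun => //; lia.
by move=> _ [f [pf f0] <-]; exact: L1norm_ge.
Qed.

Lemma nikolskii_ge d p (B : R) : (0 < d)%N -> (0 < p)%N -> (d < 4 * p)%N ->
  L1norm (@test_fun R d p) <= B -> B^-1 <= nikolskii R d.
Proof.
move=> d0 p0 dp hB; have dR : 0 < d%:R :> R by rewrite ltr0n.
have b0 : 0 < (2 * expR (- (1 / 2)) * Num.sqrt (2 * pi * d%:R) : R) ^+ d.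
  by rewrite exprn_gt0// !mulr_gt0 ?expR_gt0 ?sqrtr_gt0 ?mulr_gt0 ?pi_gt0.
rewrite /nikolskii; set S := (X in inf X).
have St : S (L1norm (@test_fun R d p)).
  exists (@test_fun R d p) => //; split; last exact: test_fun0.
  exact: PW11_test_fun.
have Sl : lbound S ((2 * expR (- (1 / 2)) * Num.sqrt (2 * pi * d%:R)) ^+ d).
  by move=> _ [f [pf f0] <-]; exact: L1norm_ge.
have iB : inf S <= B by apply: le_trans hB; apply: ge_inf => //; eexists; exact: Sl.
(* Since [0^-1 = 0], inversion reverses the inequality only once the infimum is known to be
   positive. *)
have i0 : 0 < inf S.
  by apply: (lt_le_trans b0); apply: lb_le_inf => //; eexists; exact: St.
by rewrite lef_pV2 ?posrE// (lt_le_trans i0).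
Qed.

Lemma normalized_nikolskiiE d :
  normalized_nikolskii R d = (2 * Num.sqrt pi) ^+ d * Gamma (d%:R / 2 + 1) * nikolskii R d.
Proof.
have w0 : Num.sqrt pi != 0 :> R by rewrite gt_eqF// sqrtr_gt0 pi_gt0.
rewrite /normalized_nikolskii /unit_ball_volume powR_half ?pi_ge0//.
rewrite [X in 2 * X](_ : pi = Num.sqrt pi * Num.sqrt pi); last first.
  by rewrite -expr2 sqr_sqrtr// pi_ge0.
move: (Num.sqrt pi) w0 => w w0; rewrite !exprMn invf_div; congr (_ * _).
by field; rewrite expf_neq0.
Qed.

(** Turns every polynomial factor in [d] into [exp (c sqrt d)]. *)
Lemma le_expR_sqrt (x : R) : 0 <= x -> x <= expR (2 * Num.sqrt x).
Proof.
move=> x0; rewrite (expRM_natl 2) -[leLHS]sqr_sqrtr// lerXn2r ?nnegrE ?sqrtr_ge0 ?expR_ge0//.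
by apply: le_trans (expR_ge1Dx _); rewrite lerDr.
Qed.

Lemma sqrt_expR_le (x : R) d : (0 < d)%N -> 0 <= x ->
  Num.sqrt (1 + x / d%:R) ^+ d <= expR (x / 2).
Proof.
move=> d0 x0; have dR : 0 < d%:R :> R by rewrite ltr0n.
have -> : x / 2 = d%:R * (x / 2 / d%:R) by field; rewrite gt_eqF.
rewrite expRM_natl lerXn2r ?nnegrE ?sqrtr_ge0 ?expR_ge0//.
rewrite -[leRHS]ger0_norm ?expR_ge0// -sqrtr_sqr ler_wsqrtr// -expRM_natl.
by apply: le_trans (expR_ge1Dx _); rewrite lerD2l le_eqVlt; apply/orP; left; apply/eqP; field; rewrite gt_eqF.
Qed.

Lemma normalized_nikolskii_le d : (0 < d)%N ->
  normalized_nikolskii R d <= 2^-1 ^+ d * expR (26 * Num.sqrt d%:R).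
Proof.
move=> d0; have dR : 1 <= d%:R :> R by rewrite (ler_nat _ 1).
have dR0 : 0 < d%:R :> R by apply: lt_le_trans dR.
have s1 : 1 <= Num.sqrt d%:R :> R by rewrite -[leLHS]sqrtr1 ler_wsqrtr.
have h0 : 0 < d%:R / 2 :> R by rewrite divr_gt0.
have w0 : 0 < Num.sqrt pi :> R by rewrite sqrtr_gt0 pi_gt0.
have v0 : 0 < Num.sqrt (2 * d%:R) :> R by rewrite sqrtr_gt0 mulr_gt0.
have e0 : 0 < expR (- (1 / 2)) :> R by exact: expR_gt0.
have hG : Gamma (d%:R / 2 + 1) <= (2^-1 * Num.sqrt (2 * d%:R) * expR (- (1 / 2))) ^+ d *
    expR (1 + 4 * Num.sqrt d%:R) :> R.
  apply: (le_trans (Gamma_le h0)).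
  rewrite powR_half ?addr_ge0 ?(ltW h0)//.
  have -> : d%:R / 2 + 1 = (2^-1) ^+ 2 * (2 * d%:R) * (1 + 2 / d%:R) :> R.
    by field; rewrite gt_eqF.
  rewrite [in leLHS]sqrtrM ?mulr_ge0// [in leLHS]sqrtrM ?exprn_ge0// sqrtr_sqr ger0_norm//.
  rewrite [_ ^+ d]exprMn [X in _ <= X * _]exprMn.
  have -> : expR (- (d%:R / 2)) = expR (- (1 / 2)) ^+ d :> R by rewrite -expRM_natl; congr expR; ring.
  rewrite expRD.
  set A := (2^-1 * _) ^+ d; set E := expR (- (1 / 2)) ^+ d.
  have -> : forall a b, A * a * E * b = A * E * (a * b) by move=> a b; ring.
  rewrite ler_wpM2l ?mulr_ge0 ?exprn_ge0 ?mulr_ge0 ?sqrtr_ge0 ?expR_ge0//.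
  rewrite ler_pM ?exprn_ge0 ?sqrtr_ge0 ?mulr_ge0 ?addr_ge0 ?divr_ge0//.
    by apply: (le_trans (sqrt_expR_le d0 _)) => //; rewrite ler_expR; lra.
  apply: (@le_trans _ _ (4 * d%:R)).
    rewrite (_ : _ * _ = d%:R / 2 + 1); first by clear -dR; lra.
    by field; rewrite gt_eqF.
  apply: (le_trans (le_expR_sqrt _)); first by rewrite mulr_ge0.
  rewrite ler_expR sqrtrM// (_ : Num.sqrt 4 = 2); first by clear; lra.
  by rewrite [4](_ : _ = 2 ^+ 2) ?sqrtr_sqr ?ger0_norm//; ring.
rewrite normalized_nikolskiiE.
apply: (le_trans (ler_wpM2l _ (nikolskii_le d0))).
  rewrite mulr_ge0 ?exprn_ge0 ?mulr_ge0 ?(ltW w0)//.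
  by apply: le_trans (Gamma_ge h0); rewrite mulr_ge0 ?powR_ge0 ?expR_ge0.
rewrite ler_pdivrMr; last first.
  by rewrite exprn_gt0// !mulr_gt0 ?sqrtr_gt0 ?mulr_gt0 ?pi_gt0.
apply: (le_trans (ler_wpM2l _ hG)); first by rewrite exprn_ge0// mulr_ge0// ltW.
rewrite (_ : 2 * pi * d%:R = pi * (2 * d%:R)); last by ring.
rewrite (sqrtrM _ (pi_ge0 R)) [leLHS]mulrA -exprMn.
rewrite [leRHS]mulrAC -exprMn.
have -> : 2^-1 * (2 * expR (- (1 / 2)) * (Num.sqrt pi * Num.sqrt (2 * d%:R))) =
  2 * Num.sqrt pi * (2^-1 * Num.sqrt (2 * d%:R) * expR (- (1 / 2))) :> R by field.
rewrite ler_wpM2l ?exprn_ge0 ?mulr_ge0 ?(ltW w0) ?(ltW v0) ?(ltW e0)// ler_expR.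
by clear -s1; lra.
Qed.

(** The constant is [26 = 18 + 8]: the polynomial factors cost [18 s], and the additive constants of
    the exponents sum to 8, at most [8 s]. *)
Lemma normalized_nikolskii_ge d : (0 < d)%N ->
  2^-1 ^+ d * expR (- (26 * Num.sqrt d%:R)) <= normalized_nikolskii R d.
Proof.
move=> d0; have dR : 1 <= d%:R :> R by rewrite (ler_nat _ 1).
have dR0 : 0 < d%:R :> R by apply: lt_le_trans dR.
set s := Num.sqrt d%:R.
have s1 : 1 <= s by rewrite /s -[leLHS]sqrtr1 ler_wsqrtr.
pose h : R := d%:R / 2; have h0 : 0 < h by rewrite divr_gt0.
have w0 : 0 < Num.sqrt pi :> R by rewrite sqrtr_gt0 pi_gt0.
(* The least [p] with [d < 4 p]; then [n = 2 p] exceeds [d / 2] by at most 2. *)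
have [p [p0 dp np]] : exists p, [/\ (0 < p)%N, (d < 4 * p)%N & (p.*2 * 2 <= d + 4)%N].
  by exists (d %/ 4).+1; split; lia.
have hB := L1norm_test_fun R p0 dp; rewrite /test_norm_bound in hB.
have hN B := @nikolskii_ge d p B d0 p0 dp.
have : (0 < p.*2)%N by rewrite double_gt0.
move: p.*2 np hB => n np hB n0.
have nR : 0 < n%:R :> R by rewrite ltr0n.
have nh : n%:R <= h + 2 :> R.
  by move: np; rewrite -(ler_nat R) natrM natrD /h; clear; lra.
set B := (X in _ <= X) in hB.
have sn : Num.sqrt (pi * (4 * n%:R * expR (- 1)) ^+ 2 / n%:R) =
    4 * Num.sqrt pi * Num.sqrt n%:R * expR (- 1) :> R.
  rewrite (_ : _ / _ = (4 * expR (- 1)) ^+ 2 * (pi * n%:R)); last by field; rewrite gt_eqF.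
  rewrite sqrtrM ?sqr_ge0// sqrtr_sqr ger0_norm ?mulr_ge0 ?expR_ge0// sqrtrM ?pi_ge0//.
  by ring.
have nd : Num.sqrt n%:R ^+ d <= Num.sqrt h ^+ d * expR 2.
  have n4 : n%:R <= h * (1 + 4 / d%:R).
    by apply: (le_trans nh); rewrite le_eqVlt /h; apply/orP; left; apply/eqP; field; rewrite gt_eqF.
  apply: (@le_trans _ _ ((Num.sqrt h * Num.sqrt (1 + 4 / d%:R)) ^+ d)).
    by rewrite lerXn2r ?nnegrE ?mulr_ge0 ?sqrtr_ge0// -sqrtrM ?(ltW h0)// ler_wsqrtr.
  rewrite exprMn ler_wpM2l ?exprn_ge0 ?sqrtr_ge0//.
  by apply: (le_trans (sqrt_expR_le d0 _)) => //; rewrite ler_expR; clear; lra.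
(* Both [n] and [2 n + 1 <= d + 5] are at most [6 d], so three such factors give [exp (18 s)]. *)
have h26 : 6 * d%:R <= expR (6 * s).
  apply: (le_trans (le_expR_sqrt _)); first by rewrite mulr_ge0.
  rewrite ler_expR sqrtrM// -/s mulrA ler_wpM2r ?(le_trans ler01 s1)//.
  rewrite [leRHS](_ : _ = 2 * Num.sqrt (3 ^+ 2) :> R); last by rewrite sqrtr_sqr ger0_norm//; ring.
  by rewrite ler_wpM2l// ler_wsqrtr//; lra.
have poly : (expR 1 * n%:R) ^+ 2 * (n.*2%:R + 1) <= expR (2 + 18 * s) :> R.
  have -> : expR (2 + 18 * s) = expR 1 ^+ 2 * (expR (6 * s)) ^+ 3.
    by rewrite -!expRM_natl -expRD; congr expR; ring.
  rewrite exprMn -mulrA ler_wpM2l ?exprn_ge0 ?expR_ge0//.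
  rewrite (_ : 3 = 2 + 1)%N// exprD expr1 ler_pM ?exprn_ge0 ?addr_ge0//.
    rewrite lerXn2r ?nnegrE ?expR_ge0//; apply: le_trans h26; apply: (le_trans nh).
    by rewrite /h; clear -dR; lra.
  apply: le_trans h26; rewrite -muln2 natrM; move: nh; rewrite /h; clear -dR; lra.
pose w4 : R := 4 * Num.sqrt pi.
have w40 : 0 <= w4 by rewrite mulr_ge0// ltW.
have BB : B <= expR (2 + 18 * s) * (expR (h + 3) * (w4 ^+ d * (Num.sqrt h ^+ d * expR 2) * expR (- (2 * h)))).
  rewrite /B sn.
  have -> : (4 * Num.sqrt pi * Num.sqrt n%:R * expR (- 1)) ^+ d =
     w4 ^+ d * Num.sqrt n%:R ^+ d * expR (- (2 * h)) :> R.
    rewrite -/w4 !exprMn; congr (_ * _ * _).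
    by rewrite -expRM_natl; congr expR; rewrite /h; field.
  have -> : forall a b c e : R, a * b * c * e = a * e * (b * c) by move=> *; ring.
  rewrite ler_pM ?mulr_ge0 ?exprn_ge0 ?mulr_ge0 ?addr_ge0 ?expR_ge0 ?sqrtr_ge0//.
  rewrite ler_pM ?mulr_ge0 ?exprn_ge0 ?mulr_ge0 ?addr_ge0 ?expR_ge0 ?sqrtr_ge0//.
    by rewrite ler_expR; move: nh; clear; lra.
  by rewrite ler_wpM2r ?expR_ge0// ler_wpM2l ?exprn_ge0.
have B0 : 0 < B.
  rewrite /B sn; apply: mulr_gt0; last by rewrite addr_gt0// ltr0n double_gt0.
  apply: mulr_gt0; first by rewrite mulr_gt0 ?exprn_gt0 ?mulr_gt0 ?expR_gt0.
  by rewrite exprn_gt0// !mulr_gt0 ?expR_gt0// sqrtr_gt0.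
have hG : Num.sqrt h ^+ d * expR (- (h + 1)) <= Gamma (h + 1).
  by rewrite -powR_half ?(ltW h0)//; exact: Gamma_ge.
rewrite normalized_nikolskiiE -/h.
have c0 : 0 <= (2 * Num.sqrt pi) ^+ d :> R by rewrite exprn_ge0// mulr_ge0// ltW.
apply: (@le_trans _ _ ((2 * Num.sqrt pi) ^+ d * (Num.sqrt h ^+ d * expR (- (h + 1))) * B^-1)); last first.
  rewrite ler_pM ?mulr_ge0 ?invr_ge0 ?(ltW B0) ?exprn_ge0 ?sqrtr_ge0 ?expR_ge0//.
    by rewrite ler_wpM2l.
  exact: hN.
rewrite ler_pdivlMr//; apply: (le_trans (ler_wpM2l _ BB)).
  by rewrite mulr_ge0 ?exprn_ge0 ?expR_ge0.
have -> : w4 ^+ d = 2 ^+ d * (2 * Num.sqrt pi) ^+ d by rewrite -exprMn /w4; congr (_ ^+ _); ring.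
move: ((2 * Num.sqrt pi) ^+ d) (Num.sqrt h ^+ d) c0 (exprn_ge0 d (sqrtr_ge0 h)) => c q c0 q0.
have -> : 2^-1 ^+ d * expR (- (26 * s)) *
    (expR (2 + 18 * s) * (expR (h + 3) * (2 ^+ d * c * (q * expR 2) * expR (- (2 * h))))) =
  c * q * (expR (- (26 * s)) * expR (2 + 18 * s) * expR (h + 3) * expR 2 * expR (- (2 * h))) :> R.
  by rewrite exprVn; field; rewrite expf_neq0.
rewrite -!expRD mulrA ler_wpM2l ?mulr_ge0// ler_expR.
by clear -s1; lra.
Qed.

End Final.

Theorem corollary1 (R : realType) :
  (fun d : nat => normalized_nikolskii R d `^ (d%:R)^-1) @ \oo --> (2^-1 : R).
Proof.
(* The [d]-th root turns a correction [exp (a sqrt d)] into [exp (a / sqrt d)], which tends to 1. *)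
have root d (a : R) : (0 < d)%N ->
    (2^-1 ^+ d * expR (a * Num.sqrt d%:R)) `^ (d%:R)^-1 = 2^-1 * expR (a / Num.sqrt d%:R) :> R.
  move=> d0; have dR : 0 < d%:R :> R by rewrite ltr0n.
  have -> : a * Num.sqrt d%:R = d%:R * (a / Num.sqrt d%:R).
    rewrite -[X in X * (_ / _)]sqr_sqrtr//; field.
    by rewrite gt_eqF// sqrtr_gt0.
  rewrite expRM_natl -exprMn -powR_mulrn ?mulr_ge0 ?expR_ge0// -powRrM divff ?gt_eqF//.
  by rewrite powRr1// mulr_ge0 ?expR_ge0.
have lim (a : R) : (fun d : nat => 2^-1 * expR (a / Num.sqrt d%:R)) @ \oo --> (2^-1 : R).
  have -> : (fun d : nat => 2^-1 * expR (a / Num.sqrt d%:R)) =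
      (fun d : nat => 2^-1 * expR (a * Num.sqrt (d%:R^-1))).
    by apply/funext => d; rewrite sqrtrV.
  rewrite [X in _ --> X](_ : _ = 2^-1 * expR (a * Num.sqrt 0)); last by rewrite sqrtr0 mulr0 expR0 mulr1.
  apply: cvgMl_tmp; apply: continuous_cvg; first exact: continuous_expR.
  apply: cvgMl_tmp; apply: continuous_cvg; first exact: sqrt_continuous.
  apply/gtr0_cvgV0; last exact: cvgr_idn.
  by exists 1%N => // d /= d0; rewrite ltr0n.
apply: (squeeze_cvgr _ (lim (- 26)) (lim 26)).
exists 1%N => // d /= d0; rewrite -!root//.
have p0 (a : R) : 0 <= 2^-1 ^+ d * expR (a * Num.sqrt d%:R).
  by rewrite mulr_ge0 ?exprn_ge0 ?expR_ge0.
have l := normalized_nikolskii_ge R d0; have u := normalized_nikolskii_le R d0.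
rewrite -mulNr in l; have l0 := le_trans (p0 _) l.
by rewrite !ge0_ler_powR ?nnegrE ?p0 ?(le_trans l0 u).
Qed.
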